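(* Let $n\ge1$ and let $\gamma$ be the standard Gaussian measure on $\mathbb R^n$. For all $t>0$, $a\in\mathbb R$ and $1<q_1<q_2$ satisfying $$q_2-1=e^{2t}\,(q_1e^{-a}-1),$$ one has $$\|N_tf\|_{L^{q_2}(d\gamma)}\le M^{n/2}\,\|T_{-a}f\|_{L^{q_1}(d\gamma)}$$ for all measurable functions $f$ on $\mathbb R^n$ such that the right-hand side is finite, where $$M=\left(\frac{q_1-1}{e^{-2t}}\right)^{1-1/q_1}\left(\frac{q_2-1}{e^{-a}}\right)^{1/q_2-1}\left(\frac{1-e^{-2t}}{q_2-q_1}\right)^{1/q_2-1/q_1}.$$
   Context: $(N_t)_{t\ge0}$ is the Ornstein-Uhlenbeck semigroup on $\mathbb R^n$, $N_tf(x)=E\big(f(e^{-t}x+\sqrt{1-e^{-2t}}\,Y)\big)$ where $Y$ has law $\gamma$. For $b\in\mathbb R$, $T_b$ is the dilation operator $T_bf(x)=f(e^{b/2}x)$. $\|f\|_{L^q(d\gamma)}=(\int|f|^q\,d\gamma)^{1/q}$. *)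

(* Defs.v *)
From HB Require Import structures.
From mathcomp Require Import all_boot all_order all_algebra.
From mathcomp Require Import all_classical all_reals all_analysis.

Set Implicit Arguments.
Unset Strict Implicit.
Unset Printing Implicit Defensive.

Import Order.TTheory GRing.Theory Num.Theory.
Import numFieldNormedType.Exports.

Local Open Scope classical_set_scope.
Local Open Scope ring_scope.

(* R^n is n.-tuple R, whose measurable structure is the product of the Borel
   sigma-algebras of the coordinates, i.e. the Borel sigma-algebra of R^n. *)

Section cons_tuple.
Context {R : realType} (n : nat).

Definition cons_pair (p : measurableTypeR R * n.-tuple R) : n.+1.-tuple R :=
  [tuple of p.1 :: p.2].

Lemma measurable_cons_pair : measurable_fun setT cons_pair.
Proof.
apply: (@measurable_cons _ _ _ R fst n snd); last exact: measurable_snd.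
exact: measurable_fst.
Qed.

HB.instance Definition _ :=
  isMeasurableFun.Build _ _ _ _ cons_pair measurable_cons_pair.

End cons_tuple.

(* The n-fold product of N(0, 1), built by transporting the binary product
   along R * R^n ~ R^n.+1; stdGaussian_box below characterizes it. *)
Fixpoint stdGaussian (R : realType) (n : nat) : probability (n.-tuple R) R :=
  if n is m.+1
  then distribution (normal_prob (0 : R) 1 \x stdGaussian R m)%E (@cons_pair R m)
  else dirac [tuple].

Lemma stdGaussian_box (R : realType) (n : nat) (A : 'I_n -> set R) :
  (forall i, measurable (A i)) ->
  stdGaussian R n [set x | forall i, A i (tnth x i)] =
  (\prod_(i < n) normal_prob (0 : R) 1 (A i))%E.
Proof.
elim: n A => [|n IHn] A mA.
  rewrite big_ord0 /= diracE mem_set//= => -[].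
  by [].
rewrite big_ord_recl -IHn//= /distribution /pushforward.
rewrite -product_measure1E//; last first.
  rewrite (_ : mkset _ = \bigcap_(i in [set: 'I_n])
    ((fun x : n.-tuple R => tnth x i) @^-1` A (lift ord0 i))); last first.
    by apply/seteqP; split=> [x xA i _|x xA i]; [exact: xA|exact: (xA i)].
  apply: fin_bigcap_measurable => // i _.
  by rewrite -[X in measurable X]setTI; exact: measurable_tnth.
  exact: (mA ord0).
congr (_ _); apply/seteqP; split=> [[x y] /= xyA|[x y] /= [xA yA] i].
  split=> [|i]; first exact: (xyA ord0).
  by have := xyA (lift ord0 i); rewrite tnthS.
by case: (unliftP ord0 i) => [j|] -> //=; rewrite tnthS.
Qed.

(* Extended-real valued, so that it is total in f and x: if the positive or the
   negative part of the integrand has infinite expectation, then the value is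
   +oo or -oo, and a finite value means that the integrand is integrable. *)
Definition ornsteinUhlenbeck (R : realType) (n : nat) (t : R)
    (f : n.-tuple R -> R) (x : n.-tuple R) : \bar R :=
  ('E_(stdGaussian R n) [fun y =>
     (f [tuple expR (- t) * tnth x i
               + Num.sqrt (1 - expR (- (2 * t))) * tnth y i | i < n])%R])%E.

Definition dilation (R : realType) (n : nat) (b : R)
    (f : n.-tuple R -> R) (x : n.-tuple R) : R :=
  f [tuple expR (b / 2) * tnth x i | i < n].

(* Main.v *)
From HB Require Import structures.
Require Import Defs.
From mathcomp Require Import all_boot all_order all_algebra.
From mathcomp Require Import all_classical all_reals all_analysis.
From mathcomp Require Import measurable_realfun.
From mathcomp Require Import ring lra.

Import Order.TTheory GRing.Theory Num.Theory.
Import numFieldNormedType.Exports.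
Local Open Scope classical_set_scope.
Local Open Scope ring_scope.

(** The inequality is Nelson's hypercontractivity theorem on the line, seen
    through two dilations, then tensorized and dualized.

    Nelson's theorem is used in bilinear form [nelson]: if X and Z are
    independent standard Gaussian variables, r^2 + s^2 = 1 and
    r^2 / (p q) <= (1 - 1/p) (1 - 1/q), then E (H(X) F(r X + s Z)) is at most
    the L^q norm of H times the L^p norm of F. It follows from an infinitesimal
    statement. For functions bounded below by a positive constant and with a
    uniform second order Taylor bound, the expectation of
    h(a + e X)^be f(b + e (r X + s Z))^al exceeds the product of the powers of
    the averages of h and f by at most K e^3, because the second order terms
    form a quadratic form that the hypothesis on r makes nonpositive
    [gauss_step]. A standard Gaussian vector is the normalized sum of two
    independent copies, and averaging preserves the class of functions with its
    constants, so an estimate with step e / sqrt 2 and error K' yields one with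
    step e and error 2 K' [step_bound_double]. Starting from the step 2^(-k/2),
    k doublings leave an error of order 2^k 2^(-3k/2), which tends to 0
    [nelson_smooth]. Gaussian mollification [mollified_smooth] makes this class
    dense in the bounded functions [smooth_dense], and truncation removes the
    bound.

    The density of the joint law of X and e^(-t) X + sqrt (1 - e^(-2t)) Z is the
    exponential of a quadratic form. With suitable dilations of the two
    variables, and Gaussian weights that have no effect on the norms except for
    a factor, it becomes the corresponding density for a pair (r, s) that is
    extremal in Nelson's theorem [normal_kernel_scaling]: three coefficients of
    the quadratic form have to match for two dilations, and the relation between
    q1, q2, a and t is the condition that makes this possible. The Jacobians
    give the constant M^(1/2) per coordinate [line_inequality].

    An inequality between bilinear integrals and norms passes to products of
    measures by induction on the number of factors [tensorized], and by duality
    [norm_le_dual] it gives the bound on the norm of N_t |f|, which dominates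
    that of N_t f. *)

(** * One-dimensional Gaussian integrals *)

Section gaussian_line.
Context {R : realType}.
Local Notation leb := (@lebesgue_measure R).
Local Notation gam := (normal_prob (0 : R) 1).
Local Open Scope ereal_scope.

Lemma ge0_integral_normal_prob (m s : R) (f : R -> \bar R) :
  measurable_fun [set: R] f -> (forall x, 0 <= f x) ->
  \int[normal_prob m s]_x f x = \int[leb]_x (f x * (normal_pdf m s x)%:E).
Proof.
move=> mf f0.
have dom := normal_prob_dominates m s.
rewrite -(Radon_Nikodym_SigmaFinite.change_of_variables dom f0 measurableT mf).
apply: ae_eq_integral => //.
- apply: emeasurable_funM => //.
  exact: measurable_int (Radon_Nikodym_SigmaFinite.f_integrable dom).
- apply: emeasurable_funM => //; apply/measurable_EFinP.
  exact: measurable_normal_pdf.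
- apply: ae_eqe_mul2l => /=; apply: integral_ae_eq => //=.
  + exact: Radon_Nikodym_SigmaFinite.f_integrable.
  + by apply/measurable_EFinP; exact: measurable_normal_pdf.
  + by move=> E _ mE; rewrite -Radon_Nikodym_SigmaFinite.f_integral.
Qed.

Definition affine (c d : R) (x : measurableTypeR R) : measurableTypeR R :=
  (c * x + d)%R.

Lemma measurable_affine (c d : R) : measurable_fun setT (affine c d).
Proof. by apply: measurable_funD => //; exact: measurable_funM. Qed.

Lemma lebesgue_measure_affine (c d : R) (A : set (measurableTypeR R)) :
  (0 < c)%R -> measurable A ->
  leb A = c%:E * pushforward leb (affine c d) A.
Proof.
move=> c0 mA.
pose nu :=
  mscale (NngNum (ltW c0)) (pushforward leb (affine c d)).
rewrite (@lebesgue_measure_unique R (nu (measurable_affine c d))) //.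
move=> _ [[a b] _ <-] /=.
rewrite /nu /mscale /= /pushforward /=.
have -> : affine c d @^-1` `]a, b]%classic =
    [set` `](a - d) / c, (b - d) / c]%R].
  apply/seteqP; split=> x /=; rewrite !in_itv/= ltr_pdivrMr// ler_pdivlMr//;
    by rewrite ltrBlDr lerBrDr (mulrC x).
rewrite !lebesgue_measure_itv/= !lte_fin ltr_pM2r ?invr_gt0// ltrD2r.
case: ifPn => _; last by rewrite mule0.
rewrite -!EFinD -EFinM; congr (_%:E).
by field; rewrite gt_eqF.
Qed.

Lemma ge0_integral_lebesgue_affine (c d : R) (f : R -> \bar R) : (0 < c)%R ->
  measurable_fun [set: R] f -> (forall x, 0 <= f x) ->
  \int[leb]_x f x = c%:E * \int[leb]_x f (c * x + d)%R.
Proof.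
move=> c0 mf f0.
have := @ge0_integral_pushforward _ _ _ _ R _ (measurable_affine c d) leb setT f
  measurableT mf (fun y _ => f0 y).
rewrite preimage_setT => <-.
pose nu := (pushforward leb (affine c d) : {measure set _ -> \bar R}).
rewrite -[RHS](@ge0_integral_mscale _ _ R (nu (measurable_affine c d)) setT
  measurableT (NngNum (ltW c0)) f mf (fun x _ => f0 x)).
apply: eq_measure_integral => A mA _ /=.
exact: lebesgue_measure_affine.
Qed.

Lemma ge0_integral_normal_affine (m s : R) (f : R -> \bar R) : (0 < s)%R ->
  measurable_fun [set: R] f -> (forall x, 0 <= f x) ->
  \int[gam]_y f (m + s * y)%R = \int[leb]_z (f z * (normal_pdf m s z)%:E).
Proof.
move=> s0 mf f0.
have mfa : measurable_fun [set: R] (fun y : R => f (m + s * y)%R).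
  by apply: (measurableT_comp mf); exact: measurable_funD.
rewrite ge0_integral_normal_prob => [|//|x]; last by [].
rewrite [RHS](ge0_integral_lebesgue_affine s m _ s0); last 2 first.
- apply: emeasurable_funM => //; apply/measurable_EFinP.
  exact: measurable_normal_pdf.
- by move=> x; rewrite mule_ge0// lee_fin normal_pdf_ge0.
rewrite -ge0_integralZl//; last 3 first.
- apply: emeasurable_funM => //.
    by apply: (measurableT_comp mf); exact: (measurable_affine s m).
  apply/measurable_EFinP.
  apply: (measurableT_comp (measurable_normal_pdf m s)).
  exact: (measurable_affine s m).
- by move=> x _; rewrite mule_ge0// lee_fin normal_pdf_ge0.
- by rewrite lee_fin ltW.
apply: eq_integral => x _.
rewrite muleCA (addrC m); congr (_ * _); rewrite -EFinM; congr (_%:E).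
rewrite !normal_pdfE ?oner_eq0 ?gt_eqF// /normal_peak /normal_fun.
rewrite mulrA; congr (_ * expR _)%R; last first.
  by rewrite subr0 addrK; field; rewrite gt_eqF.
rewrite expr1n mul1r -mulrnAr sqrtrM ?sqr_ge0// sqrtr_sqr gtr0_norm//.
by rewrite invfM mulrA divff ?mul1r// gt_eqF.
Qed.

(** The joint density of X and a X + b Z is symmetric: both have law N(0, 1) and
    covariance a. *)
Lemma normal_pdf_rotation (a b x z : R) : (0 < b)%R -> (a ^+ 2 + b ^+ 2 = 1)%R ->
  (normal_pdf 0 1 x * normal_pdf (a * x) b z =
   normal_pdf 0 1 z * normal_pdf (a * z) b x)%R.
Proof.
move=> b0 ab; rewrite !normal_pdfE ?oner_eq0 ?gt_eqF// /normal_fun.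
rewrite !mulrA -!(mulrAC _ (normal_peak b)) -![in LHS]mulrA -![in RHS]mulrA -!expRD.
congr (_ * (_ * expR _))%R.
have a2 : (a ^+ 2 = 1 - b ^+ 2)%R by rewrite -ab addrK.
have bn0 : b != 0%R by rewrite gt_eqF.
rewrite !subr0 expr1n.
have -> : ((z - a * x) ^+ 2 = z ^+ 2 - a * x * z *+ 2 + (1 - b ^+ 2) * x ^+ 2)%R.
  by rewrite -a2; ring.
have -> : ((x - a * z) ^+ 2 = x ^+ 2 - a * x * z *+ 2 + (1 - b ^+ 2) * z ^+ 2)%R.
  by rewrite -a2; ring.
by field.
Qed.

(** After the symmetry [normal_pdf_rotation] and an exchange of the integrals, the
    inner integral is that of a probability density. *)
Lemma ge0_integral_normal_rotation (a b : R) (g : R -> \bar R) :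
  (0 < b)%R -> (a ^+ 2 + b ^+ 2 = 1)%R ->
  measurable_fun [set: R] g -> (forall x, 0 <= g x) ->
  \int[gam]_x \int[gam]_y g (a * x + b * y)%R = \int[gam]_z g z.
Proof.
move=> b0 ab mg g0.
under eq_integral do rewrite ge0_integral_normal_affine//.
have mpdf : measurable_fun [set: R * R] (fun p : R * R => (normal_pdf (a * p.1) b p.2)).
  rewrite (_ : (fun _ => _) = (fun p : R * R => normal_pdf 0 b (p.2 - a * p.1))%R).
    apply: (measurableT_comp (measurable_normal_pdf 0 b)).
    by apply: measurable_funB => //; exact: measurable_funM.
  apply/funext => p; rewrite !normal_pdfE ?gt_eqF//.
  by rewrite /normal_fun subr0.
have mF : measurable_fun [set: R * R]
    (fun p : R * R => g p.2 * (normal_pdf (a * p.1) b p.2)%:E).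
  apply: emeasurable_funM; first exact: (measurableT_comp mg).
  exact/measurable_EFinP.
rewrite [LHS]ge0_integral_normal_prob; last 2 first.
- apply: (@measurable_fun_fubini_tonelli_F _ _ _ _ R leb _ mF) => q.
  by rewrite mule_ge0// lee_fin normal_pdf_ge0.
- by move=> x; apply: integral_ge0 => z _; rewrite mule_ge0// lee_fin normal_pdf_ge0.
have pdf0 m s x : 0 <= (normal_pdf m s x)%:E by rewrite lee_fin normal_pdf_ge0.
have mpdf1 m s : measurable_fun [set: R] (fun x => (normal_pdf m s x)%:E).
  by apply/measurable_EFinP; exact: measurable_normal_pdf.
have mFx x : measurable_fun [set: R] (fun z => g z * (normal_pdf (a * x) b z)%:E).
  exact: emeasurable_funM.
transitivity (\int[leb]_x \int[leb]_z
    (g z * (normal_pdf 0 1 z)%:E * (normal_pdf (a * z) b x)%:E)).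
  apply: eq_integral => x _; rewrite -ge0_integralZr; [|by []|exact: mFx|by move=> z _; rewrite mule_ge0|exact: pdf0].
  by apply: eq_integral => z _; rewrite -!muleA -!EFinM (mulrC (normal_pdf (a * x) b z))
      normal_pdf_rotation.
pose G (p : R * R) :=
  g p.2 * (normal_pdf 0 1 p.2)%:E * (normal_pdf (a * p.2) b p.1)%:E.
have mG : measurable_fun [set: R * R] G.
  apply: emeasurable_funM; first apply: emeasurable_funM.
  - exact: (measurableT_comp mg).
  - exact: (measurableT_comp (mpdf1 0%R 1%R)).
  - apply/measurable_EFinP.
    have := @measurableT_comp _ _ _ _ _ _ _ _ _ mpdf (@measurable_swap _ _ R R).
    exact.
have G0 p : 0 <= G p by rewrite !mule_ge0.
rewrite [LHS](@fubini_tonelli _ _ _ _ R leb leb G mG G0) /G/=.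
rewrite [RHS]ge0_integral_normal_prob; [|exact: mg|exact: g0].
apply: eq_integral => z _; rewrite ge0_integralZl.
- by rewrite integral_normal_pdf mule1.
- by [].
- exact: mpdf1.
- by move=> x _; exact: pdf0.
- by rewrite mule_ge0.
Qed.

Lemma ge0_integral_normal_opp (f : R -> \bar R) :
  measurable_fun [set: R] f -> (forall x, 0 <= f x) ->
  \int[gam]_x f (- x)%R = \int[gam]_x f x.
Proof.
move=> mf f0.
have mN : measurable_fun [set: R] (fun x => f (- x)%R).
  exact: (measurableT_comp mf).
rewrite !ge0_integral_normal_prob//.
have mF : measurable_fun [set: measurableTypeR R]
    (fun x : measurableTypeR R => f x * (normal_pdf 0 1 x)%:E).
  apply: emeasurable_funM => //; apply/measurable_EFinP.
  exact: measurable_normal_pdf.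
have F0 x : 0 <= f x * (normal_pdf 0 1 x)%:E.
  by rewrite mule_ge0// lee_fin normal_pdf_ge0.
have mo : measurable_fun [set: measurableTypeR R]
  (-%R : measurableTypeR R -> measurableTypeR R) by [].
have := @ge0_integral_pushforward _ _ _ _ R _ mo leb setT _
  measurableT mF (fun y _ => F0 y).
rewrite preimage_setT => H.
transitivity (\int[leb]_x (((fun x => f x * (normal_pdf 0 1 x)%:E) \o -%R) x)).
  apply: eq_integral => x _ /=; congr (_ * _%:E).
  by rewrite !normal_pdfE ?oner_eq0// /normal_fun !subr0 sqrrN.
rewrite -H; apply: eq_measure_integral => A mA _.
exact: lebesgue_measureN.
Qed.

(** Completing the square. *)
Lemma normal_mgf (c : R) :
  \int[gam]_x (expR (c * x))%:E = (expR (c ^+ 2 / 2))%:E.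
Proof.
have mexp : measurable_fun [set: R] (fun x : R => (expR (c * x))%:E).
  by apply/measurable_EFinP; apply: measurableT_comp.
rewrite ge0_integral_normal_prob//.
transitivity (\int[leb]_x ((expR (c ^+ 2 / 2))%:E * (normal_pdf c 1 x)%:E)).
  apply: eq_integral => x _; rewrite -!EFinM; congr (_%:E).
  rewrite !normal_pdfE ?oner_eq0// /normal_fun mulrCA [RHS]mulrCA -!expRD.
  by congr (_ * expR _)%R; field.
rewrite ge0_integralZl//.
- by rewrite integral_normal_pdf mule1.
- by apply/measurable_EFinP; exact: measurable_normal_pdf.
- by move=> x _; rewrite lee_fin normal_pdf_ge0.
Qed.

(** The Cameron-Martin formula. *)
Lemma ge0_integral_normal_translation (c : R) (f : R -> \bar R) :
  measurable_fun [set: R] f -> (forall x, 0 <= f x) ->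
  \int[gam]_x f (c + x)%R = \int[gam]_x (f x * (expR (c * x - c ^+ 2 / 2))%:E).
Proof.
move=> mf f0.
have := ge0_integral_normal_affine c 1 f ltr01 mf f0.
under eq_integral do rewrite mul1r.
move=> ->.
have me : measurable_fun [set: R] (fun x : R => (expR (c * x - c ^+ 2 / 2))%:E).
  apply/measurable_EFinP; apply: measurableT_comp => //.
  by apply: measurable_funB => //; exact: measurable_funM.
rewrite ge0_integral_normal_prob; last 2 first.
- exact: emeasurable_funM.
- by move=> x; rewrite mule_ge0// lee_fin expR_ge0.
apply: eq_integral => x _; rewrite -muleA; congr (_ * _); rewrite -EFinM; congr (_%:E).
rewrite !normal_pdfE ?oner_eq0// /normal_fun [RHS]mulrCA -!expRD.
by congr (_ * expR _)%R; field.
Qed.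

End gaussian_line.

(** * Taylor inequalities for powers *)

Section powR_bounds.
Context {R : realType}.
Implicit Types (a m x : R).

(** Weighted arithmetic-geometric mean inequality of x and 1. *)
Lemma powR_young x m : 0 <= x -> 0 <= m <= 1 -> x `^ m <= m * x + (1 - m).
Proof.
move=> x0 /andP[m0 m1].
have [->|mn0] := eqVneq m 0; first by rewrite powRr0; lra.
have [->|mn1] := eqVneq m 1; first by rewrite powRr1//; lra.
have mp : 0 < m by rewrite lt_neqAle eq_sym mn0.
have mp1 : 0 < 1 - m by rewrite subr_gt0 lt_neqAle mn1.
have := @conjugate_powR R (x `^ m) 1 m^-1 (1 - m)^-1.
rewrite !invrK mulr1 -powRrM divff// powRr1// powR1 mul1r mulrC; apply => //.
- exact: powR_ge0.
- by rewrite invr_gt0.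
- by rewrite invr_gt0.
- by rewrite addrC subrK.
Qed.

(** The upper bound is [powR_young] at 1/x; the lower bound is [powR_young] at x,
    inverted. *)
Lemma powR_decay x m : 0 < x -> 0 <= m <= 1 ->
  1 - m * (x - 1) <= x `^ (- m) <= 1 - m * (x - 1) + m * (x - 1) ^+ 2 / x.
Proof.
move=> x0 m01; have xn0 : x != 0 by rewrite gt_eqF.
apply/andP; split; last first.
  have -> : x `^ (- m) = x^-1 `^ m by rewrite -mulN1r powRrM powR_inv1 ?ltW.
  apply: (le_trans (powR_young _ _ _ m01)); first by rewrite invr_ge0 ltW.
  by rewrite le_eqVlt; apply/orP; left; apply/eqP; field.
rewrite powRN.
have h := powR_young x m (ltW x0) m01.
have p0 : 0 < x `^ m by rewrite powR_gt0.
rewrite -(ler_pM2r p0) mulVf ?gt_eqF//.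
have [le0|gt0] := leP (1 - m * (x - 1)) 0.
  by apply: (le_trans _ ler01); rewrite mulr_le0_ge0// ltW.
apply: (le_trans (ler_wpM2l (ltW gt0) h)).
have : 0 <= (m * (x - 1)) ^+ 2 by exact: sqr_ge0.
nra.
Qed.

(** The mean value theorem on either side of 1, for the difference of the two
    sides: its derivative is controlled by [powR_decay] with exponent a - 1. *)
Lemma powR_taylor x a : 0 < x -> 0 <= a <= 1 ->
  x `^ a <= 1 + a * (x - 1) - a * (1 - a) / 2 * (x - 1) ^+ 2 + `|x - 1| ^+ 3.
Proof.
move=> x0 a01; have /andP[a0 a1] := a01.
have m01 : 0 <= 1 - a <= 1 by lra.
pose g (s : R) (y : R) : R := 1 + a * (y - 1) - a * (1 - a) / 2 * (y - 1) ^+ 2 +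
  s * (y - 1) ^+ 3 - y `^ a.
pose dg (s : R) (y : R) : R := a - a * (1 - a) * (y - 1) + 3 * s * (y - 1) ^+ 2
   - a * y `^ (a - 1).
have dgP (s y : R) : 0 < y -> is_derive y 1 (g s : R -> R^o) (dg s y).
  move=> y0; rewrite /g /dg.
  have H := is_derive1_powR a y0.
  apply: is_derive_eq.
  rewrite /GRing.scale/= !subr0 !mulr1 ?addr0 ?add0r.
  by field.
have gc s (u v : R) : 0 < u -> {within `[u, v], continuous (g s)}.
  move=> u0; apply: derivable_within_continuous => y.
  rewrite in_itv/= => /andP[uy _].
  by have [] := dgP s y (lt_le_trans u0 uy).
have key (c : R) : 0 < c -> a * c `^ (a - 1) <= a - a * (1 - a) * (c - 1) + a * (1 - a) * (c - 1) ^+ 2 / c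
   /\ a - a * (1 - a) * (c - 1) <= a * c `^ (a - 1).
  move=> c0; have /andP[] := powR_decay c (1 - a) c0 m01; rewrite opprB => h1 h2; split.
    by apply: (le_trans (ler_wpM2l a0 h2)); rewrite le_eqVlt; apply/orP; left; apply/eqP; ring.
  by apply: (le_trans _ (ler_wpM2l a0 h1)); rewrite le_eqVlt; apply/orP; left; apply/eqP; ring.
have g1 s : g s 1 = 0 by rewrite /g powR1 subrr !expr0n /= !mulr0; lra.
have gE s : 0 <= g s x -> s * (x - 1) ^+ 3 = `|x - 1| ^+ 3 ->
    x `^ a <= 1 + a * (x - 1) - a * (1 - a) / 2 * (x - 1) ^+ 2 + `|x - 1| ^+ 3.
  by move=> gx <-; move: gx; rewrite /g; lra.
have [x1|x1] := leP 1 x.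
- apply: (gE 1); last by rewrite ger0_norm ?subr_ge0// mul1r.
  have [||c] := @MVT_segment R (g 1) (dg 1) 1 x x1.
  + by move=> y; rewrite in_itv/= => /andP[y1 _]; apply: dgP; lra.
  + exact: gc.
  + rewrite in_itv/= => /andP[c1 cx]; rewrite g1 subr0 => ->.
    apply: mulr_ge0; last by lra.
    have c0 : 0 < c by lra.
    have [h _] := key c c0; rewrite /dg.
    have : a * (1 - a) * (c - 1) ^+ 2 / c <= (c - 1) ^+ 2.
      rewrite ler_pdivrMr// mulrC; apply: ler_wpM2l; first exact: sqr_ge0.
      by nra.
    have : 0 <= (c - 1) ^+ 2 by exact: sqr_ge0.
    by lra.
- apply: (gE (-1)); last by rewrite ltr0_norm ?subr_lt0//; ring.
  have [||c] := @MVT_segment R (g (-1)) (dg (-1)) x 1 (ltW x1).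
  + by move=> y; rewrite in_itv/= => /andP[y1 _]; apply: dgP; lra.
  + exact: gc.
  + rewrite in_itv/= => /andP[c1 cx]; rewrite g1 sub0r => h.
    have c0 : 0 < c by lra.
    have [_ h2] := key c c0.
    have : dg (-1) c <= 0.
      rewrite /dg; have : 0 <= (c - 1) ^+ 2 by exact: sqr_ge0.
      by lra.
    by nra.
Qed.

(** Product of two expansions [powR_taylor], in which the increments x - 1 and
    y - 1 are replaced by approximations xi and zt in the second order terms
    only. *)
Lemma powR_product_taylor x y (a b xi zt t r : R) : 0 < x -> 0 < y ->
  0 <= a <= 1 -> 0 <= b <= 1 ->
  `|x - 1| <= t -> `|y - 1| <= t -> `|xi| <= t -> `|zt| <= t ->
  `|x - 1 - xi| <= r -> `|y - 1 - zt| <= r ->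
  x `^ a * y `^ b <= 1 + a * (x - 1) + b * (y - 1) +
    (a * b * (xi * zt) - a * (1 - a) / 2 * xi ^+ 2 - b * (1 - b) / 2 * zt ^+ 2)
    + (6 * t * r + 7 * t ^+ 3 + 4 * t ^+ 6).
Proof.
move=> x0 y0 a01 b01 xt yt xit ztt xr yr.
have Ax := powR_taylor x a x0 a01; have By := powR_taylor y b y0 b01.
have /andP[a0 a1] := a01; have /andP[b0 b1] := b01.
move: (x - 1) (y - 1) xt yt xr yr Ax By => u v ut vt ur vr Ax By.
have t0 : 0 <= t by apply: le_trans ut.
have r0 : 0 <= r by apply: le_trans ur.
have mulb (c d e f : R) : `|c| <= e -> `|d| <= f -> `|c * d| <= e * f.
  by move=> ce df; rewrite normrM; apply: ler_pM.
have cb (c d f : R) : 0 <= c <= 1 -> `|d| <= f -> c * d <= f /\ - (c * d) <= f.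
  move=> /andP[c0 c1] df.
  have : `|c * d| <= 1 * f by apply: mulb => //; rewrite ger0_norm.
  by rewrite mul1r ler_norml => /andP[]; lra.
have a2 : 0 <= a * (1 - a) / 2 <= 1 by nra.
have b2 : 0 <= b * (1 - b) / 2 <= 1 by nra.
have c01 (c d : R) : 0 <= c <= 1 -> 0 <= d <= 1 -> 0 <= c * d <= 1.
  by move=> /andP[? ?] /andP[? ?]; apply/andP; split; nra.
set A2 := a * (1 - a) / 2 in a2 Ax *; set B2 := b * (1 - b) / 2 in b2 By *.
have uu : `|u ^+ 2| <= t * t by rewrite expr2; apply: mulb.
have vv : `|v ^+ 2| <= t * t by rewrite expr2; apply: mulb.
have nrm3 (w : R) : `|w| <= t -> `|(`|w| ^+ 3)| <= t * (t * t).
  move=> wt; rewrite !exprS expr0 mulr1; apply: (mulb); rewrite ?normr_id//.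
  by apply: (mulb); rewrite normr_id.
have u3 := nrm3 u ut; have v3 := nrm3 v vt.
(* bounds for the monomials of degree at least 3 of the product *)
have e1 := (cb _ _ _ (c01 _ _ a01 b2) (mulb _ _ _ _ ut vv)).2.
have e2 := (cb _ _ _ (c01 _ _ a2 b01) (mulb _ _ _ _ uu vt)).2.
have e3 := (cb _ _ _ (c01 _ _ a2 b2) (mulb _ _ _ _ uu vv)).1.
have e4 := (cb _ _ _ a01 (mulb _ _ _ _ ut v3)).1.
have e5 := (cb _ _ _ b01 (mulb _ _ _ _ vt u3)).1.
have e6 : 0 <= A2 * (u ^+ 2 * `|v| ^+ 3).
  by case/andP: a2 => ? _; apply: mulr_ge0 => //; apply: mulr_ge0; [exact: sqr_ge0|exact: exprn_ge0].
have e7 : 0 <= B2 * (v ^+ 2 * `|u| ^+ 3).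
  by case/andP: b2 => ? _; apply: mulr_ge0 => //; apply: mulr_ge0; [exact: sqr_ge0|exact: exprn_ge0].
have e8 := le_trans (ler_norm _) (mulb _ _ _ _ u3 v3).
have e9 := le_trans (ler_norm _) u3; have e10 := le_trans (ler_norm _) v3.
(* bounds for the errors of replacing u by xi and v by zt in degree 2 *)
have q1 := (cb _ _ _ (c01 _ _ a01 b01) (mulb _ _ _ _ ut vr)).1.
have q2 := (cb _ _ _ (c01 _ _ a01 b01) (mulb _ _ _ _ ztt ur)).1.
have q3 := (cb _ _ _ a2 (mulb _ _ _ _ ut ur)).2.
have q4 := (cb _ _ _ a2 (mulb _ _ _ _ xit ur)).2.
have q5 := (cb _ _ _ b2 (mulb _ _ _ _ vt vr)).2.
have q6 := (cb _ _ _ b2 (mulb _ _ _ _ ztt vr)).2.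
have t4 : t ^+ 4 <= t ^+ 3 + t ^+ 6.
  have [t1|t1] := leP t 1.
    have : t ^+ 4 <= t ^+ 3 by rewrite exprS ler_piMl// exprn_ge0.
    have : 0 <= t ^+ 6 by exact: exprn_ge0.
    by lra.
  have : t ^+ 4 <= t ^+ 6 by rewrite ler_weXn2l// ltW.
  have : 0 <= t ^+ 3 by exact: exprn_ge0.
  by lra.
have A0 : 0 <= x `^ a by exact: powR_ge0.
have B0 : 0 <= y `^ b by exact: powR_ge0.
apply: (le_trans (ler_pM A0 B0 Ax By)).
have -> : 6 * t * r + 7 * t ^+ 3 + 4 * t ^+ 6 =
  6 * (t * r) + 4 * (t * (t * t)) + t * (t * t) * (t * (t * t)) + 3 * t ^+ 4
  + 3 * (t ^+ 3 + t ^+ 6 - t ^+ 4) by ring.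
apply: (@le_trans _ _ (1 + a * u + b * v +
   (a * b * (xi * zt) - A2 * xi ^+ 2 - B2 * zt ^+ 2) +
  (6 * (t * r) + 4 * (t * (t * t)) + t * (t * t) * (t * (t * t)) + 3 * t ^+ 4)));
  last lra.
have -> : 3 * t ^+ 4 = t * t * (t * t) + t * (t * (t * t)) + t * (t * (t * t)) by ring.
have -> : (1 + a * u - A2 * u ^+ 2 + `|u| ^+ 3) * (1 + b * v - B2 * v ^+ 2 + `|v| ^+ 3)
  = 1 + a * u + b * v + (a * b * (xi * zt) - A2 * xi ^+ 2 - B2 * zt ^+ 2)
  + (a * b * (u * (v - zt)) + a * b * (zt * (u - xi)) - A2 * (u * (u - xi))
     - A2 * (xi * (u - xi)) - B2 * (v * (v - zt)) - B2 * (zt * (v - zt)))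
  + (- (a * B2 * (u * v ^+ 2)) - (A2 * b * (u ^+ 2 * v)) + A2 * B2 * (u ^+ 2 * v ^+ 2)
   + a * (u * `|v| ^+ 3) + b * (v * `|u| ^+ 3) + `|u| ^+ 3 + `|v| ^+ 3
   + `|u| ^+ 3 * `|v| ^+ 3 - A2 * (u ^+ 2 * `|v| ^+ 3) - B2 * (v ^+ 2 * `|u| ^+ 3)).
  by ring.
lra.
Qed.

End powR_bounds.

(** * The standard Gaussian measure on the line *)

(** The standard Gaussian measure, on R with its canonical measurable structure
    instead of the structure of the type alias that carries normal_prob. *)
Definition gauss {R : realType} : set R -> \bar R := normal_prob (0 : R) 1.

Section gauss_measure.
Context {R : realType}.
Local Open Scope ereal_scope.

Let gauss0 : gauss (set0 : set R) = 0.
Proof. exact: (measure0 (normal_prob (0 : R) 1)). Qed.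

Let gauss_ge0 (A : set R) : 0 <= gauss A.
Proof. exact: (measure_ge0 (normal_prob (0 : R) 1)). Qed.

Let gauss_sigma_additive : semi_sigma_additive (@gauss R).
Proof. exact: (@measure_semi_sigma_additive _ _ _ (normal_prob (0 : R) 1)). Qed.

HB.instance Definition _ := isMeasure.Build _ R R gauss
  gauss0 gauss_ge0 gauss_sigma_additive.

Let gauss_setT : gauss [set: R] = 1.
Proof. exact: (probability_setT (normal_prob (0 : R) 1)). Qed.

HB.instance Definition _ := @Measure_isProbability.Build _ R R gauss gauss_setT.

Lemma ge0_integral_gauss (f : R -> \bar R) : measurable_fun [set: R] f ->
  (forall x, 0 <= f x) -> \int[normal_prob 0 1]_x f x = \int[gauss]_x f x.
Proof.
move=> mf f0.
have mid : measurable_fun [set: measurableTypeR R] (idfun : measurableTypeR R -> R).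
  by move=> _ B mB; rewrite setTI; exact: mB.
have := @ge0_integral_pushforward _ _ _ _ R _ mid (normal_prob (0 : R) 1) setT f
  measurableT mf (fun y _ => f0 y).
rewrite preimage_setT => <-.
by apply: eq_measure_integral => A mA _.
Qed.

Lemma integral_prob_cst d (T : measurableType d) (P : probability T R) (c : \bar R) :
  \int[P]_x c = c.
Proof.
rewrite integral_cst// -[RHS]mule1; congr (_ * _).
exact: (@probability_setT _ _ _ P).
Qed.

Lemma integral_gauss_rotation (a b : R) (g : R -> \bar R) :
  (0 < b)%R -> (a ^+ 2 + b ^+ 2 = 1)%R ->
  measurable_fun [set: R] g -> (forall x, 0 <= g x) ->
  \int[gauss]_x \int[gauss]_y g (a * x + b * y)%R = \int[gauss]_z g z.
Proof.
move=> b0 ab mg g0.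
have mF : measurable_fun [set: R * R] (fun p : R * R => g (a * p.1 + b * p.2)%R).
  by apply: (measurableT_comp mg); apply: measurable_funD; exact: measurable_funM.
have F0 (p : R * R) : 0 <= g (a * p.1 + b * p.2)%R by [].
rewrite -[RHS]ge0_integral_gauss// -(ge0_integral_normal_rotation a b)//.
rewrite -ge0_integral_gauss; last 2 first.
- exact: (@measurable_fun_fubini_tonelli_F _ _ _ _ R gauss _ mF F0).
- by move=> x; apply: integral_ge0.
apply: eq_integral => x _; rewrite -ge0_integral_gauss//.
exact: (measurableT_comp mF (measurable_pair1 _)).
Qed.

Lemma integral_gauss_opp (f : R -> \bar R) :
  measurable_fun [set: R] f -> (forall x, 0 <= f x) ->
  \int[gauss]_x f (- x)%R = \int[gauss]_x f x.
Proof.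
move=> mf f0; rewrite -!ge0_integral_gauss//; last exact: (measurableT_comp mf).
exact: ge0_integral_normal_opp.
Qed.

Lemma gauss_mgf (c : R) :
  \int[gauss]_x (expR (c * x))%:E = (expR (c ^+ 2 / 2))%:E.
Proof.
rewrite -ge0_integral_gauss ?normal_mgf//.
by apply/measurable_EFinP; apply: measurableT_comp.
Qed.

Lemma integral_gauss_translation (c : R) (f : R -> \bar R) :
  measurable_fun [set: R] f -> (forall x, 0 <= f x) ->
  \int[gauss]_x f (c + x)%R = \int[gauss]_x (f x * (expR (c * x - c ^+ 2 / 2))%:E).
Proof.
move=> mf f0; rewrite -!ge0_integral_gauss//.
- exact: ge0_integral_normal_translation.
- apply: emeasurable_funM => //; apply/measurable_EFinP; apply: measurableT_comp => //.
  by apply: measurable_funB => //; exact: measurable_funM.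
- by move=> x; rewrite mule_ge0// lee_fin expR_ge0.
- by apply: (measurableT_comp mf); exact: measurable_funD.
Qed.

End gauss_measure.

Section gaussian_expectation.
Context {R : realType}.
Local Notation gam := (@gauss R).
Local Notation gam2 := (@gauss R \x @gauss R)%E.

(** From 1 + u <= exp u at u = |x| / 12, raised to the power 12. *)
Lemma poly_le_exp (x : R) : (1 + x ^+ 2) ^+ 6 <= 12 ^+ 12 * (expR x + expR (- x)).
Proof.
have h : 1 + `|x| <= 12 * expR (`|x| / 12).
  have := @expR_ge1Dx R (`|x| / 12); have := normr_ge0 x; lra.
have h2 : 1 + x ^+ 2 <= (12 * expR (`|x| / 12)) ^+ 2.
  apply: (@le_trans _ _ ((1 + `|x|) ^+ 2)).
    by rewrite sqrrD real_normK ?num_real// expr1n; have := normr_ge0 x; lra.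
  by rewrite lerXn2r// nnegrE ?addr_ge0// mulr_ge0// expR_ge0.
apply: (@le_trans _ _ (((12 * expR (`|x| / 12)) ^+ 2) ^+ 6)).
  by rewrite lerXn2r// nnegrE ?addr_ge0 ?sqr_ge0.
rewrite -exprM exprMn ler_wpM2l ?exprn_ge0// -expRM_natl.
have -> : (2 * 6)%:R * (`|x| / 12) = `|x| :> R by field.
have [x0|x0] := leP 0 x.
  by rewrite ger0_norm// lerDl expR_ge0.
by rewrite ltr0_norm// lerDr expR_ge0.
Qed.

(** Domination by the exponentials of [poly_le_exp], whose integrals are given by
    [gauss_mgf]. *)
Lemma integrable_poly (g : R -> R) (K : R) : measurable_fun [set: R] g ->
  (forall x, `|g x| <= K * (1 + x ^+ 2) ^+ 6) -> gam.-integrable setT (EFin \o g).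
Proof.
move=> mg gK.
have K0 : 0 <= K.
  have := le_trans (normr_ge0 _) (gK 0).
  by rewrite expr0n/= addr0 expr1n mulr1.
have mexp (c : R) : measurable_fun [set: R] (fun x : R => (expR (c * x))%:E).
  by apply/measurable_EFinP; apply: measurableT_comp.
apply/integrableP; split; first exact/measurable_EFinP.
apply: (@le_lt_trans _ _ (\int[gam]_x ((K * 12 ^+ 12)%:E *
    ((expR (1 * x))%:E + (expR (- 1 * x))%:E)))%E).
  apply: ge0_le_integral => //.
  - by apply: measurableT_comp => //; exact/measurable_EFinP.
  - by apply: emeasurable_funM => //; apply: emeasurable_funD; exact: mexp.
  - move=> x _ /=; rewrite -EFinD -EFinM lee_fin mul1r mulN1r -mulrA.
    by apply: (le_trans (gK x)); rewrite ler_wpM2l// poly_le_exp.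
rewrite ge0_integralZl//; last 3 first.
- by apply: emeasurable_funD; exact: mexp.
- by move=> x _; rewrite -EFinD lee_fin addr_ge0 ?expR_ge0.
- by rewrite lee_fin mulr_ge0.
rewrite ge0_integralD//.
by rewrite !gauss_mgf -EFinD -EFinM ltry.
Qed.

Lemma integrable_bounded (g : R -> R) (K : R) : measurable_fun [set: R] g ->
  (forall x, `|g x| <= K) -> gam.-integrable setT (EFin \o g).
Proof.
move=> mg gK; apply: (integrable_poly g K) => // x.
apply: (le_trans (gK x)); rewrite ler_peMr//; first exact: le_trans (gK x).
by rewrite exprn_ege1// lerDl sqr_ge0.
Qed.

Lemma Rintegral_gauss_cst (c : R) : \int[gam]_x c = c.
Proof. by rewrite /Rintegral integral_prob_cst. Qed.

Local Open Scope ereal_scope.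

(** A measurable map that transports the measure for nonnegative functions does
    so for integrable functions. *)
Lemma integral_marginal (phi : R * R -> R) : measurable_fun setT phi ->
  (forall f : R -> \bar R, measurable_fun [set: R] f -> (forall x, 0 <= f x) ->
     \int[gam2]_p f (phi p) = \int[gam]_x f x) ->
  forall g : R -> R, gam.-integrable setT (EFin \o g) ->
  gam2.-integrable setT (EFin \o (g \o phi)) /\
  \int[gam2]_p (g (phi p))%:E = \int[gam]_x (g x)%:E.
Proof.
move=> mphi H g /integrableP[mg ig].
split.
  apply/integrableP; split; first exact: (measurableT_comp mg).
  rewrite (H (fun x => `|(EFin \o g) x|))//.
  exact: measurableT_comp.
rewrite integralE [RHS]integralE; congr (_ - _).
- have := H _ (measurable_funepos mg) (fun x => funepos_ge0 _ x).
  by move=> <-; apply: eq_integral => p _; rewrite unlock.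
- have := H _ (measurable_funeneg mg) (fun x => funeneg_ge0 _ x).
  by move=> <-; apply: eq_integral => p _; rewrite unlock.
Qed.

(** The variables x, r x + s z and z are each standard Gaussian under the product
    measure, so a bound by a sum of functions of one of them integrates to
    one-dimensional integrals. *)
Lemma gaussian_integral_bound (r s : R) (J : R * R -> R) (G1 G2 G3 : R -> R) :
  (0 < s)%R -> (r ^+ 2 + s ^+ 2 = 1)%R ->
  measurable_fun setT J -> (forall p, 0 <= J p)%R ->
  gam.-integrable setT (EFin \o G1) -> gam.-integrable setT (EFin \o G2) ->
  gam.-integrable setT (EFin \o G3) ->
  (forall x z, J (x, z) <= G1 x + G2 (r * x + s * z) + G3 z)%R ->
  \int[gam]_x \int[gam]_z (J (x, z))%:E <=
  (\int[gam]_x G1 x + \int[gam]_x G2 x + \int[gam]_x G3 x)%:E.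
Proof.
move=> s0 rs mJ J0 i1 i2 i3 JG.
have mJE : measurable_fun setT (EFin \o J) by exact/measurable_EFinP.
have J0E p : 0 <= (EFin \o J) p by rewrite lee_fin.
rewrite -(@fubini_tonelli1 _ _ _ _ R gam gam _ mJE J0E).
have mY : measurable_fun [set: R * R] (fun p : R * R => r * p.1 + s * p.2)%R.
  by apply: measurable_funD; exact: measurable_funM.
have [j1 e1] : gam2.-integrable setT (EFin \o (G1 \o fst)) /\
  \int[gam2]_p (G1 (p.1))%:E = \int[gam]_x (G1 x)%:E.
  apply: (integral_marginal fst) => // f mf f0.
  rewrite fubini_tonelli1//=; last exact: measurableT_comp.
  by apply: eq_integral => x _; rewrite /fubini_F/= integral_prob_cst.
have [j3 e3] : gam2.-integrable setT (EFin \o (G3 \o snd)) /\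
  \int[gam2]_p (G3 (p.2))%:E = \int[gam]_x (G3 x)%:E.
  apply: (integral_marginal snd) => //. move=> f mf f0.
  rewrite fubini_tonelli2//=; last exact: measurableT_comp.
  by apply: eq_integral => x _; rewrite /fubini_G/= integral_prob_cst.
have [j2 e2] : gam2.-integrable setT (EFin \o (G2 \o (fun p : R * R => r * p.1 + s * p.2)%R)) /\
  \int[gam2]_p (G2 (r * p.1 + s * p.2)%R)%:E = \int[gam]_x (G2 x)%:E.
  apply: (integral_marginal (fun p : R * R => r * p.1 + s * p.2)%R) => // f mf f0.
  rewrite fubini_tonelli1//=; last exact: measurableT_comp.
  exact: integral_gauss_rotation.
have fin G : gam.-integrable setT (EFin \o G) ->
    \int[gam]_x (G x)%:E = (\int[gam]_x G x)%R%:E.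
  by move=> iG; rewrite /Rintegral fineK//; exact: integrable_fin_num.
rewrite !EFinD -!fin// -e1 -e2 -e3 -integralD// -integralD//; last exact: integrableD.
apply: ge0_le_integral => //.
- apply: emeasurable_funD; first apply: emeasurable_funD.
  + by case/integrableP: j1.
  + by case/integrableP: j2.
  + by case/integrableP: j3.
- by move=> [x z] _; rewrite -!EFinD lee_fin; exact: JG.
Qed.

End gaussian_expectation.

(** * The local inequality *)

Section local_inequality.
Context {R : realType}.
Local Notation gam := (@gauss R).

Definition average (e : R) (f : R -> R) (a : R) : R := \int[gam]_x f (a + e * x).

(** The bound on the second order remainder, which replaces two derivatives, is
    uniform and passes to averages with the same constants; the positive lower
    bound allows division by averages. *)
Definition smooth_bounded (eta C : R) (f : R -> R) : Prop :=
  [/\ measurable_fun [set: R] f, forall x, eta <= f x <= C &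
   exists2 f1 : R -> R, measurable_fun [set: R] f1 &
     forall x d, `|f (x + d) - f x - d * f1 x| <= C * d ^+ 2].

(** The functions that occur as one-dimensional majorants in [gauss_step]. *)
Lemma gauss_lincomb (g : R -> R) (B c0 c1 c2 c3 : R) : measurable_fun [set: R] g ->
  (forall x, `|g x| <= B) ->
  let G x := c0 + c1 * g x + c2 * x ^+ 2 + c3 * (1 + x ^+ 2) ^+ 6 in
  gam.-integrable setT (EFin \o G) /\
  \int[gam]_x G x = c0 + c1 * \int[gam]_x g x + c2 * \int[gam]_x (x ^+ 2) +
    c3 * \int[gam]_x ((1 + x ^+ 2) ^+ 6).
Proof.
move=> mg gB G.
have one (x : R) : 1 <= (1 + x ^+ 2) by rewrite lerDl sqr_ge0.
have ic (c : R) : gam.-integrable setT (EFin \o cst c).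
  by apply: (integrable_bounded _ `|c|).
have ig : gam.-integrable setT (EFin \o g) by exact: (integrable_bounded _ B).
have i2 : gam.-integrable setT (EFin \o (fun x : R => x ^+ 2)).
  apply: (integrable_poly _ 1) => [|x]; first exact: measurable_funX.
  rewrite mul1r ger0_norm ?sqr_ge0//.
  by apply: (@le_trans _ _ (1 + x ^+ 2)); [lra|rewrite ler_eXnr].
have i3 : gam.-integrable setT (EFin \o (fun x : R => (1 + x ^+ 2) ^+ 6)).
  apply: (integrable_poly _ 1) => [|x].
    by apply: measurable_funX; apply: measurable_funD => //; exact: measurable_funX.
  by rewrite mul1r ger0_norm// exprn_ge0//; apply: le_trans (one x).
have iZ (c : R) h : gam.-integrable setT (EFin \o h) ->
    gam.-integrable setT (EFin \o (fun x => c * h x)).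
  by move=> ih; exact: (integrableZl measurableT c ih).
have iD h k : gam.-integrable setT (EFin \o h) -> gam.-integrable setT (EFin \o k) ->
    gam.-integrable setT (EFin \o (fun x => h x + k x)).
  by move=> ih ik; exact: (integrableD measurableT ih ik).
have j1 := iD _ _ (ic c0) (iZ c1 _ ig).
have j2 := iD _ _ j1 (iZ c2 _ i2).
split; first exact: (iD _ _ j2 (iZ c3 _ i3)).
rewrite /G RintegralD//; last exact: iZ.
rewrite RintegralD//; last exact: iZ.
rewrite RintegralD//; [|exact: (ic c0)|exact: iZ].
by rewrite !RintegralZl// Rintegral_gauss_cst.
Qed.

Lemma gauss_bounded_le (g : R -> R) (m M : R) : measurable_fun [set: R] g ->
  (forall x, m <= g x <= M) -> m <= \int[gam]_x g x <= M.
Proof.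
move=> mg gm.
have ic (c : R) : gam.-integrable setT (EFin \o cst c).
  by apply: (integrable_bounded _ `|c|).
have ig : gam.-integrable setT (EFin \o g).
  apply: (integrable_bounded _ (`|m| + `|M|)) => // x.
  have /andP[h1 h2] := gm x; rewrite ler_norml; apply/andP; split.
    by have := ler_norm (- m); rewrite normrN; have := normr_ge0 M; lra.
  by have := ler_norm M; have := normr_ge0 m; lra.
apply/andP; split.
  rewrite -[leLHS](Rintegral_gauss_cst m); apply: le_Rintegral => //; first exact: ic.
  by move=> x _; case/andP: (gm x).
rewrite -[leRHS](Rintegral_gauss_cst M); apply: le_Rintegral => //; first exact: ic.
by move=> x _; case/andP: (gm x).
Qed.

Lemma gauss_norm_le (g : R -> R) (M : R) : measurable_fun [set: R] g ->
  (forall x, `|g x| <= M) -> `|\int[gam]_x g x| <= M.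
Proof.
move=> mg gM; rewrite ler_norml; apply: gauss_bounded_le => // x.
by rewrite -ler_norml.
Qed.

Lemma measurable_shift (e a : R) (g : R -> R) : measurable_fun [set: R] g ->
  measurable_fun [set: R] (fun x => g (a + e * x)).
Proof.
by move=> mg; apply: (measurableT_comp mg); apply: measurable_funD.
Qed.

Lemma measurable_average (e B : R) (g : R -> R) : measurable_fun [set: R] g ->
  (forall x, `|g x| <= B) -> measurable_fun [set: R] (average e g).
Proof.
move=> mg gB.
have mF : measurable_fun [set: R * R] (fun p : R * R => (g (p.1 + e * p.2))%:E).
  apply/measurable_EFinP; apply: (measurableT_comp mg); apply: measurable_funD => //.
  exact: measurable_funM.
apply: (measurableT_comp (fine_measurable _)) => //.
have iF : ((gam \x gam)%E).-integrable setT (fun p : R * R => (g (p.1 + e * p.2))%:E).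
  apply/(@integrable12ltyP _ _ _ _ R gam gam _ mF).
  apply: (@le_lt_trans _ _ (\int[gam]_x \int[gam]_y B%:E)%E); last first.
    by rewrite !integral_prob_cst ltry.
  apply: ge0_le_integral => //.
  - by move=> x _; exact: integral_ge0.
  - have := @measurable_fun_fubini_tonelli_F _ _ _ _ R gam _
      (measurableT_comp (@abse_measurable R setT) mF) (fun _ => abse_ge0 _).
    exact.
  - move=> x _; apply: ge0_le_integral => //.
    + apply: measurableT_comp => //; exact: (measurableT_comp mF (measurable_pair1 x)).
    + by move=> y _; rewrite lee_fin; exact: gB.
exact: (measurable_fubini_F iF).
Qed.

Lemma gauss_odd0 : \int[gam]_x x = 0.
Proof.
have H (f : R -> \bar R) := @integral_gauss_opp R f.
have mid : measurable_fun [set: R] (EFin \o (@idfun R)) by apply/measurable_EFinP; exact: measurable_id.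
rewrite /Rintegral integralE.
have h1 := H _ (measurable_funepos mid) (fun x => funepos_ge0 _ x).
have h2 : ((EFin \o (@idfun R))^\- = (fun x => (EFin \o (@idfun R))^\+ (- x)%R))%E.
  by apply/funext => x; rewrite unlock /= unlock /=.
transitivity (fine (\int[gam]_x (EFin \o (@idfun R))^\+ x -
                    \int[gam]_x (EFin \o (@idfun R))^\- x)%E) => //.
rewrite h2 h1; set I := (\int[_]_x _)%E.
by have [F|/negbTE F] := boolP (I \is a fin_num); [rewrite subee|case: I F].
Qed.

Lemma average_smooth (e eta C : R) (f : R -> R) : 0 < eta ->
  smooth_bounded eta C f -> smooth_bounded eta C (average e f).
Proof.
move=> eta0 [mf fb [f1 mf1 f1P]].
have fB x : `|f x| <= C.
  by have /andP[h1 h2] := fb x; rewrite ger0_norm//; apply: le_trans h1; exact: ltW.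
have f1B x : `|f1 x| <= C + C + C.
  have := f1P x 1; rewrite mul1r expr1n mulr1 => h.
  have -> : f1 x = f (x + 1) - f x - (f (x + 1) - f x - f1 x) by ring.
  apply: (le_trans (ler_normB _ _)); apply: lerD => //.
  by apply: (le_trans (ler_normB _ _)); exact: lerD.
split.
- exact: (measurable_average _ C).
- by move=> x; apply: gauss_bounded_le => //; exact: measurable_shift.
- exists (average e f1); first exact: (measurable_average _ (C + C + C)).
  move=> x d; rewrite /average.
  have ib (g : R -> R) (K a : R) : measurable_fun [set: R] g -> (forall x, `|g x| <= K) ->
      gam.-integrable setT (EFin \o (fun y => g (a + e * y))).
    move=> mg gK; apply: (integrable_bounded _ K) => //; exact: measurable_shift.
  have i1 := ib f C (x + d) mf fB; have i2 := ib f C x mf fB.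
  have i3 := ib f1 _ x mf1 f1B.
  rewrite -RintegralB// -RintegralZl// -RintegralB//; last 2 first.
  + exact: (integrableB measurableT i1 i2).
  + exact: (integrableZl measurableT d i3).
  apply: gauss_norm_le.
    apply: measurable_funB; first by apply: measurable_funB; exact: measurable_shift.
    by apply: measurable_funM => //; exact: measurable_shift.
  by move=> y; have := f1P (x + e * y) d; rewrite (addrAC x).
Qed.

Definition expansion_constant (eta C : R) : R :=
  C / eta * (2 + \int[gam]_x (x ^+ 2)).

Lemma gauss_sqr_ge0 : 0 <= \int[gam]_x (x ^+ 2 : R).
Proof. by apply: Rintegral_ge0 => x _; exact: sqr_ge0. Qed.

(** Relative to its average the function is 1 + e l y + O(e^2): the linear term has
    mean zero, so the average differs from f(b) by O(e^2) only. The constant is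
    uniform in f and b. *)
Lemma average_expansion (eta C e : R) (f : R -> R) (b : R) :
  0 < eta -> 0 < e <= 1 -> smooth_bounded eta C f ->
  let L := expansion_constant eta C in
  exists l : R, forall y, let tau := f (b + e * y) / average e f b - 1 in
    [/\ `|tau - e * l * y| <= L * e ^+ 2 * (1 + y ^+ 2),
        `|e * l * y| <= L * e * (1 + y ^+ 2) &
        `|tau| <= L * e * (1 + y ^+ 2) ].
Proof.
move=> eta0 /andP[e0 e1] sf L; have [mf fb [f1 mf1 f1P]] := sf.
set u0 := average e f b.
have fB x : `|f x| <= C.
  by have /andP[h1 h2] := fb x; rewrite ger0_norm//; apply: le_trans h1; exact: ltW.
have /andP[u0l u0u] : eta <= u0 <= C.
  by apply: gauss_bounded_le => //; exact: measurable_shift.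
have u00 : 0 < u0 by exact: lt_le_trans u0l.
have C0 : 0 < C by exact: lt_le_trans u0u.
set M2 := \int[gam]_x (x ^+ 2); have M20 : 0 <= M2 := gauss_sqr_ge0.
have LE : L = C / eta * (2 + M2) by [].
set lam := f1 b.
have lamB : `|lam| <= 2 * C.
  have := f1P b 1; rewrite mul1r expr1n mulr1 -/lam.
  have /andP[h1 h2] := fb b; have /andP[h3 h4] := fb (b + 1).
  by rewrite !ler_norml => /andP[h5 h6]; apply/andP; split; lra.
have U1 y : `|f (b + e * y) - f b - e * lam * y| <= C * e ^+ 2 * y ^+ 2.
  have := f1P b (e * y); rewrite exprMn mulrA.
  by have -> : e * y * f1 b = e * lam * y by rewrite /lam; ring.
have iid : gam.-integrable setT (EFin \o (fun x : R => x)).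
  apply: (integrable_poly _ 1) => // x; rewrite mul1r.
  apply: (@le_trans _ _ (1 + x ^+ 2)); last by rewrite ler_eXnr// lerDl sqr_ge0.
  have : 0 <= (`|x| - 1) ^+ 2 by exact: sqr_ge0.
  by rewrite sqrrB real_normK ?num_real// mulr1; have := normr_ge0 x; lra.
have iff : gam.-integrable setT (EFin \o (fun y => f (b + e * y))).
  by apply: (integrable_bounded _ C) => //; exact: measurable_shift.
have icst (c : R) : gam.-integrable setT (EFin \o (fun _ : R => c)).
  by apply: (integrable_bounded _ `|c|).
have il : gam.-integrable setT (EFin \o (fun y => e * lam * y)).
  exact: (integrableZl measurableT (e * lam) iid).
have i1 := integrableB measurableT iff (icst (f b)).
have i2 := integrableB measurableT i1 il.
have isq : gam.-integrable setT (EFin \o (fun x : R => x ^+ 2)).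
  apply: (integrable_poly _ 1) => [|x]; first exact: measurable_funX.
  rewrite mul1r ger0_norm ?sqr_ge0//.
  by apply: (@le_trans _ _ (1 + x ^+ 2)); [lra|rewrite ler_eXnr// lerDl sqr_ge0].
have iq := integrableZl measurableT (C * e ^+ 2) isq.
have U2 : `|u0 - f b| <= C * e ^+ 2 * M2.
  have -> : u0 - f b = \int[gam]_y (f (b + e * y) - f b - e * lam * y).
    rewrite RintegralB// RintegralB// RintegralZl// gauss_odd0 mulr0 subr0.
    by rewrite Rintegral_gauss_cst.
  apply: (le_trans (le_normr_Rintegral measurableT i2)).
  rewrite /M2 -RintegralZl//; apply: le_Rintegral => //.
  exact: integrable_norm.
have U3 y : `|f (b + e * y) - u0 - e * lam * y| <= C * e ^+ 2 * (y ^+ 2 + M2).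
  have -> : f (b + e * y) - u0 - e * lam * y =
     f (b + e * y) - f b - e * lam * y - (u0 - f b) by ring.
  by rewrite mulrDr; apply: (le_trans (ler_normB _ _)); exact: lerD.
have Ce : C / u0 <= C / eta by rewrite ler_wpM2l ?(ltW C0)// lef_pV2.
have Ce0 : 0 <= C / eta by rewrite divr_ge0 // ltW.
exists (lam / u0) => y tau.
have y20 : 0 <= y ^+ 2 by exact: sqr_ge0.
have e20 : 0 <= e ^+ 2 by exact: sqr_ge0.
have T1 : `|tau - e * (lam / u0) * y| <= C / eta * (e ^+ 2 * ((1 + M2) * (1 + y ^+ 2))).
  have -> : tau - e * (lam / u0) * y = (f (b + e * y) - u0 - e * lam * y) / u0.
    by rewrite /tau; field; rewrite gt_eqF.
  rewrite normrM (gtr0_norm (_ : 0 < u0^-1)) ?invr_gt0// ler_pdivrMr//.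
  apply: (le_trans (U3 y)).
  have -> : C / eta * (e ^+ 2 * ((1 + M2) * (1 + y ^+ 2))) * u0 =
    C * (e ^+ 2 * ((1 + M2) * (1 + y ^+ 2))) * (u0 / eta) by field; rewrite gt_eqF.
  apply: (@le_trans _ _ (C * (e ^+ 2 * ((1 + M2) * (1 + y ^+ 2))))).
    rewrite -mulrA ler_wpM2l ?(ltW C0)// ler_wpM2l//; nra.
  rewrite ler_peMr//; last by rewrite ler_pdivlMr// mul1r.
  by rewrite !mulr_ge0 ?(ltW C0)//; lra.
have T2 : `|e * (lam / u0) * y| <= C / eta * (e * (1 + y ^+ 2)).
  rewrite !normrM normfV (gtr0_norm e0) (gtr0_norm u00).
  have y2 : 2 * `|y| <= 1 + y ^+ 2.
    have : 0 <= (`|y| - 1) ^+ 2 by exact: sqr_ge0.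
    by rewrite sqrrB real_normK ?num_real// mulr1; lra.
  apply: (@le_trans _ _ (e * ((2 * C) / u0) * `|y|)).
    by rewrite ler_wpM2r// ler_wpM2l ?(ltW e0)// ler_wpM2r// invr_ge0 ltW.
  have -> : e * (2 * C / u0) * `|y| = C / u0 * (e * (2 * `|y|)) by ring.
  apply: ler_pM => //; first by rewrite divr_ge0// ltW.
    by rewrite !mulr_ge0// ltW.
  by rewrite ler_wpM2l ?(ltW e0).
have w0 : 1 <= 1 + y ^+ 2 by lra.
have ee : e ^+ 2 <= e by rewrite expr2 ler_piMr// ltW.
set c := C / eta in LE T1 T2 Ce0 *.
have P : 0 <= (1 + M2) * (1 + y ^+ 2) by rewrite mulr_ge0; lra.
split.
- apply: (le_trans T1).
  have -> : L * e ^+ 2 * (1 + y ^+ 2) = c * (e ^+ 2 * ((2 + M2) * (1 + y ^+ 2))).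
    by rewrite LE; ring.
  by rewrite ler_wpM2l// ler_wpM2l// ler_wpM2r//; lra.
- apply: (le_trans T2).
  have -> : L * e * (1 + y ^+ 2) = c * ((2 + M2) * (e * (1 + y ^+ 2))).
    by rewrite LE; ring.
  rewrite ler_wpM2l// ler_peMl//; last by lra.
  by apply: mulr_ge0; [exact: ltW|lra].
- have -> : tau = tau - e * (lam / u0) * y + e * (lam / u0) * y by ring.
  apply: (le_trans (ler_normD _ _)); apply: (le_trans (lerD T1 T2)).
  have -> : L * e * (1 + y ^+ 2) =
     c * (e * ((1 + M2) * (1 + y ^+ 2)) + e * (1 + y ^+ 2)).
    by rewrite LE; ring.
  by rewrite -mulrDr ler_wpM2l// lerD2r ler_wpM2r.
Qed.

Lemma sum_expr6_le (u v : R) : 0 <= u -> 0 <= v ->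
  (u + v) ^+ 6 <= 64 * (u ^+ 6 + v ^+ 6).
Proof.
have w6 (x y : R) : 0 <= x -> x <= y -> (x + y) ^+ 6 <= 64 * (x ^+ 6 + y ^+ 6).
  move=> x0 xy; apply: (@le_trans _ _ ((2 * y) ^+ 6)).
    by apply: lerXn2r; rewrite ?nnegrE; lra.
  by rewrite exprMn -natrX ler_wpM2l// lerDr exprn_ge0.
move=> u0 v0; have [uv|vu] := leP u v; first exact: w6.
by rewrite addrC (addrC (u ^+ 6)); apply: w6 => //; exact: ltW.
Qed.

Lemma quadratic_form_ge0 (A B c x y : R) : 0 <= A -> 0 <= B ->
  c ^+ 2 <= 4 * A * B -> 0 <= A * x ^+ 2 + B * y ^+ 2 - c * x * y.
Proof.
move=> A0 B0 disc; have [AE|An] := eqVneq A 0.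
  have -> : c = 0.
    apply/eqP; rewrite -sqrf_eq0 eq_le sqr_ge0 andbT.
    by apply: (le_trans disc); rewrite AE mulr0 mul0r.
  by rewrite AE !mul0r subr0 add0r mulr_ge0// sqr_ge0.
have A4 : 0 < 4 * A by rewrite mulr_gt0// lt_neqAle eq_sym An.
rewrite -(pmulr_rge0 _ A4).
have -> : 4 * A * (A * x ^+ 2 + B * y ^+ 2 - c * x * y) =
    (2 * A * x - c * y) ^+ 2 + (4 * A * B - c ^+ 2) * y ^+ 2 by ring.
by rewrite addr_ge0 ?sqr_ge0// mulr_ge0 ?sqr_ge0// subr_ge0.
Qed.

Lemma onemM_half_ge0 (al : R) : 0 <= al <= 1 -> 0 <= al * (1 - al) / 2.
Proof.
by case/andP=> al0 al1; apply: divr_ge0 => //; apply: mulr_ge0; rewrite ?subr_ge0.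
Qed.

Lemma gauss_moment_ge0 : 0 <= \int[gam]_x ((1 + x ^+ 2) ^+ 6 : R).
Proof.
by apply: Rintegral_ge0 => x _; rewrite exprn_ge0// addr_ge0// sqr_ge0.
Qed.

(** The infinitesimal form of hypercontractivity. After division by the averages,
    [powR_product_taylor] applies; the first order terms integrate to zero
    exactly, and the integral of the second order terms is -e^2 M2 times the form
    A2 l^2 + B2 l'^2 - al be r l l', whose discriminant is nonpositive by the
    hypothesis on r. *)
Lemma gauss_step (eta C al be r s : R) :
  0 < eta -> eta <= C -> 0 <= al <= 1 -> 0 <= be <= 1 -> 0 < r -> 0 < s ->
  r ^+ 2 + s ^+ 2 = 1 -> r ^+ 2 * (al * be) <= (1 - al) * (1 - be) ->
  exists2 K : R, 0 <= K & forall (e : R) (f h : R -> R) (a b : R), 0 < e <= 1 ->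
    smooth_bounded eta C f -> smooth_bounded eta C h ->
    (\int[gam]_x \int[gam]_z
       (h (a + e * x) `^ be * f (b + e * (r * x + s * z)) `^ al)%:E <=
     (average e h a `^ be * average e f b `^ al + K * e ^+ 3)%:E)%E.
Proof.
move=> eta0 etaC al01 be01 r0 s0 rs hyp.
set L := expansion_constant eta C.
set M2 := \int[gam]_x (x ^+ 2); have M20 : 0 <= M2 := gauss_sqr_ge0.
set M6 := \int[gam]_x ((1 + x ^+ 2) ^+ 6); have M60 : 0 <= M6 := gauss_moment_ge0.
have C0 : 0 < C by exact: lt_le_trans etaC.
have L1 : 1 <= L.
  rewrite /L /expansion_constant -/M2 -[1]mulr1; apply: ler_pM => //; last lra.
  by rewrite ler_pdivlMr// mul1r.
have L0 : 0 <= L by lra.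
(* 17 = 6 + 7 + 4 from the remainder in powR_product_taylor, and 64 = 2 ^ 6 from
   sum_expr6_le *)
set K0 := 17 * L ^+ 6 * 64.
have K00 : 0 <= K0 by apply: mulr_ge0 => //; apply: mulr_ge0 => //; exact: exprn_ge0.
exists (C `^ be * C `^ al * (2 * K0 * M6)).
  apply: mulr_ge0; first by apply: mulr_ge0; exact: powR_ge0.
  by apply: mulr_ge0 => //; exact: mulr_ge0.
move=> e f h a b e01 sf sh; have /andP[e0 e1] := e01.
have [l lP] := average_expansion eta C e f b eta0 e01 sf.
have [l' l'P] := average_expansion eta C e h a eta0 e01 sh.
have [mf fb _] := sf; have [mh hb _] := sh.
set u0 := average e f b in lP *; set v0 := average e h a in l'P *.
have /andP[u0l u0u] : eta <= u0 <= C.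
  by apply: gauss_bounded_le => //; exact: measurable_shift.
have /andP[v0l v0u] : eta <= v0 <= C.
  by apply: gauss_bounded_le => //; exact: measurable_shift.
have u00 : 0 < u0 by exact: lt_le_trans u0l.
have v00 : 0 < v0 by exact: lt_le_trans v0l.
have /andP[al0 al1] := al01; have /andP[be0 be1] := be01.
have e30 : 0 <= e ^+ 3 by rewrite exprn_ge0// ltW.
set J0 := v0 `^ be * u0 `^ al.
have J00 : 0 <= J0 by apply: mulr_ge0; exact: powR_ge0.
have J0C : J0 <= C `^ be * C `^ al.
  by rewrite ler_pM ?powR_ge0// ge0_ler_powR// nnegrE ltW.
set A2 := al * (1 - al) / 2; set B2 := be * (1 - be) / 2.
have key x z : h (a + e * x) `^ be * f (b + e * (r * x + s * z)) `^ al <=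
  J0 * (1 + al * (f (b + e * (r * x + s * z)) / u0 - 1) + be * (h (a + e * x) / v0 - 1)
   + (al * be * (e * l * (r * x + s * z) * (e * l' * x))
      - A2 * (e * l * (r * x + s * z)) ^+ 2 - B2 * (e * l' * x) ^+ 2)
   + K0 * e ^+ 3 * ((1 + x ^+ 2) ^+ 6 + (1 + (r * x + s * z) ^+ 2) ^+ 6)).
  set y := r * x + s * z.
  have [p1 p2 p3] := lP y; have [p1' p2' p3'] := l'P x.
  have fp : 0 < f (b + e * y) by case/andP: (fb (b + e * y)) => h1 _; exact: lt_le_trans h1.
  have hp : 0 < h (a + e * x) by case/andP: (hb (a + e * x)) => h1 _; exact: lt_le_trans h1.
  have -> : h (a + e * x) `^ be * f (b + e * y) `^ al =
     J0 * ((f (b + e * y) / u0) `^ al * (h (a + e * x) / v0) `^ be).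
    have Ef : f (b + e * y) `^ al = u0 `^ al * (f (b + e * y) / u0) `^ al.
      by rewrite -powRM ?divr_ge0 ?(ltW u00) ?(ltW fp)// (mulrC u0) divfK ?gt_eqF.
    have Eh : h (a + e * x) `^ be = v0 `^ be * (h (a + e * x) / v0) `^ be.
      by rewrite -powRM ?divr_ge0 ?(ltW v00) ?(ltW hp)// (mulrC v0) divfK ?gt_eqF.
    by rewrite Ef Eh /J0 mulrACA [X in _ * X = _]mulrC.
  apply: ler_wpM2l => //.
  set wx := 1 + x ^+ 2; set wy := 1 + y ^+ 2.
  have wx1 : 1 <= wx by rewrite lerDl sqr_ge0.
  have wy1 : 1 <= wy by rewrite lerDl sqr_ge0.
  set W := wx + wy; set t := L * e * W; set q := L * e ^+ 2 * W.
  have Le0 : 0 <= L * e by rewrite mulr_ge0// ltW.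
  have Le20 : 0 <= L * e ^+ 2 by rewrite mulr_ge0// sqr_ge0.
  have tx : L * e * wx <= t by rewrite ler_wpM2l// lerDl (le_trans ler01).
  have ty : L * e * wy <= t by rewrite ler_wpM2l// lerDr (le_trans ler01).
  have qx : L * e ^+ 2 * wx <= q by rewrite ler_wpM2l// lerDl (le_trans ler01).
  have qy : L * e ^+ 2 * wy <= q by rewrite ler_wpM2l// lerDr (le_trans ler01).
  have := @powR_product_taylor R (f (b + e * y) / u0) (h (a + e * x) / v0) al be
    (e * l * y) (e * l' * x) t q (divr_gt0 fp u00) (divr_gt0 hp v00) al01 be01
    (le_trans p3 ty) (le_trans p3' tx) (le_trans p2 ty) (le_trans p2' tx)
    (le_trans p1 qy) (le_trans p1' qx).
  move/le_trans; apply.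
  rewrite -/A2 -/B2; rewrite lerD2l.
  have W1 : 1 <= W by apply: (le_trans wx1); rewrite lerDl (le_trans ler01).
  have W0 : 0 <= W := le_trans ler01 W1.
  have LW i j k : (i <= 6)%N -> (3 <= j)%N -> (k <= 6)%N ->
      L ^+ i * e ^+ j * W ^+ k <= L ^+ 6 * e ^+ 3 * W ^+ 6.
    move=> i6 j3 k6.
    apply: ler_pM; rewrite ?exprn_ge0 ?mulr_ge0 ?exprn_ge0 ?(ltW e0)//; last first.
      by rewrite ler_weXn2l.
    apply: ler_pM; rewrite ?exprn_ge0 ?(ltW e0)//; first by rewrite ler_weXn2l.
    by rewrite ler_wiXn2l// ltW.
  have -> : 6 * t * q + 7 * t ^+ 3 + 4 * t ^+ 6 =
     6 * (L ^+ 2 * e ^+ 3 * W ^+ 2) + 7 * (L ^+ 3 * e ^+ 3 * W ^+ 3)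
     + 4 * (L ^+ 6 * e ^+ 6 * W ^+ 6) by rewrite /t /q; ring.
  have h1 := LW 2%N 3%N 2%N isT isT isT; have h2 := LW 3%N 3%N 3%N isT isT isT.
  have h3 := LW 6%N 6%N 6%N isT isT isT.
  apply: (@le_trans _ _ (17 * (L ^+ 6 * e ^+ 3 * W ^+ 6))); first by lra.
  have -> : K0 * e ^+ 3 * (wx ^+ 6 + wy ^+ 6) =
    17 * (L ^+ 6 * e ^+ 3 * (64 * (wx ^+ 6 + wy ^+ 6))) by rewrite /K0; ring.
  have Le3 : 0 <= L ^+ 6 * e ^+ 3 by apply: mulr_ge0 => //; exact: exprn_ge0.
  rewrite ler_wpM2l// ler_wpM2l//.
  by apply: sum_expr6_le; exact: le_trans ler01 _.
have hB x : `|h (a + e * x)| <= C.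
  by have /andP[h1 h2] := hb (a + e * x); rewrite ger0_norm//; apply: le_trans h1; exact: ltW.
have fB x : `|f (b + e * x)| <= C.
  by have /andP[h1 h2] := fb (b + e * x); rewrite ger0_norm//; apply: le_trans h1; exact: ltW.
(* the mixed term is diagonalized: with y = r x + s z,
   x y = (r^2 x^2 + y^2 - s^2 z^2) / (2 r), a sum of functions of one variable *)
have := gauss_lincomb (fun x => h (a + e * x)) C (J0 * (1 - al - be)) (J0 * (be / v0))
  (J0 * (al * be * e ^+ 2 * l * l' * r / 2 - B2 * e ^+ 2 * l' ^+ 2))
  (J0 * (K0 * e ^+ 3)) (measurable_shift e a h mh) hB.
set G1 := fun x : R => _ => /= -[i1 I1].
have := gauss_lincomb (fun x => f (b + e * x)) C 0 (J0 * (al / u0))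
  (J0 * (al * be * e ^+ 2 * l * l' / (2 * r) - A2 * e ^+ 2 * l ^+ 2))
  (J0 * (K0 * e ^+ 3)) (measurable_shift e b f mf) fB.
set G2 := fun x : R => _ => /= -[i2 I2].
have := gauss_lincomb (fun x => h (a + e * x)) C 0 0
  (- (J0 * (al * be * e ^+ 2 * l * l' * s ^+ 2 / (2 * r)))) 0
  (measurable_shift e a h mh) hB.
set G3 := fun x : R => _ => /= -[i3 I3].
have mJ : measurable_fun [set: R * R] (fun p : R * R =>
    h (a + e * p.1) `^ be * f (b + e * (r * p.1 + s * p.2)) `^ al).
  apply: measurable_funM; apply: (measurableT_comp (measurable_powR _)).
    by apply: (measurableT_comp mh); apply: measurable_funD => //; exact: measurable_funM.
  apply: (measurableT_comp mf); apply: measurable_funD => //; apply: measurable_funM => //.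
  by apply: measurable_funD; exact: measurable_funM.
have J0' (p : R * R) : 0 <= h (a + e * p.1) `^ be * f (b + e * (r * p.1 + s * p.2)) `^ al.
  by rewrite mulr_ge0// powR_ge0.
have := @gaussian_integral_bound R r s _ G1 G2 G3 s0 rs mJ J0' i1 i2 i3.
move=> /= H; apply: (le_trans (H _)) => [x z|].
  apply: (le_trans (key x z)); rewrite le_eqVlt; apply/orP; left; apply/eqP.
  by rewrite /G1 /G2 /G3; field; rewrite !gt_eqF.
rewrite lee_fin I1 I2 I3 -/M2 -/M6 -/(average e h a) -/(average e f b) -/u0 -/v0.
have s2 : s ^+ 2 = 1 - r ^+ 2 by rewrite -rs; ring.
have -> : J0 * (1 - al - be) + J0 * (be / v0) * v0 +
  J0 * (al * be * e ^+ 2 * l * l' * r / 2 - B2 * e ^+ 2 * l' ^+ 2) * M2 +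
  J0 * (K0 * e ^+ 3) * M6 +
  (0 + J0 * (al / u0) * u0 +
   J0 * (al * be * e ^+ 2 * l * l' / (2 * r) - A2 * e ^+ 2 * l ^+ 2) * M2 +
   J0 * (K0 * e ^+ 3) * M6) +
  (0 + 0 * v0 + - (J0 * (al * be * e ^+ 2 * l * l' * s ^+ 2 / (2 * r))) * M2 + 0 * M6)
  = J0 + J0 * (2 * K0 * M6) * e ^+ 3 -
    J0 * e ^+ 2 * M2 * (A2 * l ^+ 2 + B2 * l' ^+ 2 - al * be * r * l * l').
  by rewrite s2; field; rewrite !gt_eqF.
have qf : 0 <= A2 * l ^+ 2 + B2 * l' ^+ 2 - al * be * r * l * l'.
  have disc : (al * be * r) ^+ 2 <= 4 * A2 * B2.
    have -> : (al * be * r) ^+ 2 = (al * be) * (r ^+ 2 * (al * be)) by ring.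
    have -> : 4 * A2 * B2 = al * be * ((1 - al) * (1 - be)) by rewrite /A2 /B2; field.
    by rewrite ler_wpM2l// mulr_ge0.
  by apply: quadratic_form_ge0; [exact: onemM_half_ge0|exact: onemM_half_ge0|].
have form0 : 0 <= J0 * e ^+ 2 * M2 * (A2 * l ^+ 2 + B2 * l' ^+ 2 - al * be * r * l * l').
  exact: (mulr_ge0 (mulr_ge0 (mulr_ge0 J00 (sqr_ge0 e)) M20) qf).
have err : J0 * (2 * K0 * M6) * e ^+ 3 <= C `^ be * C `^ al * (2 * K0 * M6) * e ^+ 3.
  rewrite ler_wpM2r// ler_wpM2r//; apply: mulr_ge0 => //; exact: mulr_ge0.
by rewrite lerBlDr; apply: (le_trans (lerD (lexx _) err)); rewrite lerDl.
Qed.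

End local_inequality.

(** * Doubling: from the local inequality to smooth functions *)

Section doubling.
Context {R : realType}.
Local Notation gam := (@gauss R).
Variables (eta C al be r s : R).
Hypothesis (eta0 : 0 < eta).

Definition correlated (e : R) (f h : R -> R) (a b : R) : \bar R :=
  (\int[gam]_x \int[gam]_z
       (h (a + e * x) `^ be * f (b + e * (r * x + s * z)) `^ al)%:E)%E.

(** Uniform in the functions of the class and in the base points, so that the
    bound can be used on averages and at random base points. *)
Definition step_bound (e K : R) := forall f h a b,
  smooth_bounded eta C f -> smooth_bounded eta C h ->
  (correlated e f h a b <= (average e h a `^ be * average e f b `^ al + K)%:E)%E.

Let sig : R := Num.sqrt (1 / 2).

Let sig0 : 0 < sig. Proof. by rewrite sqrtr_gt0; lra. Qed.
Let sig2 : sig ^+ 2 = 1 / 2. Proof. by rewrite sqr_sqrtr//; lra. Qed.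
Let sigsig : sig ^+ 2 + sig ^+ 2 = 1. Proof. by rewrite sig2; lra. Qed.

(** The variance of a sum of independent Gaussian variables is the sum of the
    variances. *)
Lemma average_average (e B : R) (f : R -> R) (a : R) : measurable_fun [set: R] f ->
  (forall x, 0 <= f x <= B) ->
  average (sig * e) (average (sig * e) f) a = average e f a.
Proof.
move=> mf fb; rewrite /average /Rintegral; congr fine.
have fin a' : (\int[gam]_x (f (a' + sig * e * x))%:E)%E \is a fin_num.
  apply: integrable_fin_num => //; apply: (integrable_bounded _ B).
    exact: measurable_shift.
  by move=> x; rewrite ger0_norm; case/andP: (fb (a' + sig * e * x)).
under eq_integral do rewrite fineK//.
rewrite -(integral_gauss_rotation sig sig (fun x => (f (a + e * x))%:E) sig0 sigsig).
- apply: eq_integral => x _; apply: eq_integral => y _; congr (f _)%:E; ring.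
- by apply/measurable_EFinP; exact: measurable_shift.
- by move=> x; rewrite lee_fin; case/andP: (fb (a + e * x)).
Qed.

Lemma measurable_correlated_integrand (f h : R -> R) :
  measurable_fun [set: R] f -> measurable_fun [set: R] h ->
  measurable_fun [set: R * R] (fun p : R * R => (h p.1 `^ be * f p.2 `^ al)%:E).
Proof.
move=> mf mh; apply/measurable_EFinP; apply: measurable_funM.
  by apply: (measurableT_comp (measurable_powR _)); exact: (measurableT_comp mh).
by apply: (measurableT_comp (measurable_powR _)); exact: (measurableT_comp mf).
Qed.

(** A standard Gaussian vector is a normalized sum of two independent copies. The
    estimate is applied to the second copy at the random base point given by the
    first one, then to the averages of the two functions. *)
Lemma step_bound_double (e K : R) :
  0 <= K -> step_bound (sig * e) K -> step_bound e (2 * K).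
Proof.
move=> K0 H f h a b sf sh; have [mf fb _] := sf; have [mh hb _] := sh.
have f0 x : 0 <= f x by case/andP: (fb x) => h1 _; apply: le_trans h1; exact: ltW.
have h0 x : 0 <= h x by case/andP: (hb x) => h1 _; apply: le_trans h1; exact: ltW.
have fb' x : 0 <= f x <= C by rewrite f0; case/andP: (fb x).
have hb' x : 0 <= h x <= C by rewrite h0; case/andP: (hb x).
set e' := sig * e.
pose F (x z : R) : \bar R := (h (a + e * x) `^ be * f (b + e * (r * x + s * z)) `^ al)%:E.
have F0 x z : (0 <= F x z)%E by rewrite lee_fin mulr_ge0// powR_ge0.
have mFc d (T : measurableType d) (u v : T -> R) : measurable_fun setT u ->
    measurable_fun setT v -> measurable_fun setT (fun t => F (u t) (v t)).
  move=> mu mv.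
  have mpair : measurable_fun setT (fun t => (a + e * u t, b + e * (r * u t + s * v t))).
    apply: measurable_fun_pair.
      by apply: measurable_funD => //; exact: measurable_funM.
    apply: measurable_funD => //; apply: measurable_funM => //.
    by apply: measurable_funD; exact: measurable_funM.
  exact: (measurableT_comp (measurable_correlated_integrand f h mf mh) mpair).
have -> : correlated e f h a b = (\int[gam]_x \int[gam]_z
    correlated e' f h (a + e' * x)%R (b + e' * (r * x + s * z))%R)%E.
  pose G x x' z : \bar R := (\int[gam]_z' F (sig * x + sig * x')%R (sig * z + sig * z')%R)%E.
  have G0 x x' z : (0 <= G x x' z)%E by apply: integral_ge0.
  transitivity (\int[gam]_x \int[gam]_x' \int[gam]_z G x x' z)%E.
    rewrite /correlated.
    rewrite -(integral_gauss_rotation sig sig (fun x => \int[gam]_z F x z)%E sig0 sigsig).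
    - apply: eq_integral => x _; apply: eq_integral => x' _.
      rewrite -(integral_gauss_rotation sig sig (F (sig * x + sig * x')) sig0 sigsig)//.
      exact: mFc.
    - apply: (@measurable_fun_fubini_tonelli_F _ _ _ _ R gam (fun p : R * R => F p.1 p.2)) => //.
      exact: mFc.
    - by move=> x; exact: integral_ge0.
  apply: eq_integral => x _.
  have mG : measurable_fun [set: R * R] (fun p : R * R => G x p.1 p.2).
    apply: (@measurable_fun_fubini_tonelli_F _ _ _ _ R gam
      (fun p : (R * R) * R => F (sig * x + sig * p.1.1) (sig * p.1.2 + sig * p.2))) => //.
    apply: mFc; apply: measurable_funD => //; apply: measurable_funM => //.
    - exact: (measurableT_comp measurable_fst measurable_fst).
    - exact: (measurableT_comp measurable_snd measurable_fst).
  have G0p (p : R * R) : (0 <= G x p.1 p.2)%E by exact: G0.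
  rewrite [LHS](@fubini_tonelli _ _ _ _ R gam gam (fun p : R * R => G x p.1 p.2) mG G0p).
  apply: eq_integral => z _; apply: eq_integral => x' _; apply: eq_integral => z' _.
  rewrite /F /e' /=; congr (h _ `^ be * f _ `^ al)%:E; ring.
have sfa := average_smooth e' eta C f eta0 sf.
have sha := average_smooth e' eta C h eta0 sh.
have [mfa fab _] := sfa; have [mha hab _] := sha.
pose A x z : R := average e' h (a + e' * x) `^ be * average e' f (b + e' * (r * x + s * z)) `^ al.
have mA : measurable_fun [set: R * R] (fun p : R * R => (A p.1 p.2)%:E).
  have mpair : measurable_fun [set: R * R]
      (fun t : R * R => (a + e' * t.1, b + e' * (r * t.1 + s * t.2))).
    apply: measurable_fun_pair.
      by apply: measurable_funD => //; exact: measurable_funM.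
    apply: measurable_funD => //; apply: measurable_funM => //.
    by apply: measurable_funD; exact: measurable_funM.
  exact: (measurableT_comp (measurable_correlated_integrand _ _ mfa mha) mpair).
have A0 x z : 0 <= A x z by rewrite mulr_ge0// powR_ge0.
apply: (@le_trans _ _ (\int[gam]_x \int[gam]_z ((A x z)%:E + K%:E))%E).
  have c0 a' b' : (0 <= correlated e' f h a' b')%E.
    by apply: integral_ge0 => x _; apply: integral_ge0 => z _; rewrite lee_fin mulr_ge0// powR_ge0.
  have mc : measurable_fun [set: R * R] (fun p : R * R =>
      correlated e' f h (a + e' * p.1) (b + e' * (r * p.1 + s * p.2))).
    have mS (i : bool) : measurable_fun [set: (R * R) * R] (fun q : (R * R) * R =>
      if i then q.1.1 else q.1.2).
      case: i; first exact: (measurableT_comp measurable_fst measurable_fst).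
      exact: (measurableT_comp measurable_snd measurable_fst).
    have m3 : measurable_fun [set: ((R * R) * R) * R] (fun q : ((R * R) * R) * R =>
        (a + e' * q.1.1.1 + e' * q.1.2,
         b + e' * (r * q.1.1.1 + s * q.1.1.2) + e' * (r * q.1.2 + s * q.2))).
      have m1 : measurable_fun [set: ((R * R) * R) * R] (fun q : ((R * R) * R) * R => q.1.1.1).
        exact: (measurableT_comp (mS true) measurable_fst).
      have m2 : measurable_fun [set: ((R * R) * R) * R] (fun q : ((R * R) * R) * R => q.1.1.2).
        exact: (measurableT_comp (mS false) measurable_fst).
      have m4 : measurable_fun [set: ((R * R) * R) * R] (fun q : ((R * R) * R) * R => q.1.2).
        exact: (measurableT_comp measurable_snd measurable_fst).
      have m5 : measurable_fun [set: ((R * R) * R) * R] (fun q : ((R * R) * R) * R => q.2).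
        exact: measurable_snd.
      apply: measurable_fun_pair.
        by apply: measurable_funD; [apply: measurable_funD|]; do ?apply: measurable_funM.
      by apply: measurable_funD; [apply: measurable_funD => //|];
        apply: measurable_funM => //; apply: measurable_funD; apply: measurable_funM.
    have m6 := measurableT_comp (measurable_correlated_integrand f h mf mh) m3.
    apply: (@measurable_fun_fubini_tonelli_F _ _ _ _ R gam (fun p : (R * R) * R =>
      \int[gam]_z (h (a + e' * p.1.1 + e' * p.2) `^ be *
         f (b + e' * (r * p.1.1 + s * p.1.2) + e' * (r * p.2 + s * z)) `^ al)%:E)%E).
      apply: (@measurable_fun_fubini_tonelli_F _ _ _ _ R gam _ m6) => q /=.
      by rewrite lee_fin mulr_ge0// powR_ge0.
    by move=> q; apply: integral_ge0 => z _; rewrite lee_fin mulr_ge0// powR_ge0.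
  apply: ge0_le_integral => //.
  - by move=> x _; apply: integral_ge0 => z _.
  - exact: (@measurable_fun_fubini_tonelli_F _ _ _ _ R gam _ mc).
  - apply: (@measurable_fun_fubini_tonelli_F _ _ _ _ R gam (fun p : R * R => (A p.1 p.2)%:E + K%:E)%E).
      by apply: emeasurable_funD.
    by move=> p; rewrite -EFinD lee_fin addr_ge0.
  - move=> x _; apply: ge0_le_integral => //.
    + exact: (measurableT_comp mc (measurable_pair1 x)).
    + apply: emeasurable_funD => //; exact: (measurableT_comp mA (measurable_pair1 x)).
    + by move=> z _; exact: H.
have -> : (\int[gam]_x \int[gam]_z ((A x z)%:E + K%:E) =
     correlated e' (average e' f) (average e' h) a b + K%:E)%E.
  have EA x : (\int[gam]_z ((A x z)%:E + K%:E) = \int[gam]_z (A x z)%:E + K%:E)%E.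
    rewrite ge0_integralD//; last 2 first.
    - by move=> z _; rewrite lee_fin.
    - exact: (measurableT_comp mA (measurable_pair1 x)).
    by rewrite integral_prob_cst.
  under eq_integral do rewrite EA.
  rewrite ge0_integralD//; last 2 first.
  - by move=> x _; apply: integral_ge0 => z _; rewrite lee_fin.
  - by apply: (@measurable_fun_fubini_tonelli_F _ _ _ _ R gam _ mA) => p; rewrite lee_fin.
  by rewrite integral_prob_cst.
apply: (le_trans (leeD2r _ (H _ _ a b sfa sha))).
rewrite (average_average e C h)// (average_average e C f)//.
by rewrite -EFinD lee_fin; lra.
Qed.

(** Each doubling multiplies the error by 2 and the step by sqrt 2, so that an
    error K e^3 at e = sig^k becomes 2^k K sig^(3k) = K sig^k. *)
Lemma step_bound_iter (K : R) (k : nat) : 0 <= K ->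
  step_bound (sig ^+ k) (K * (sig ^+ k) ^+ 3) -> step_bound 1 (K * sig ^+ k).
Proof.
move=> K0; have -> : K * sig ^+ k = 2 ^+ k * (K * (sig ^+ k) ^+ 3).
  have -> : (sig ^+ k) ^+ 3 = sig ^+ k * (1 / 2) ^+ k by rewrite exprS exprAC sig2.
  rewrite [RHS]mulrCA; congr (K * _); rewrite mulrCA -exprMn.
  by rewrite mul1r divff// expr1n mulr1.
have K10 : 0 <= K * (sig ^+ k) ^+ 3 by rewrite mulr_ge0// !exprn_ge0// ltW.
move: (K * (sig ^+ k) ^+ 3) K10 => K1.
elim: k K1 => [|k IH] K1 K10; first by rewrite !expr0 mul1r.
rewrite exprS => /step_bound_double => /(_ K10) /(IH (2 * K1)).
by rewrite exprSr mulrA; apply; rewrite mulr_ge0.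
Qed.

End doubling.

(** Nelson's inequality for smooth functions, with error terms removed by letting
    the number of doublings tend to infinity. *)
Lemma nelson_smooth {R : realType} (eta C al be r s : R) (f h : R -> R) :
  0 < eta -> eta <= C -> 0 <= al <= 1 -> 0 <= be <= 1 -> 0 < r -> 0 < s ->
  r ^+ 2 + s ^+ 2 = 1 -> r ^+ 2 * (al * be) <= (1 - al) * (1 - be) ->
  smooth_bounded eta C f -> smooth_bounded eta C h ->
  (\int[gauss]_x \int[gauss]_z (h x `^ be * f (r * x + s * z) `^ al)%:E <=
   ((\int[gauss]_x h x) `^ be * (\int[gauss]_x f x) `^ al)%:E)%E.
Proof.
move=> eta0 etaC al01 be01 r0 s0 rs hyp sf sh.
have [K K0 HK] := gauss_step eta C al be r s eta0 etaC al01 be01 r0 s0 rs hyp.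
pose sig : R := Num.sqrt (1 / 2).
have sig0 : 0 < sig by rewrite sqrtr_gt0; lra.
have sig1 : sig < 1.
  by rewrite -(@ltr_pXn2r _ 2)// ?nnegrE ?(ltW sig0)// sqr_sqrtr; lra.
have E (g : R -> R) : average 1 g 0 = \int[gauss]_x g x.
  by apply: eq_Rintegral => x _; rewrite add0r mul1r.
have bound k : (\int[gauss]_x \int[gauss]_z (h x `^ be * f (r * x + s * z) `^ al)%:E <=
   ((\int[gauss]_x h x) `^ be * (\int[gauss]_x f x) `^ al + K * sig ^+ k)%:E)%E.
  have st : step_bound eta C al be r s (sig ^+ k) (K * (sig ^+ k) ^+ 3).
    move=> f' h' a b sf' sh'; apply: HK => //.
    by rewrite exprn_gt0//= exprn_ile1// ltW.
  have := step_bound_iter eta C al be r s eta0 K k K0 st f h 0 0 sf sh.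
  rewrite !E; apply: le_trans; rewrite le_eqVlt; apply/orP; left; apply/eqP.
  apply: eq_integral => x _; apply: eq_integral => z _.
  by rewrite !add0r !mul1r.
apply/lee_addgt0Pr => eps eps0.
have cv : K * sig ^+ k @[k --> \oo] --> (0 : R).
  rewrite -[X in _ --> X](mulr0 K); apply: cvgMr => //.
  by apply: cvg_expr; rewrite ger0_norm// ltW.
have /cvgrPdist_lt /(_ eps eps0) [k _ /(_ k (leqnn k))] := cv.
rewrite /= sub0r normrN ger0_norm; last by rewrite mulr_ge0// exprn_ge0// ltW.
move=> hk; apply: (le_trans (bound k)); rewrite EFinD leeD2l// lee_fin ltW//.
Qed.

(** * Gaussian mollification *)

Section mollification.
Context {R : realType}.
Local Notation gam := (@gauss R).

Lemma expR_taylor1 (w : R) : 0 <= expR w - 1 - w <= w ^+ 2 * expR `|w|.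
Proof.
have h1 := @expR_ge1Dx R w; have h2 := @expR_ge1Dx R (- w).
have e0 := expR_gt0 w.
apply/andP; split; first by lra.
have h3 : expR w - 1 <= w * expR w.
  have : (1 + - w) * expR w <= 1.
    by apply: (le_trans (ler_wpM2r (ltW e0) h2)); rewrite -expRD addNr expR0.
  by lra.
have [w0|w0] := leP 0 w.
  rewrite ger0_norm//.
  have : w * (expR w - 1) <= w * (w * expR w) by rewrite ler_wpM2l.
  have : expR w - 1 - w <= w * (expR w - 1) by lra.
  by rewrite expr2 -mulrA; lra.
rewrite ltr0_norm//.
have h4 : expR w - 1 - w <= w * (expR w - 1) by lra.
apply: (le_trans h4).
have h5 : w * (expR w - 1) <= w * w by rewrite ler_nM2l//; lra.
rewrite expr2; apply: (le_trans h5).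
by rewrite ler_peMr -?expr2 ?sqr_ge0//; lra.
Qed.

Lemma sqr_le_expR (u : R) : 0 <= u -> u ^+ 2 <= 2 * expR u.
Proof.
move=> u0; have := @expR_ge1Dxn R u 1 u0; rewrite /= => h.
have -> : u ^+ 2 = 2 * (u ^+ 2 / 2) by field.
rewrite ler_wpM2l//; apply: le_trans h.
by rewrite lerDr.
Qed.

(** An integrable function that dominates, up to the factor c^2 for |c| <= 1, the
    second order remainder of the Cameron-Martin density. *)
Definition mollifier_weight (y : R) : R :=
  2 * expR 2 * (expR (2 * y) + expR (- 2 * y)) + 1.

Lemma mollifier_remainder (c y : R) : `|c| <= 1 ->
  `|expR (c * y - c ^+ 2 / 2) - 1 - c * y| <= c ^+ 2 * mollifier_weight y.
Proof.
move=> c1; set w := c * y - c ^+ 2 / 2.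
have /andP[r0 r1] := expR_taylor1 w.
have c0 := normr_ge0 c; have y0 := normr_ge0 y.
have c2 : c ^+ 2 = `|c| ^+ 2 by rewrite real_normK ?num_real.
have c2c : c ^+ 2 <= `|c|.
  by rewrite c2 expr2 ler_piMl.
have wB : `|w| <= `|c| * (`|y| + 1).
  apply: (le_trans (ler_normB _ _)); rewrite normrM mulrDr mulr1 lerD2l.
  rewrite ger0_norm ?divr_ge0 ?sqr_ge0//; have := sqr_ge0 c; lra.
have wB1 : `|w| <= `|y| + 1.
  by apply: (le_trans wB); rewrite ler_piMl// addr_ge0.
have w2 : w ^+ 2 <= c ^+ 2 * (`|y| + 1) ^+ 2.
  rewrite c2 -exprMn -(real_normK (num_real w)) lerXn2r// nnegrE.
  by rewrite mulr_ge0// addr_ge0.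
have e1 : expR `|w| <= expR (`|y| + 1) by rewrite ler_expR.
have s1 := sqr_le_expR (`|y| + 1) (addr_ge0 y0 ler01).
have E2 : expR (`|y| + 1) * expR (`|y| + 1) <= expR 2 * (expR (2 * y) + expR (- 2 * y)).
  rewrite -expRD; have -> : `|y| + 1 + (`|y| + 1) = 2 + 2 * `|y| by ring.
  rewrite expRD ler_wpM2l ?expR_ge0//.
  have [yy|yy] := leP 0 y.
    by rewrite ger0_norm// lerDl expR_ge0.
  by rewrite ltr0_norm// mulrN -mulNr lerDr expR_ge0.
have c20 : 0 <= c ^+ 2 by exact: sqr_ge0.
have big : w ^+ 2 * expR `|w| <= c ^+ 2 * (2 * expR 2 * (expR (2 * y) + expR (- 2 * y))).
  apply: (@le_trans _ _ (c ^+ 2 * (`|y| + 1) ^+ 2 * expR (`|y| + 1))).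
    by apply: ler_pM => //; rewrite ?sqr_ge0 ?expR_ge0.
  rewrite -mulrA ler_wpM2l//.
  apply: (@le_trans _ _ (2 * expR (`|y| + 1) * expR (`|y| + 1))).
    by rewrite ler_wpM2r ?expR_ge0.
  by rewrite -!mulrA ler_wpM2l.
have -> : expR w - 1 - c * y = (expR w - 1 - w) - c ^+ 2 / 2 by rewrite /w; ring.
apply: (le_trans (ler_normB _ _)).
rewrite (ger0_norm r0) (ger0_norm (_ : 0 <= c ^+ 2 / 2)) ?divr_ge0//.
by rewrite /mollifier_weight mulrDr mulr1; lra.
Qed.

Lemma integrable_mollifier_weight : gam.-integrable setT (EFin \o mollifier_weight).
Proof.
have me (c : R) : measurable_fun [set: R] (fun x : R => expR (c * x)).
  by apply: measurableT_comp.
have ie (c : R) : gam.-integrable setT (EFin \o (fun x => expR (c * x))).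
  apply/integrableP; split; first exact/measurable_EFinP.
  under eq_integral do rewrite /= ger0_norm ?expR_ge0//.
  by rewrite gauss_mgf ltry.
have i1 := integrableD measurableT (ie 2) (ie (- 2)).
have i2 := integrableZl measurableT (2 * expR 2) i1.
have i3 : gam.-integrable setT (EFin \o (fun _ : R => 1)).
  by apply: (integrable_bounded _ 1) => // x; rewrite normr1.
exact: (integrableD measurableT i2 i3).
Qed.

(** The translation is moved from f to the Gaussian density, which is smooth. *)
Lemma average_translation (d B x dd : R) (f : R -> R) : 0 < d ->
  measurable_fun [set: R] f -> (forall x, 0 <= f x <= B) ->
  average d f (x + dd) =
  \int[gam]_y (f (x + d * y) * expR (dd / d * y - (dd / d) ^+ 2 / 2)).
Proof.
move=> d0 mf fb; rewrite /average /Rintegral; congr fine.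
have mfx := measurable_shift d x f mf.
have mfE : measurable_fun [set: R] (fun y => (f (x + d * y))%:E).
  exact/measurable_EFinP.
have fE0 y : (0 <= (f (x + d * y))%:E)%E by rewrite lee_fin; case/andP: (fb (x + d * y)).
rewrite -(integral_gauss_translation (dd / d) _ mfE fE0).
by apply: eq_integral => y _; congr (f _)%:E; field; rewrite gt_eqF.
Qed.

Lemma measurable_Rintegral_param (F : R * R -> R) (k : R -> R) :
  measurable_fun [set: R * R] F -> gam.-integrable setT (EFin \o k) ->
  (forall x y, `|F (x, y)| <= k y) ->
  measurable_fun [set: R] (fun x => \int[gam]_y F (x, y)).
Proof.
move=> mF ik Fk; have [mk _] := integrableP _ _ _ ik.
have mFE : measurable_fun [set: R * R] (EFin \o F) by exact/measurable_EFinP.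
apply: (measurableT_comp (fine_measurable _)) => //.
have iF : ((gam \x gam)%E).-integrable setT (EFin \o F).
  apply/(@integrable12ltyP _ _ _ _ R gam gam _ mFE).
  apply: (@le_lt_trans _ _ (\int[gam]_x \int[gam]_y (k y)%:E)%E); last first.
    by rewrite integral_prob_cst -ge0_fin_numE ?integrable_fin_num//;
      apply: integral_ge0 => y _; rewrite lee_fin; apply: le_trans (Fk 0 y).
  apply: ge0_le_integral => //.
  - by move=> x _; exact: integral_ge0.
  - exact: (@measurable_fun_fubini_tonelli_F _ _ _ _ R gam _
      (measurableT_comp (@abse_measurable R setT) mFE) (fun _ => abse_ge0 _)).
  - move=> x _; apply: ge0_le_integral => //.
    + by apply: measurableT_comp => //; exact: (measurableT_comp mFE (measurable_pair1 x)).
    + by move=> y _; rewrite lee_fin; exact: Fk.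
exact: (measurable_fubini_F iF).
Qed.

(** By [average_translation] the average inherits a second order expansion from
    the Cameron-Martin density; for increments larger than d, where
    [mollifier_remainder] says nothing, the bound is trivial because the average
    and its derivative are bounded. The addition of d gives the lower bound. *)
Lemma mollified_smooth (d B : R) (f : R -> R) : 0 < d <= 1 ->
  measurable_fun [set: R] f -> (forall x, 0 <= f x <= B) ->
  exists C, forall C', C <= C' ->
    smooth_bounded d C' (fun x => average d f x + d).
Proof.
move=> /andP[d0 d1] mf fb.
have B0 : 0 <= B by case/andP: (fb 0) => h1 h2; exact: le_trans h2.
have fB x : `|f x| <= B by case/andP: (fb x) => h1 h2; rewrite ger0_norm.
set M := \int[gam]_y mollifier_weight y.
have wge0 y : 0 <= mollifier_weight y.
  by rewrite addr_ge0// !mulr_ge0 ?addr_ge0 ?expR_ge0.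
have M0 : 0 <= M by apply: Rintegral_ge0.
pose g1 x := \int[gam]_y (f (x + d * y) * (y / d)).
have yw (y : R) : `|y| <= mollifier_weight y.
  rewrite /mollifier_weight.
  have h1 := @expR_ge1Dx R (2 * y); have h2 := @expR_ge1Dx R (- 2 * y).
  have p1 := expR_ge0 (2 * y); have p2 := expR_ge0 (- 2 * y).
  have e2 : 1 <= expR 2 :> R by have := @expR_ge1Dx R 2; lra.
  have : expR (2 * y) + expR (- 2 * y) <= expR 2 * (expR (2 * y) + expR (- 2 * y)).
    by rewrite ler_peMl// addr_ge0.
  by rewrite ler_norml => h; apply/andP; split; lra.
have mi (x : R) : measurable_fun [set: R] (fun y => f (x + d * y) * (y / d)).
  by apply: measurable_funM; [exact: measurable_shift|exact: measurable_funM].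
have dom (k : R -> R) (K : R) : measurable_fun [set: R] k ->
   (forall y, `|k y| <= K * mollifier_weight y) ->
   gam.-integrable setT (EFin \o k) /\ `|\int[gam]_y k y| <= K * M.
  move=> mk kK.
  have iK := integrableZl measurableT K integrable_mollifier_weight.
  have ik : gam.-integrable setT (EFin \o k).
    apply: (le_integrable measurableT _ _ iK); first exact/measurable_EFinP.
    by move=> y _ /=; rewrite lee_fin; apply: (le_trans (kK y)); exact: ler_norm.
  split=> //; apply: (le_trans (le_normr_Rintegral measurableT ik)).
  rewrite /M -RintegralZl//; last exact: integrable_mollifier_weight.
  apply: le_Rintegral => //; first exact: integrable_norm.
have fyB x y : `|f (x + d * y) * (y / d)| <= B / d * mollifier_weight y.
  rewrite normrM normrM normfV (gtr0_norm d0).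
  have -> : B / d * mollifier_weight y = B * (mollifier_weight y / d) by ring.
  apply: ler_pM => //; first by rewrite divr_ge0// ltW.
  by rewrite ler_wpM2r// invr_ge0 ltW.
have g1B x : gam.-integrable setT (EFin \o (fun y => f (x + d * y) * (y / d))) /\
    `|g1 x| <= B / d * M.
  by apply: dom => // y; exact: fyB.
have mg1 : measurable_fun [set: R] g1.
  apply: (measurable_Rintegral_param (fun p : R * R => f (p.1 + d * p.2) * (p.2 / d))
    (fun y => B / d * mollifier_weight y)).
  - apply: measurable_funM; last exact: measurable_funM.
    by apply: (measurableT_comp mf); apply: measurable_funD => //; exact: measurable_funM.
  - exact: (integrableZl measurableT (B / d) integrable_mollifier_weight).
  - by move=> x y; exact: fyB.
have ab x : 0 <= average d f x <= B.
  by apply: gauss_bounded_le => //; exact: measurable_shift.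
have d20 : 0 < d ^+ 2 by rewrite exprn_gt0.
have P1 : 0 <= B * M / d ^+ 2 by rewrite divr_ge0 ?mulr_ge0// ltW.
have P2 : 0 <= B / d ^+ 2 by rewrite divr_ge0// ltW.
exists (B + 1 + (B * M / d ^+ 2) + (B / d ^+ 2)) => C' CC'; split.
- by apply: measurable_funD => //; exact: (measurable_average _ B).
- by move=> x; have /andP[h1 h2] := ab x; apply/andP; split; lra.
- exists g1 => // x dd.
  apply: (@le_trans _ _ ((B * M / d ^+ 2 + B / d ^+ 2) * dd ^+ 2)); last first.
    by rewrite ler_wpM2r ?sqr_ge0//; lra.
  have -> : average d f (x + dd) + d - (average d f x + d) - dd * g1 x =
     average d f (x + dd) - average d f x - dd * g1 x by ring.
  set c := dd / d.
  have ddE : dd = c * d by rewrite /c divfK// gt_eqF.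
  have -> : (B * M / d ^+ 2 + B / d ^+ 2) * dd ^+ 2 = B * c ^+ 2 * M + B * c ^+ 2.
    by rewrite ddE; field; rewrite gt_eqF.
  have c20 : 0 <= c ^+ 2 by exact: sqr_ge0.
  have Bc : 0 <= B * c ^+ 2 by rewrite mulr_ge0.
  have [c1|c1] := leP `|c| 1.
  + rewrite (average_translation d B x dd f d0 mf fb) -/c.
    pose Z y := expR (c * y - c ^+ 2 / 2) - 1 - c * y.
    have mZ1 : measurable_fun [set: R] (fun y : R => expR (c * y - c ^+ 2 / 2)).
      by apply: measurableT_comp => //; apply: measurable_funB => //; exact: measurable_funM.
    have w1 y : 1 <= mollifier_weight y.
      by rewrite /mollifier_weight lerDr !mulr_ge0// ?addr_ge0 ?expR_ge0.
    have [|y|iA _] := dom (fun y => f (x + d * y) * expR (c * y - c ^+ 2 / 2))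
        (B * (1 + 1 + 1)).
        by apply: measurable_funM => //; exact: measurable_shift.
      rewrite normrM -mulrA; apply: ler_pM => //.
      have -> : expR (c * y - c ^+ 2 / 2) = Z y + c * y + 1 by rewrite /Z; ring.
      have hZ := mollifier_remainder c y c1; rewrite -/(Z y) in hZ.
      apply: (le_trans (ler_normD _ _)); rewrite normr1 !mulrDl mul1r lerD//.
      apply: (le_trans (ler_normD _ _)); apply: lerD.
        apply: (le_trans hZ); rewrite ler_piMl//.
        by rewrite -real_normK ?num_real// exprn_ile1.
      by rewrite normrM; apply: le_trans (yw y); rewrite ler_piMl.
    have iB : gam.-integrable setT (EFin \o (fun y => f (x + d * y))).
      by apply: (integrable_bounded _ B) => //; exact: measurable_shift.
    have [iC _] := g1B x.
    have iAB := integrableB measurableT iA iB.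
    have iC' := integrableZl measurableT dd iC.
    rewrite /average -RintegralB// /g1 -RintegralZl// -RintegralB//.
    apply: (@le_trans _ _ (B * c ^+ 2 * M)); last by rewrite lerDl.
    have E y : f (x + d * y) * expR (c * y - c ^+ 2 / 2) - f (x + d * y) -
        dd * (f (x + d * y) * (y / d)) = f (x + d * y) * Z y.
      by rewrite /Z ddE; field; rewrite gt_eqF.
    under eq_Rintegral do rewrite E.
    have [|y|_] := dom (fun y => f (x + d * y) * Z y) (B * c ^+ 2); last by [].
      apply: measurable_funM; first exact: measurable_shift.
      by apply: measurable_funB; [exact: measurable_funB|exact: measurable_funM].
    rewrite normrM -mulrA; apply: ler_pM => //; exact: mollifier_remainder.
  + clearbody c; have [_ gB] := g1B x.
    have cc : `|c| <= c ^+ 2.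
      by rewrite -(real_normK (num_real c)) expr2 ler_peMr// ltW.
    apply: (le_trans (ler_normB _ _)); rewrite addrC; apply: lerD.
      rewrite ddE !normrM (gtr0_norm d0).
      apply: (@le_trans _ _ (`|c| * d * (B / d * M))); first by rewrite ler_wpM2l// mulr_ge0// ltW.
      have -> : `|c| * d * (B / d * M) = B * `|c| * M by field; rewrite gt_eqF.
      by rewrite ler_wpM2r// ler_wpM2l.
    apply: (@le_trans _ _ B); last by rewrite ler_peMr//; lra.
    have /andP[h1 h2] := ab x; have /andP[h3 h4] := ab (x + dd).
    by rewrite ler_norml; apply/andP; split; lra.
Qed.

End mollification.

(** * Density of smooth functions *)

Section density.
Context {R : realType}.
Local Notation gam := (@gauss R).
Local Notation leb := (@lebesgue_measure R).

Lemma gauss_bounded_cvg (F : nat -> R -> R) (G : R -> R) (B : R) :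
  (forall n, measurable_fun [set: R] (F n)) -> (forall n x, `|F n x| <= B) ->
  (forall x, F n x @[n --> \oo] --> G x) ->
  (\int[gam]_x (F n x)%:E @[n --> \oo] --> \int[gam]_x (G x)%:E)%E.
Proof.
move=> mF FB FG.
apply: (@dominated_cvg _ _ R gam setT measurableT (fun n x => (F n x)%:E)
   (fun x => (G x)%:E) (fun _ => B%:E)) => //.
- by move=> n; apply/measurable_EFinP.
- by move=> x _; apply: cvg_EFin; [exact: nearW|exact: FG].
- by apply: (integrable_bounded _ `|B|).
- by move=> n x _; rewrite lee_fin.
Qed.

Lemma average_cvg (g : R -> R) (B : R) (x : R) : continuous g ->
  (forall x, 0 <= g x <= B) ->
  average (n.+1%:R^-1) g x + n.+1%:R^-1 @[n --> \oo] --> g x.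
Proof.
move=> cg gb.
have mg : measurable_fun [set: R] g by exact: continuous_measurable_fun.
have h0 : n.+1%:R^-1 @[n --> \oo] --> (0 : R) by exact: cvg_harmonic.
rewrite -[X in _ --> X]addr0; apply: cvgD => //.
have H := gauss_bounded_cvg (fun n y => g (x + n.+1%:R^-1 * y)) (fun _ => g x) B.
have := H (fun n => measurable_shift _ x g mg).
rewrite integral_prob_cst => /(_ _ _)/fine_cvg; apply.
- by move=> n y; rewrite ger0_norm; case/andP: (gb (x + n.+1%:R^-1 * y)).
- move=> y; apply: continuous_cvg; first exact: cg.
  rewrite -[X in _ --> X]addr0; apply: cvgD; first exact: cvg_cst.
  by rewrite -[X in _ --> X](mul0r y); apply: cvgMl.
Qed.

Definition gauss_dist (f g : R -> R) : \bar R := (\int[gam]_x (`|f x - g x|)%:E)%E.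

(** Density of continuous functions in L^1 of an interval for the Lebesgue measure,
    which dominates gauss because the Gaussian density is at most 1; the tail is bounded by
    Chebyshev's inequality. *)
Lemma continuous_dense (f : R -> R) (B eps : R) : 0 < eps ->
  measurable_fun [set: R] f -> (forall x, 0 <= f x <= B) ->
  exists g : R -> R, [/\ continuous g, forall x, 0 <= g x <= B &
    (gauss_dist f g <= eps%:E)%E].
Proof.
move=> eps0 mf fb.
have B0 : 0 <= B by case/andP: (fb 0) => h1 h2; exact: le_trans h2.
set M2 : R := \int[gam]_x (x ^+ 2); have M20 : 0 <= M2 := gauss_sqr_ge0.
(* the mass of the complement of [-K, K] is at most M2 / K^2, and
   B * M2 / K^2 <= eps / 2 *)
pose K : R := 1 + 2 * B * M2 / eps.
have K1 : 1 <= K by rewrite lerDl divr_ge0 ?mulr_ge0// ltW.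
pose E := [set` `[- K, K]%R] : set R.
have mE : measurable E by exact: measurable_itv.
have Efin : (leb E < +oo)%E.
  by rewrite /E lebesgue_measure_itv /=; case: ifP => _; rewrite -?EFinD ltry.
have iff : leb.-integrable E (EFin \o f).
  apply: measurable_bounded_integrable => //; first exact: measurable_funTS.
  exists B; split; rewrite ?num_real// => y By x _ /=.
  by case/andP: (fb x) => f0 fB; rewrite ger0_norm// (le_trans fB)// ltW.
have [g_ [cg_ ig_ cv_]] := approximation_continuous_integrable mE Efin iff.
have [N dN] : exists N,
    (\int[leb]_(z in E) `|(f z - g_ N z)%:E| < (eps / 2)%:E)%E.
  have /fine_cvgP[fin_ cvf] := cv_.
  have e20 : 0 < eps / 2 by rewrite divr_gt0.
  have /cvgrPdist_lt /(_ _ e20) lt_ := cvf.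
  have [N _ /(_ N (leqnn N)) [F1 F2]] := filterI fin_ lt_.
  exists N; rewrite -(fineK F1) lte_fin; apply: le_lt_trans F2.
  by rewrite sub0r normrN ler_norm.
pose g x := Num.max 0 (Num.min B (g_ N x)).
have cg : continuous g.
  move=> x; apply: (@continuous_max _ _ (cst 0) (fun x => Num.min B (g_ N x))).
    exact: cst_continuous.
  apply: (@continuous_min _ _ (cst B) (g_ N)); first exact: cst_continuous.
  exact: cg_.
have gb x : 0 <= g x <= B.
  by rewrite /g le_max lexx/= ge_max B0 ge_min lexx.
have fgB x : `|f x - g x| <= B.
  have /andP[? ?] := fb x; have /andP[? ?] := gb x.
  by rewrite ler_norml; apply/andP; split; lra.
have fg x : `|f x - g x| <= `|f x - g_ N x|.
  have /andP[h1 h2] := fb x.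
  rewrite /g; case: (leP B (g_ N x)) => h3.
    rewrite max_r//; apply: (le_trans _ (_ : g_ N x - f x <= _)).
      by rewrite ler0_norm ?subr_le0//; lra.
    by rewrite distrC ler_norm.
  case: (leP 0 (g_ N x)) => h4//.
  rewrite subr0 ger0_norm//; apply: le_trans (ler_norm _); lra.
have mg : measurable_fun [set: R] g by exact: continuous_measurable_fun.
have mN : measurable_fun [set: R] (g_ N) by exact: continuous_measurable_fun.
exists g; split => //.
have mfg : measurable_fun [set: R] (fun x => (`|f x - g x|)%:E).
  by apply/measurable_EFinP; apply: measurableT_comp => //; exact: measurable_funB.
rewrite /gauss_dist -ge0_integral_gauss// ge0_integral_normal_prob//.
have pdf0 (x : R) : (0 <= (normal_pdf 0 1 x)%:E)%E by rewrite lee_fin normal_pdf_ge0.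
have pdf1 (x : R) : normal_pdf 0 1 x <= 1.
  apply: (le_trans (normal_pdf_ub _ _ (oner_neq0 _))).
  have p2 : 0 < pi *+ 2 :> R by have := pi_ge2 R; rewrite mulr2n; lra.
  rewrite /normal_peak expr1n mul1r invf_le1 ?sqrtr_gt0//.
  rewrite -[leLHS]sqrtr1; apply: ler_wsqrtr.
  by have := pi_ge2 R; rewrite mulr2n; lra.
have mpdf : measurable_fun [set: R] (fun x : R => (normal_pdf 0 1 x)%:E).
  by apply/measurable_EFinP; exact: measurable_normal_pdf.
have K20 : 0 < K ^+ 2 by rewrite exprn_gt0//; lra.
have BK0 : 0 <= B / K ^+ 2 by rewrite divr_ge0// ltW.
(* D bounds the integrand inside the interval and Q outside *)
pose D x : \bar R := ((fun x => `|(f x - g_ N x)%:E|%E) \_ E) x.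
pose Q x : \bar R := (((B / K ^+ 2) * x ^+ 2)%:E * (normal_pdf 0 1 x)%:E)%E.
have mD : measurable_fun [set: R] D.
  apply/(measurable_restrictT _ mE); apply: measurable_funTS.
  apply: measurableT_comp => //; apply/measurable_EFinP; exact: measurable_funB.
have D0 x : (0 <= D x)%E by rewrite /D patchE; case: ifP.
have q0 (x : R) : (0 <= (B / K ^+ 2 * x ^+ 2)%:E)%E by rewrite lee_fin mulr_ge0// sqr_ge0.
have mq : measurable_fun [set: R] (fun x : R => (B / K ^+ 2 * x ^+ 2)%:E).
  by apply/measurable_EFinP; apply: measurable_funM => //; exact: measurable_funX.
apply: (@le_trans _ _ (\int[leb]_x (D x + Q x))%E).
  apply: ge0_le_integral => //.
  - by move=> x _; rewrite mule_ge0.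
  - exact: emeasurable_funM.
  - by apply: emeasurable_funD => //; exact: emeasurable_funM.
  - move=> x _; rewrite /D /Q patchE; case: ifPn => xE.
      rewrite -!EFinM -EFinD lee_fin; apply: (@le_trans _ _ (`|f x - g_ N x| * 1)).
        by apply: ler_pM => //; rewrite normal_pdf_ge0.
      rewrite mulr1 lerDl; apply: mulr_ge0; last exact: normal_pdf_ge0.
      by apply: mulr_ge0 => //; exact: sqr_ge0.
    rewrite add0e -!EFinM lee_fin ler_wpM2r ?normal_pdf_ge0//.
    apply: (le_trans (fgB x)); rewrite -mulrA ler_peMr//.
    rewrite mulrC ler_pdivlMr// mul1r -(real_normK (num_real x)).
    rewrite lerXn2r ?nnegrE//; first by lra.
    move: xE; rewrite /E notin_setE /= in_itv/= => /negP; rewrite -ler_norml -ltNge.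
    exact: ltW.
rewrite ge0_integralD//; last 2 first.
- by move=> x _; rewrite mule_ge0.
- exact: emeasurable_funM.
have -> : eps%:E = ((eps / 2)%:E + (eps / 2)%:E)%E by rewrite -EFinD; congr (_%:E); field.
apply: leeD.
  by rewrite /D -integral_mkcond; exact: ltW.
rewrite /Q -ge0_integral_normal_prob// ge0_integral_gauss//.
have i2 : gam.-integrable setT (EFin \o (fun x : R => x ^+ 2)).
  apply: (integrable_poly _ 1) => [|x]; first exact: measurable_funX.
  rewrite mul1r ger0_norm ?sqr_ge0//.
  by apply: (@le_trans _ _ (1 + x ^+ 2)); [lra|rewrite ler_eXnr// lerDl sqr_ge0].
under eq_integral do rewrite EFinM.
rewrite integralZl//.
have -> : (\int[gam]_x (x ^+ 2)%:E = M2%:E)%E.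
  by rewrite /M2 /Rintegral fineK//; exact: integrable_fin_num.
rewrite -EFinM lee_fin mulrAC ler_pdivrMr//.
have KK : K <= K ^+ 2 by rewrite expr2 ler_peMr//; lra.
apply: (@le_trans _ _ (eps / 2 * K)); last by rewrite ler_wpM2l// divr_ge0// ltW.
rewrite /K mulrDr mulr1.
have -> : eps / 2 * (2 * B * M2 / eps) = B * M2 by field; rewrite gt_eqF.
by rewrite lerDr divr_ge0// ltW.
Qed.

(** Mollify a continuous approximation: its averages converge pointwise and
    boundedly. *)
Lemma smooth_dense (f : R -> R) (B eps : R) : 0 < eps ->
  measurable_fun [set: R] f -> (forall x, 0 <= f x <= B) ->
  exists g : R -> R, [/\ exists d, 0 < d /\ exists C, forall C', C <= C' -> smooth_bounded d C' g,
    forall x, 0 <= g x <= B + 1 & (gauss_dist f g <= eps%:E)%E].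
Proof.
move=> eps0 mf fb.
have e20 : 0 < eps / 2 by rewrite divr_gt0.
have [g [cg gb dg]] := continuous_dense f B (eps / 2) e20 mf fb.
have mg : measurable_fun [set: R] g by exact: continuous_measurable_fun.
pose a n x := average (n.+1%:R^-1) g x + n.+1%:R^-1.
have d01 n : 0 < (n.+1%:R^-1 : R) <= 1.
  by rewrite invr_gt0 ltr0n invf_le1 ?ltr0n// ler1n.
have ab n x : 0 <= a n x <= B + 1.
  have /andP[d0 d1] := d01 n.
  have /andP[h1 h2] : 0 <= average (n.+1%:R^-1) g x <= B.
    by apply: gauss_bounded_le => //; exact: measurable_shift.
  have key (A q : R) : 0 < q -> q <= 1 -> 0 <= A -> A <= B -> 0 <= A + q <= B + 1.
    by move=> *; apply/andP; split; lra.
  exact: key.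
have ma n : measurable_fun [set: R] (a n).
  apply: measurable_funD => //; apply: (measurable_average _ B) => // x.
  by rewrite ger0_norm; case/andP: (gb x).
have cv : (\int[gam]_x (`|g x - a n x|)%:E @[n --> \oo] --> \int[gam]_x (0 : R)%:E)%E.
  apply: (gauss_bounded_cvg (fun n x => `|g x - a n x|) (fun _ => 0) (B + 1)).
  - by move=> n; apply: measurableT_comp => //; exact: measurable_funB.
  - move=> n x; rewrite normr_id; have /andP[? ?] := ab n x; have /andP[? ?] := gb x.
    by rewrite ler_norml; apply/andP; split; lra.
  - move=> x; have H := average_cvg g B x cg gb.
    by apply/norm_cvg0P; rewrite -[X in _ --> X](subrr (g x)); apply: cvgB => //; exact: cvg_cst.
rewrite integral_prob_cst in cv.
have [n dn] : exists n, (\int[gam]_x (`|g x - a n x|)%:E < (eps / 2)%:E)%E.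
  have /fine_cvgP[fin_ cvf] := cv.
  have /cvgrPdist_lt /(_ _ e20) lt_ := cvf.
  have [n _ /(_ n (leqnn n)) [F1 F2]] := filterI fin_ lt_.
  exists n; rewrite -(fineK F1) lte_fin; apply: le_lt_trans F2.
  by rewrite sub0r normrN ler_norm.
exists (a n); split.
- exists (n.+1%:R^-1); split; first by case/andP: (d01 n).
  exact: mollified_smooth.
- exact: ab.
- apply: (@le_trans _ _ (gauss_dist f g + gauss_dist g (a n)))%E.
    rewrite /gauss_dist -ge0_integralD//; last 2 first.
    + by apply/measurable_EFinP; apply: measurableT_comp => //; exact: measurable_funB.
    + by apply/measurable_EFinP; apply: measurableT_comp => //; exact: measurable_funB.
    apply: ge0_le_integral => //.
    + by apply/measurable_EFinP; apply: measurableT_comp => //; exact: measurable_funB.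
    + apply: emeasurable_funD; apply/measurable_EFinP;
        by apply: measurableT_comp => //; exact: measurable_funB.
    + by move=> x _; rewrite -EFinD lee_fin; exact: ler_distD.
  have -> : eps%:E = ((eps / 2)%:E + (eps / 2)%:E)%E by rewrite -EFinD; congr (_%:E); field.
  by apply: leeD => //; exact: ltW.
Qed.

End density.

(** * Bounded measurable functions *)

Section nelson_bounded.
Context {R : realType}.
Local Notation gam := (@gauss R).

Lemma powR_subadditive (u v a : R) : 0 <= u -> 0 <= v -> 0 < a <= 1 ->
  (u + v) `^ a <= u `^ a + v `^ a.
Proof.
move=> u0 v0 /andP[a0 a1].
have [uv|uv] := eqVneq (u + v) 0.
  by rewrite uv powR0 ?gt_eqF// addr_ge0 ?powR_ge0.
have uvp : 0 < u + v by rewrite lt_neqAle eq_sym uv addr_ge0.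
have key w : 0 <= w -> w <= u + v -> (u + v) `^ a * (w / (u + v)) <= w `^ a.
  move=> w0 wuv.
  have -> : w `^ a = (u + v) `^ a * (w / (u + v)) `^ a.
    by rewrite -powRM ?divr_ge0// ?(ltW uvp)// (mulrC (u + v)) divfK.
  rewrite ler_wpM2l ?powR_ge0//.
  have [->|wn0] := eqVneq w 0; first by rewrite mul0r powR_ge0.
  have wp : 0 < w by rewrite lt_neqAle eq_sym wn0.
  apply: ger1_powR => //; apply/andP; split; first exact: divr_gt0.
  by rewrite ler_pdivrMr// mul1r.
have k1 : (u + v) `^ a * (u / (u + v)) <= u `^ a by apply: key => //; rewrite lerDl.
have k2 : (u + v) `^ a * (v / (u + v)) <= v `^ a by apply: key => //; rewrite lerDr.
apply: le_trans (lerD k1 k2); rewrite -mulrDr -mulrDl divff// mulr1//.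
Qed.

Lemma powR_le_dist (x y a : R) : 0 <= x -> 0 <= y -> 0 < a <= 1 ->
  x `^ a <= y `^ a + `|x - y| `^ a.
Proof.
move=> x0 y0 a01; have /andP[a0 _] := a01.
apply: le_trans (powR_subadditive y `|x - y| a y0 (normr_ge0 _) a01).
rewrite ge0_ler_powR ?nnegrE ?addr_ge0// ?(ltW a0)//.
by rewrite -lerBlDl ler_norm.
Qed.

(** Jensen's inequality for the concave function u^a, by its tangent at eps. *)
Lemma gauss_powR_dist (f g : R -> R) (a eps : R) : 0 < a <= 1 -> 0 < eps ->
  measurable_fun [set: R] f -> measurable_fun [set: R] g ->
  (gauss_dist f g <= eps%:E)%E ->
  (\int[gam]_x (`|f x - g x| `^ a)%:E <= (eps `^ a)%:E)%E.
Proof.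
move=> /andP[a0 a1] eps0 mf mg d.
have mu : measurable_fun [set: R] (fun x => `|f x - g x|).
  by apply: measurableT_comp => //; exact: measurable_funB.
have muE : measurable_fun [set: R] (fun x => (`|f x - g x|)%:E) by exact/measurable_EFinP.
have e0 := powR_ge0 eps a.
have c10 : 0 <= eps `^ a * a / eps by rewrite !mulr_ge0 ?invr_ge0// ltW.
have c20 : 0 <= eps `^ a * (1 - a) by rewrite mulr_ge0// subr_ge0.
apply: (@le_trans _ _ (\int[gam]_x ((eps `^ a * a / eps)%:E * (`|f x - g x|)%:E +
     (eps `^ a * (1 - a))%:E))%E).
  apply: ge0_le_integral => //.
  - by apply/measurable_EFinP; exact: (measurableT_comp (measurable_powR _) mu).
  - apply: emeasurable_funD => //; exact: emeasurable_funM.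
  - move=> x _; rewrite -EFinM -EFinD lee_fin.
    have E : `|f x - g x| `^ a = eps `^ a * (`|f x - g x| / eps) `^ a.
      by rewrite -powRM ?divr_ge0// ?(ltW eps0)// (mulrC eps) divfK// gt_eqF.
    have y := powR_young (`|f x - g x| / eps) a (divr_ge0 (normr_ge0 _) (ltW eps0)) _.
    rewrite E; apply: (@le_trans _ _ (eps `^ a * (a * (`|f x - g x| / eps) + (1 - a)))).
      by rewrite ler_wpM2l// y// ltW.
    by rewrite le_eqVlt; apply/orP; left; apply/eqP; ring.
rewrite ge0_integralD//; last 2 first.
- by move=> x _; rewrite -EFinM lee_fin mulr_ge0.
- exact: emeasurable_funM.
rewrite integral_prob_cst ge0_integralZl//.
apply: (@le_trans _ _ ((eps `^ a * a / eps)%:E * eps%:E + (eps `^ a * (1 - a))%:E)%E).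
  by rewrite leeD2r// lee_wpmul2l// lee_fin.
rewrite -EFinM -EFinD lee_fin divfK ?gt_eqF//; lra.
Qed.

Lemma smooth_bounded_weaken (eta eta' C : R) (f : R -> R) : eta' <= eta ->
  smooth_bounded eta C f -> smooth_bounded eta' C f.
Proof.
move=> ee [mf fb f1]; split => // x; have /andP[h1 ->] := fb x.
by rewrite andbT; exact: le_trans h1.
Qed.

Variables (al be r s : R).
Hypotheses (al01 : 0 < al <= 1) (be01 : 0 < be <= 1) (r0 : 0 < r) (s0 : 0 < s).
Hypotheses (rs : r ^+ 2 + s ^+ 2 = 1)
  (hyp : r ^+ 2 * (al * be) <= (1 - al) * (1 - be)).

(** Both sides are Hoelder continuous for the L^1 distance: the powers al and be
    are Hoelder continuous functions, and r x + s z is standard Gaussian, so that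
    replacing f inside the double integral costs no more than outside. *)
Lemma nelson_bounded_approx (f h : R -> R) (B eps : R) : 0 < eps ->
  measurable_fun [set: R] f -> (forall x, 0 <= f x <= B) ->
  measurable_fun [set: R] h -> (forall x, 0 <= h x <= B) ->
  (\int[gam]_x \int[gam]_z (h x `^ be * f (r * x + s * z) `^ al)%:E <=
   ((\int[gam]_x h x) `^ be * (\int[gam]_x f x) `^ al +
    (2 * (B + 1) `^ be * eps `^ al + 2 * (B + 1) `^ al * eps `^ be))%:E)%E.
Proof.
move=> eps0 mf fb mh hb.
have /andP[al0 al1] := al01; have /andP[be0 be1] := be01.
have [f' [[d1 [d10 [C1 sf]]] fb' df]] := smooth_dense f B eps eps0 mf fb.
have [h' [[d2 [d20 [C2 sh]]] hb' dh]] := smooth_dense h B eps eps0 mh hb.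
have [mf' _ _] := sf C1 (lexx _); have [mh' _ _] := sh C2 (lexx _).
pose eta := Num.min d1 d2.
pose C := Num.max eta (Num.max C1 C2).
have eta0 : 0 < eta by rewrite lt_min d10.
have sf' : smooth_bounded eta C f'.
  apply: (smooth_bounded_weaken d1); first by rewrite ge_min lexx.
  by apply: sf; rewrite !le_max lexx !orbT.
have sh' : smooth_bounded eta C h'.
  apply: (smooth_bounded_weaken d2); first by rewrite ge_min lexx orbT.
  by apply: sh; rewrite !le_max lexx !orbT.
have etaC : eta <= C by rewrite le_max lexx.
have al01' : 0 <= al <= 1 by rewrite (ltW al0).
have be01' : 0 <= be <= 1 by rewrite (ltW be0).
have N := nelson_smooth eta C al be r s f' h' eta0 etaC al01' be01' r0 s0 rs hyp sf' sh'.
have B0 : 0 <= B by case/andP: (fb 0) => h1 h2; exact: le_trans h2.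
set B' := B + 1; have B'0 : 0 <= B' by rewrite addr_ge0.
have mY : measurable_fun [set: R * R] (fun p : R * R => r * p.1 + s * p.2).
  by apply: measurable_funD; exact: measurable_funM.
have mJ (g k : R -> R) : measurable_fun [set: R] g -> measurable_fun [set: R] k ->
    measurable_fun [set: R * R] (fun p : R * R => (k p.1 `^ be * g (r * p.1 + s * p.2) `^ al)%:E).
  move=> mg mk.
  have mp : measurable_fun [set: R * R] (fun p : R * R => (p.1, r * p.1 + s * p.2)).
    exact: measurable_fun_pair.
  exact: (measurableT_comp (measurable_correlated_integrand al be _ _ mg mk) mp).
pose U y := `|f y - f' y| `^ al; pose V x := `|h x - h' x| `^ be.
have mU : measurable_fun [set: R] U.
  apply: (measurableT_comp (measurable_powR _)); apply: measurableT_comp => //.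
  exact: measurable_funB.
have mV : measurable_fun [set: R] V.
  apply: (measurableT_comp (measurable_powR _)); apply: measurableT_comp => //.
  exact: measurable_funB.
have U0 y : 0 <= U y by exact: powR_ge0.
have V0 y : 0 <= V y by exact: powR_ge0.
have key x z : h x `^ be * f (r * x + s * z) `^ al <=
   h' x `^ be * f' (r * x + s * z) `^ al + (B' `^ be * U (r * x + s * z) + B' `^ al * V x).
  set y := r * x + s * z.
  have /andP[f0 fB] := fb y; have /andP[h0 hB] := hb x.
  have /andP[f'0 f'B] := fb' y; have /andP[h'0 h'B] := hb' x.
  have p1 := powR_le_dist (h x) (h' x) be h0 h'0 be01.
  have p2 := powR_le_dist (f y) (f' y) al f0 f'0 al01.
  have fBa : f y `^ al <= B' `^ al by rewrite ge0_ler_powR ?nnegrE ?(ltW al0)// (le_trans fB)// lerDl.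
  have hBb : h' x `^ be <= B' `^ be by rewrite ge0_ler_powR ?nnegrE ?(ltW be0).
  apply: (le_trans (ler_wpM2r (powR_ge0 _ _) p1)); rewrite mulrDl addrA.
  apply: lerD; last by rewrite [leRHS]mulrC ler_wpM2l// V0.
  apply: (le_trans (ler_wpM2l (powR_ge0 _ _) p2)); rewrite mulrDr lerD2l.
  by rewrite ler_wpM2r// U0.
have gUx : (\int[gam]_x (V x)%:E <= (eps `^ be)%:E)%E by exact: gauss_powR_dist.
have gUy : (\int[gam]_x (U x)%:E <= (eps `^ al)%:E)%E by exact: gauss_powR_dist.
have mUY : measurable_fun [set: R * R] (fun p : R * R => (U (r * p.1 + s * p.2))%:E).
  by apply/measurable_EFinP; exact: (measurableT_comp mU mY).
have mVE : measurable_fun [set: R] (fun x => (V x)%:E) by exact/measurable_EFinP.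
have J0 (g k : R -> R) (p : R * R) : (0 <= (k p.1 `^ be * g (r * p.1 + s * p.2) `^ al)%:E)%E.
  by rewrite lee_fin mulr_ge0// powR_ge0.
have UY0 (p : R * R) : (0 <= (U (r * p.1 + s * p.2))%:E)%E by rewrite lee_fin.
have Bb0 : (0 <= (B' `^ be)%:E)%E by rewrite lee_fin powR_ge0.
have Ba0 : (0 <= (B' `^ al)%:E)%E by rewrite lee_fin powR_ge0.
have mJx (g k : R -> R) x : measurable_fun [set: R] g -> measurable_fun [set: R] k ->
    measurable_fun [set: R] (fun z => (k x `^ be * g (r * x + s * z) `^ al)%:E).
  by move=> mg mk; exact: (measurableT_comp (mJ g k mg mk) (measurable_pair1 x)).
have mUx x : measurable_fun [set: R] (fun z => (U (r * x + s * z))%:E).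
  exact: (measurableT_comp mUY (measurable_pair1 x)).
have E1 : (\int[gam]_x \int[gam]_z ((h' x `^ be * f' (r * x + s * z) `^ al)%:E +
    ((B' `^ be)%:E * (U (r * x + s * z))%:E + (B' `^ al)%:E * (V x)%:E)) =
   \int[gam]_x \int[gam]_z (h' x `^ be * f' (r * x + s * z) `^ al)%:E +
   ((B' `^ be)%:E * \int[gam]_y (U y)%:E + (B' `^ al)%:E * \int[gam]_x (V x)%:E))%E.
  have inner x : (\int[gam]_z ((h' x `^ be * f' (r * x + s * z) `^ al)%:E +
      ((B' `^ be)%:E * (U (r * x + s * z))%:E + (B' `^ al)%:E * (V x)%:E)) =
      \int[gam]_z (h' x `^ be * f' (r * x + s * z) `^ al)%:E +
      ((B' `^ be)%:E * \int[gam]_z (U (r * x + s * z))%:E + (B' `^ al)%:E * (V x)%:E))%E.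
    rewrite ge0_integralD//; last 4 first.
    - by move=> z _; exact: (J0 f' h' (x, z)).
    - exact: mJx.
    - by move=> z _; rewrite adde_ge0// mule_ge0// lee_fin.
    - by apply: emeasurable_funD => //; exact: emeasurable_funM.
    rewrite ge0_integralD//; last 3 first.
    - by move=> z _; rewrite mule_ge0// lee_fin.
    - exact: emeasurable_funM.
    - by move=> z _; rewrite mule_ge0// lee_fin.
    rewrite ge0_integralZl//; last by move=> z _; rewrite lee_fin.
    by rewrite integral_prob_cst.
  under eq_integral do rewrite inner.
  have mJI : measurable_fun [set: R] (fun x => \int[gam]_z (h' x `^ be * f' (r * x + s * z) `^ al)%:E)%E.
    exact: (@measurable_fun_fubini_tonelli_F _ _ _ _ R gam _ (mJ f' h' mf' mh') (J0 f' h')).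
  have mUI : measurable_fun [set: R] (fun x => \int[gam]_z (U (r * x + s * z))%:E)%E.
    exact: (@measurable_fun_fubini_tonelli_F _ _ _ _ R gam _ mUY UY0).
  have UI0 x : (0 <= \int[gam]_z (U (r * x + s * z))%:E)%E.
    by apply: integral_ge0 => z _; rewrite lee_fin.
  rewrite ge0_integralD//; last 3 first.
  - by move=> x _; apply: integral_ge0 => z _; exact: (J0 f' h' (x, z)).
  - by move=> x _; rewrite adde_ge0// mule_ge0// lee_fin.
  - by apply: emeasurable_funD; exact: emeasurable_funM.
  congr (_ + _)%E; rewrite ge0_integralD; last 5 first.
  - by [].
  - by move=> x _; rewrite mule_ge0.
  - exact: emeasurable_funM.
  - by move=> x _; rewrite mule_ge0// lee_fin.
  - exact: emeasurable_funM.
  rewrite ge0_integralZl// ge0_integralZl//; last by move=> x _; rewrite lee_fin.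
  rewrite (integral_gauss_rotation r s (fun y => (U y)%:E))//.
  exact/measurable_EFinP.
apply: (@le_trans _ _ (\int[gam]_x \int[gam]_z ((h' x `^ be * f' (r * x + s * z) `^ al)%:E +
    ((B' `^ be)%:E * (U (r * x + s * z))%:E + (B' `^ al)%:E * (V x)%:E)))%E).
  have mR : measurable_fun [set: R * R] (fun p : R * R =>
      ((h' p.1 `^ be * f' (r * p.1 + s * p.2) `^ al)%:E +
      ((B' `^ be)%:E * (U (r * p.1 + s * p.2))%:E + (B' `^ al)%:E * (V p.1)%:E))%E).
    apply: emeasurable_funD; first exact: mJ.
    apply: emeasurable_funD; apply: emeasurable_funM => //.
    exact: (measurableT_comp mVE).
  have R0 (p : R * R) : (0 <= (h' p.1 `^ be * f' (r * p.1 + s * p.2) `^ al)%:E +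
      ((B' `^ be)%:E * (U (r * p.1 + s * p.2))%:E + (B' `^ al)%:E * (V p.1)%:E))%E.
    by rewrite adde_ge0 ?J0// adde_ge0// mule_ge0// lee_fin.
  apply: ge0_le_integral => //.
  - by move=> x _; apply: integral_ge0 => z _; exact: (J0 f h (x, z)).
  - exact: (@measurable_fun_fubini_tonelli_F _ _ _ _ R gam _ (mJ f h mf mh) (J0 f h)).
  - exact: (@measurable_fun_fubini_tonelli_F _ _ _ _ R gam _ mR R0).
  - move=> x _; apply: ge0_le_integral => //.
    + by move=> z _; exact: (J0 f h (x, z)).
    + exact: mJx.
    + exact: (measurableT_comp mR (measurable_pair1 x)).
    + by move=> z _; rewrite -!EFinM -!EFinD lee_fin; exact: key.
rewrite E1.
set F := \int[gam]_x f x; set H := \int[gam]_x h x.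
set F' := \int[gam]_x f' x in N; set H' := \int[gam]_x h' x in N.
have mean (g g' : R -> R) : measurable_fun [set: R] g -> measurable_fun [set: R] g' ->
    (forall x, 0 <= g x <= B) -> (forall x, 0 <= g' x <= B + 1) ->
    (gauss_dist g g' <= eps%:E)%E ->
    [/\ 0 <= \int[gam]_x g x <= B, 0 <= \int[gam]_x g' x <= B' &
      \int[gam]_x g' x <= \int[gam]_x g x + eps].
  move=> mg mg' gb g'b dg; split; [exact: gauss_bounded_le|exact: gauss_bounded_le|].
  have ig : gam.-integrable setT (EFin \o g).
    by apply: (integrable_bounded _ B) => // x; rewrite ger0_norm; case/andP: (gb x).
  have ig' : gam.-integrable setT (EFin \o g').
    by apply: (integrable_bounded _ B') => // x; rewrite ger0_norm; case/andP: (g'b x).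
  have igg : gam.-integrable setT (EFin \o (fun x => g x - g' x)).
    exact: (integrableB measurableT ig ig').
  rewrite -lerBlDl -RintegralB//.
  apply: (le_trans (ler_norm _)).
  have -> : `|\int[gam]_x (g' x - g x)| = `|\int[gam]_x (g x - g' x)|.
    by rewrite !RintegralB// distrC.
  apply: (le_trans (le_normr_Rintegral measurableT igg)).
  rewrite -lee_fin /Rintegral fineK//.
  by apply: integrable_fin_num => //; exact: (integrable_norm igg).
have [/andP[F0 FB] /andP[F'0 F'B] FF'] := mean f f' mf mf' fb fb' df.
have [/andP[H0 HB] /andP[H'0 H'B] HH'] := mean h h' mh mh' hb hb' dh.
rewrite -/F in F0 FB FF'; rewrite -/F' in F'0 F'B FF'.
rewrite -/H in H0 HB HH'; rewrite -/H' in H'0 H'B HH'.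
have e0 := ltW eps0.
have ea := powR_ge0 eps al; have eb := powR_ge0 eps be.
have F'a : F' `^ al <= F `^ al + eps `^ al.
  apply: le_trans (powR_subadditive F eps al F0 e0 al01).
  by rewrite ge0_ler_powR ?nnegrE ?addr_ge0// ltW.
have H'b : H' `^ be <= H `^ be + eps `^ be.
  apply: le_trans (powR_subadditive H eps be H0 e0 be01).
  by rewrite ge0_ler_powR ?nnegrE ?addr_ge0// ltW.
have F'Ba : F' `^ al <= B' `^ al by rewrite ge0_ler_powR ?nnegrE// ltW.
have HBb : H `^ be <= B' `^ be.
  by rewrite ge0_ler_powR ?nnegrE ?(ltW be0)// (le_trans HB)// lerDl.
have prod : H' `^ be * F' `^ al <=
    H `^ be * F `^ al + (B' `^ be * eps `^ al + B' `^ al * eps `^ be).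
  apply: (le_trans (ler_wpM2r (powR_ge0 _ _) H'b)); rewrite mulrDl addrA.
  apply: lerD; last by rewrite mulrC ler_wpM2r.
  apply: (le_trans (ler_wpM2l (powR_ge0 _ _) F'a)); rewrite mulrDr lerD2l.
  by rewrite ler_wpM2r.
apply: (@le_trans _ _ ((H' `^ be * F' `^ al)%:E + ((B' `^ be)%:E * (eps `^ al)%:E +
   (B' `^ al)%:E * (eps `^ be)%:E))%E).
  by apply: leeD => //; apply: leeD; exact: lee_wpmul2l.
rewrite -!EFinM -!EFinD lee_fin; apply: (le_trans (lerD prod (lexx _))).
by rewrite le_eqVlt; apply/orP; left; apply/eqP; ring.
Qed.

(** Nelson's inequality for powers of bounded functions: let eps tend to 0 in
    [nelson_bounded_approx]. *)
Lemma nelson_bounded (f h : R -> R) (B : R) :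
  measurable_fun [set: R] f -> (forall x, 0 <= f x <= B) ->
  measurable_fun [set: R] h -> (forall x, 0 <= h x <= B) ->
  (\int[gam]_x \int[gam]_z (h x `^ be * f (r * x + s * z) `^ al)%:E <=
   ((\int[gam]_x h x) `^ be * (\int[gam]_x f x) `^ al)%:E)%E.
Proof.
move=> mf fb mh hb.
have /andP[al0 al1] := al01; have /andP[be0 be1] := be01.
have B0 : 0 <= B by case/andP: (fb 0) => h1 h2; exact: le_trans h2.
apply/lee_addgt0Pr => tau tau0.
set c := 2 * (B + 1) `^ be + 2 * (B + 1) `^ al.
have c0 : 0 < c by rewrite addr_gt0// mulr_gt0// powR_gt0// ltr_wpDl.
pose q := tau / c; have q0 : 0 < q by rewrite divr_gt0.
pose eps := Num.min (q `^ al^-1) (q `^ be^-1).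
have eps0 : 0 < eps by rewrite lt_min !powR_gt0.
have ea : eps `^ al <= q.
  rewrite -[leRHS](powRr1 (ltW q0)) -(@mulVf _ al) ?gt_eqF// powRrM.
  rewrite ge0_ler_powR ?nnegrE ?powR_ge0 ?(ltW eps0) ?(ltW al0)//.
  by rewrite ge_min lexx.
have eb : eps `^ be <= q.
  rewrite -[leRHS](powRr1 (ltW q0)) -(@mulVf _ be) ?gt_eqF// powRrM.
  rewrite ge0_ler_powR ?nnegrE ?powR_ge0 ?(ltW eps0) ?(ltW be0)//.
  by rewrite ge_min lexx orbT.
apply: (le_trans (nelson_bounded_approx f h B eps eps0 mf fb mh hb)).
rewrite -EFinD lee_fin lerD2l.
apply: (@le_trans _ _ (2 * (B + 1) `^ be * q + 2 * (B + 1) `^ al * q)).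
  by apply: lerD; rewrite ler_wpM2l// mulr_ge0// powR_ge0.
by rewrite -mulrDl -/c /q mulrC divfK// gt_eqF.
Qed.

End nelson_bounded.

(** * Nonnegative measurable functions *)

Section nelson.
Context {R : realType}.
Local Notation gam := (@gauss R).
Local Open Scope ereal_scope.

Lemma cvg_mine_natr (x : \bar R) : 0 <= x ->
  mine x n%:R%:E @[n --> \oo] --> x.
Proof.
case: x => [x| |//] _.
  apply: cvg_near_cst; near=> n.
  rewrite /mine lte_fin; case: ltP => // nx; congr (_%:E); apply/eqP.
  rewrite eq_le nx/=; near: n; exact: nbhs_infty_ger.
apply/cvgeyPge => A; near=> n.
rewrite /mine ltNge leey/= lee_fin; near: n; exact: nbhs_infty_ger.
Unshelve. all: by end_near. Qed.

Lemma le_poweR (r : R) (x y : \bar R) : (0 <= r)%R -> 0 <= x -> x <= y ->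
  x `^ r <= y `^ r.
Proof.
move=> r0 x0 xy; apply: gt0_ler_poweR => //; rewrite in_itv/= ?x0 ?leey//=.
by rewrite (le_trans x0 xy).
Qed.

Definition truncate (F : R -> \bar R) (n : nat) (x : R) : R :=
  fine (mine (F x) n%:R%:E).

Lemma truncateE (F : R -> \bar R) n x : 0 <= F x ->
  (truncate F n x)%:E = mine (F x) n%:R%:E.
Proof.
move=> F0; rewrite fineK// ge0_fin_numE; last by rewrite le_min F0 lee_fin ler0n.
by rewrite gt_min ltry orbT.
Qed.

Lemma truncate_bound (F : R -> \bar R) n x : 0 <= F x ->
  (0 <= truncate F n x <= n%:R)%R.
Proof.
move=> F0; rewrite -!lee_fin truncateE//.
by rewrite le_min F0 lee_fin ler0n/= ge_min lexx orbT.
Qed.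

Lemma measurable_truncate (F : R -> \bar R) n : measurable_fun [set: R] F ->
  measurable_fun [set: R] (truncate F n).
Proof.
move=> mF; apply: (measurableT_comp (fine_measurable _)) => //.
exact: measurable_mine.
Qed.

Variables (p q r s : R).
Hypotheses (p1 : (1 <= p)%R) (q1 : (1 <= q)%R) (r0 : (0 < r)%R) (s0 : (0 < s)%R).
Hypotheses (rs : (r ^+ 2 + s ^+ 2 = 1)%R)
  (hyp : (r ^+ 2 * (p^-1 * q^-1) <= (1 - p^-1) * (1 - q^-1))%R).

(** Nelson's hypercontractivity theorem on the line, in bilinear form: apply
    [nelson_bounded] to powers of truncations, and pass to the limit by monotone
    convergence. *)
Lemma nelson (F H : R -> \bar R) :
  measurable_fun [set: R] F -> (forall x, 0 <= F x) ->
  measurable_fun [set: R] H -> (forall x, 0 <= H x) ->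
  \int[gam]_x \int[gam]_z (H x * F (r * x + s * z)%R) <=
  (\int[gam]_x (H x `^ q)) `^ q^-1 * (\int[gam]_x (F x `^ p)) `^ p^-1.
Proof.
move=> mF F0 mH H0.
have p0 : (0 < p)%R by exact: lt_le_trans p1.
have q0 : (0 < q)%R by exact: lt_le_trans q1.
have pi01 : (0 < p^-1 <= 1)%R by rewrite invr_gt0 p0 invf_le1.
have qi01 : (0 < q^-1 <= 1)%R by rewrite invr_gt0 q0 invf_le1.
have mY : measurable_fun [set: R * R] (fun p : R * R => r * p.1 + s * p.2)%R.
  by apply: measurable_funD; exact: measurable_funM.
have mK (F' H' : R -> \bar R) : measurable_fun [set: R] F' -> measurable_fun [set: R] H' ->
    measurable_fun [set: R * R] (fun p : R * R => H' p.1 * F' (r * p.1 + s * p.2)%R).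
  move=> mF' mH'; apply: emeasurable_funM; first exact: (measurableT_comp mH').
  exact: (measurableT_comp mF' mY).
have bound n : \int[gam]_x \int[gam]_z
    ((truncate H n x)%:E * (truncate F n (r * x + s * z))%:E) <=
  (\int[gam]_x (H x `^ q)) `^ q^-1 * (\int[gam]_x (F x `^ p)) `^ p^-1.
  pose f x := (truncate F n x `^ p)%R; pose h x := (truncate H n x `^ q)%R.
  pose B : R := (n%:R `^ p + n%:R `^ q)%R.
  have n0 : (0 <= n%:R :> R)%R by exact: ler0n.
  have fb x : (0 <= f x <= B)%R.
    have /andP[t0 t1] := truncate_bound F n x (F0 x).
    rewrite powR_ge0/= (@le_trans _ _ (n%:R `^ p)%R)//; last by rewrite lerDl powR_ge0.
    by rewrite ge0_ler_powR ?nnegrE// ltW.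
  have hb x : (0 <= h x <= B)%R.
    have /andP[t0 t1] := truncate_bound H n x (H0 x).
    rewrite powR_ge0/= (@le_trans _ _ (n%:R `^ q)%R)//; last by rewrite lerDr powR_ge0.
    by rewrite ge0_ler_powR ?nnegrE// ltW.
  have mf : measurable_fun [set: R] f.
    exact: (measurableT_comp (measurable_powR _) (measurable_truncate F n mF)).
  have mh : measurable_fun [set: R] h.
    exact: (measurableT_comp (measurable_powR _) (measurable_truncate H n mH)).
  have := nelson_bounded p^-1 q^-1 r s pi01 qi01 r0 s0 rs hyp f h B mf fb mh hb.
  under eq_integral => x _.
    under eq_integral => z _.
      have tH : (truncate H n x = h x `^ q^-1)%R.
        by rewrite /h -powRrM divff ?gt_eqF// powRr1//;
          case/andP: (truncate_bound H n x (H0 x)).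
      have tF : (truncate F n (r * x + s * z) = f (r * x + s * z) `^ p^-1)%R.
        by rewrite /f -powRrM divff ?gt_eqF// powRr1//;
          case/andP: (truncate_bound F n (r * x + s * z) (F0 _)).
      rewrite -tH -tF EFinM; over.
    over.
  have conv (a b c d : R) : (a `^ c * b `^ d)%R%:E = a%:E `^ c * b%:E `^ d.
    by rewrite EFinM.
  move=> N; apply: (le_trans N); rewrite {N} conv.
  have le1 (G : R -> \bar R) (m : R) : measurable_fun [set: R] G -> (forall x, 0 <= G x) ->
    (0 < m)%R -> (forall x, 0 <= truncate G n x `^ m <= B)%R ->
    (\int[gam]_x (truncate G n x `^ m))%R%:E <= \int[gam]_x (G x `^ m).
    move=> mG G0 m0 gb.
    have mg : measurable_fun [set: R] (fun x => truncate G n x `^ m)%R.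
      exact: (measurableT_comp (measurable_powR _) (measurable_truncate G n mG)).
    rewrite /Rintegral fineK; last first.
      apply: integrable_fin_num => //; apply: (integrable_bounded _ B) => // x.
      by rewrite ger0_norm; case/andP: (gb x).
    apply: ge0_le_integral => //.
    - by move=> x _; rewrite lee_fin powR_ge0.
    - exact/measurable_EFinP.
    - exact: (measurableT_comp (measurable_poweR _)).
    - move=> x _; rewrite -poweR_EFin truncateE//.
      apply: le_poweR; rewrite ?(ltW m0)//; first by rewrite le_min G0 lee_fin.
      by rewrite ge_min lexx.
  apply: lee_pmul; [exact: poweR_ge0|exact: poweR_ge0| |];
    (apply: le_poweR; [by rewrite invr_ge0 ltW| |exact: le1]);
    by rewrite lee_fin; apply: Rintegral_ge0 => x _; exact: powR_ge0.
have HF0 (t : R * R) : 0 <= H t.1 * F (r * t.1 + s * t.2)%R by exact: mule_ge0.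
rewrite -(@fubini_tonelli1 _ _ _ _ R gam gam _ (mK F H mF mH) HF0).
pose G n (t : R * R) := (truncate H n t.1)%:E * (truncate F n (r * t.1 + s * t.2)%R)%:E.
have G0 n t : 0 <= G n t.
  by rewrite mule_ge0// lee_fin; [case/andP: (truncate_bound H n t.1 (H0 _))|
   case/andP: (truncate_bound F n (r * t.1 + s * t.2) (F0 _))].
have mG n : measurable_fun [set: R * R] (G n).
  apply: (mK (EFin \o truncate F n) (EFin \o truncate H n));
    apply/measurable_EFinP; exact: measurable_truncate.
have cG t : G n t @[n --> \oo] --> H t.1 * F (r * t.1 + s * t.2)%R.
  rewrite /G; under eq_fun do rewrite !truncateE//.
  have cH := cvg_mine_natr _ (H0 t.1); have cF := cvg_mine_natr _ (F0 (r * t.1 + s * t.2)%R).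
  have [H00|Hn] := eqVneq (H t.1) 0.
    rewrite H00 mul0e; apply: cvg_near_cst; near=> n.
    by rewrite min_l ?lee_fin ?ler0n// mul0e.
  have [F00|Fn] := eqVneq (F (r * t.1 + s * t.2)%R) 0.
    rewrite F00 mule0; apply: cvg_near_cst; near=> n.
    by rewrite [X in _ * X]min_l ?lee_fin ?ler0n// mule0.
  by apply: cvgeM => //; apply: neq0_mule_def; rewrite mule_neq0.
rewrite (_ : \int[_]_t _ = \int[(gam \x gam)%E]_t (limn (G ^~ t))); last first.
  by apply: eq_integral => t _; apply/esym/cvg_lim => //; exact: cG.
rewrite monotone_convergence//; last first.
  move=> t _ m n mn; apply: lee_pmul.
  - by rewrite lee_fin; case/andP: (truncate_bound H m t.1 (H0 _)).
  - by rewrite lee_fin; case/andP: (truncate_bound F m (r * t.1 + s * t.2) (F0 _)).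
  - by rewrite !truncateE// le_min ge_min lexx/= ge_min lee_fin ler_nat mn orbT.
  - by rewrite !truncateE// le_min ge_min lexx/= ge_min lee_fin ler_nat mn orbT.
apply: lime_le.
  apply: ereal_nondecreasing_is_cvgn => m n mn.
  apply: ge0_le_integral => // t _; apply: lee_pmul.
  - by rewrite lee_fin; case/andP: (truncate_bound H m t.1 (H0 _)).
  - by rewrite lee_fin; case/andP: (truncate_bound F m (r * t.1 + s * t.2) (F0 _)).
  - by rewrite !truncateE// le_min ge_min lexx/= ge_min lee_fin ler_nat mn orbT.
  - by rewrite !truncateE// le_min ge_min lexx/= ge_min lee_fin ler_nat mn orbT.
apply: nearW => n; apply: le_trans (bound n).
by rewrite (@fubini_tonelli1 _ _ _ _ R gam gam _ (mG n) (G0 n)).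
Unshelve. all: by end_near. Qed.

End nelson.

(** * Dilations and the sharp constant in dimension one *)

Section scaling.
Context {R : realType}.
Local Notation gam := (@gauss R).
Local Notation leb := (@lebesgue_measure R).

Lemma measurable_normal_kernel (r s : R) : 0 < s ->
  measurable_fun [set: R * R]
    (fun p : R * R => (normal_pdf 0 1 p.1 * normal_pdf (r * p.1) s p.2)%:E).
Proof.
move=> s0; apply/measurable_EFinP; apply: measurable_funM.
  exact: (measurableT_comp (measurable_normal_pdf 0 1)).
rewrite (_ : (fun _ => _) = (fun p : R * R => normal_pdf 0 s (p.2 - r * p.1))).
  apply: (measurableT_comp (measurable_normal_pdf 0 s)).
  by apply: measurable_funB => //; exact: measurable_funM.
apply/funext => p; rewrite !normal_pdfE ?gt_eqF//.
by rewrite /normal_fun subr0.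
Qed.

Local Open Scope ereal_scope.

(** Change of variables z' = r x + s z in the inner integral. *)
Lemma gauss_density (r s : R) (H F : R -> \bar R) : (0 < s)%R ->
  measurable_fun [set: R] H -> (forall x, 0 <= H x) ->
  measurable_fun [set: R] F -> (forall x, 0 <= F x) ->
  \int[gam]_x \int[gam]_z (H x * F (r * x + s * z)%R) =
  \int[leb]_x \int[leb]_z (H x * F z *
     (normal_pdf 0 1 x * normal_pdf (r * x) s z)%:E).
Proof.
move=> s0 mH H0 mF F0.
have mY : measurable_fun [set: R * R] (fun p : R * R => r * p.1 + s * p.2)%R.
  by apply: measurable_funD; exact: measurable_funM.
have mK : measurable_fun [set: R * R] (fun p : R * R => H p.1 * F (r * p.1 + s * p.2)%R).
  apply: emeasurable_funM; first exact: (measurableT_comp mH).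
  exact: (measurableT_comp mF mY).
have K0 (p : R * R) : 0 <= H p.1 * F (r * p.1 + s * p.2)%R by exact: mule_ge0.
rewrite -ge0_integral_gauss; last 2 first.
- exact: (@measurable_fun_fubini_tonelli_F _ _ _ _ R gam _ mK K0).
- by move=> x; apply: integral_ge0 => z _; exact: mule_ge0.
rewrite ge0_integral_normal_prob; last 2 first.
- exact: (@measurable_fun_fubini_tonelli_F _ _ _ _ R gam _ mK K0).
- by move=> x; apply: integral_ge0 => z _; exact: mule_ge0.
apply: eq_integral => x _.
have mFx : measurable_fun [set: R] (fun z => F (r * x + s * z)%R).
  exact: (measurableT_comp (measurableT_comp mF mY) (measurable_pair1 x)).
have pdf0 m s' y : 0 <= (normal_pdf m s' y : R)%:E by rewrite lee_fin normal_pdf_ge0.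
have mpdf : measurable_fun [set: R] (fun z : R => (normal_pdf (r * x) s z)%:E).
  by apply/measurable_EFinP; exact: measurable_normal_pdf.
rewrite ge0_integralZl//.
rewrite -ge0_integral_gauss// ge0_integral_normal_affine//.
rewrite -muleA -ge0_integralZr; last 4 first.
- by [].
- exact: emeasurable_funM.
- by move=> z _; exact: mule_ge0.
- exact: pdf0.
rewrite -ge0_integralZl; last 4 first.
- by [].
- by apply: emeasurable_funM => //; exact: emeasurable_funM.
- by move=> z _; rewrite !mule_ge0.
- exact: H0.
apply: eq_integral => z _.
by rewrite EFinM -!muleA; congr (_ * (_ * _)); rewrite muleC.
Qed.

(** The weight turns the density of X into 1 / c times that of X / c. *)
Lemma gauss_scaling (c : R) (G : R -> \bar R) : (0 < c)%R ->
  measurable_fun [set: R] G -> (forall x, 0 <= G x) ->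
  \int[gam]_x (G (c * x)%R * (expR ((1 - c ^+ 2) / 2 * x ^+ 2))%:E) =
  (c^-1)%:E * \int[gam]_x G x.
Proof.
move=> c0 mG G0.
have mGc : measurable_fun [set: R] (fun x => G (c * x)%R).
  exact: (measurableT_comp mG).
have mexp : measurable_fun [set: R] (fun x : R => (expR ((1 - c ^+ 2) / 2 * x ^+ 2))%:E).
  by apply/measurable_EFinP; apply: measurableT_comp => //; exact: measurable_funM.
have mpdf : measurable_fun [set: R] (fun z : R => (normal_pdf 0 1 z)%:E).
  by apply/measurable_EFinP; exact: measurable_normal_pdf.
have pdf0 y : 0 <= (normal_pdf 0 1 y : R)%:E by rewrite lee_fin normal_pdf_ge0.
rewrite -ge0_integral_gauss; last 2 first.
- exact: emeasurable_funM.
- by move=> x; rewrite mule_ge0// lee_fin expR_ge0.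
rewrite ge0_integral_normal_prob; last 2 first.
- exact: emeasurable_funM.
- by move=> x; rewrite mule_ge0// lee_fin expR_ge0.
rewrite -[in RHS]ge0_integral_gauss// [in RHS]ge0_integral_normal_prob//.
rewrite [in RHS](ge0_integral_lebesgue_affine c 0)//; last 2 first.
- exact: emeasurable_funM.
- by move=> x; exact: mule_ge0.
rewrite muleA -EFinM mulVf ?gt_eqF// mul1e.
apply: eq_integral => x _; rewrite addr0 -muleA; congr (_ * _).
rewrite -EFinM; congr (_%:E).
rewrite !normal_pdfE ?oner_eq0// /normal_fun mulrCA -expRD; congr (_ * expR _)%R.
by field.
Qed.

Lemma normal_peak_scale (s : R) : (0 < s)%R -> (normal_peak s = normal_peak 1 / s)%R.
Proof.
move=> s0; rewrite /normal_peak expr1n mul1r -mulrnAr sqrtrM ?sqr_ge0//.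
by rewrite sqrtr_sqr gtr0_norm// invfM mulrC.
Qed.

End scaling.

Section constants.
Context {R : realType}.
Variables (t a p q : R).
Hypotheses (t0 : 0 < t) (p1 : 1 < p) (pq : p < q)
  (hpq : q - 1 = expR (2 * t) * (p * expR (- a) - 1)).

(** The correlation for which the exponents p and conj_q q are extremal in
    Nelson's theorem. *)
Definition scale_r : R := Num.sqrt ((p - 1) / (q - 1)).
Definition scale_r' : R := Num.sqrt ((q - p) / (q - 1)).
Definition ou_s : R := expR (- t).
Definition ou_sg : R := Num.sqrt (1 - expR (- (2 * t))).
(** The dilations: the variable of H is multiplied by scale_lam and the variable
    of F by scale_mu. Compared with the dilation by exp(-a/2) already present in
    the norm of F, the latter is scale_m. *)
Definition scale_k : R := ou_sg / scale_r'.
Definition scale_lam : R := expR (a / 2) * scale_k.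
Definition scale_m : R := scale_r / ou_s * scale_k.
Definition scale_mu : R := scale_m * expR (- (a / 2)).

Lemma ou_sE : ou_s ^+ 2 = expR (- (2 * t)).
Proof. by rewrite /ou_s -expRM_natl mulrN. Qed.

Lemma ou_s_lt1 : expR (- (2 * t)) < 1.
Proof. by rewrite -[ltRHS]expR0 ltr_expR; move: t0; lra. Qed.

Lemma ou_sgE : ou_sg ^+ 2 = 1 - ou_s ^+ 2.
Proof. by rewrite ou_sE sqr_sqrtr// subr_ge0 ltW// ou_s_lt1. Qed.

Lemma ou_sg_gt0 : 0 < ou_sg.
Proof. by rewrite sqrtr_gt0 subr_gt0 ou_s_lt1. Qed.

Lemma scale_rE : scale_r ^+ 2 = (p - 1) / (q - 1).
Proof. by rewrite sqr_sqrtr// divr_ge0//; move: p1 pq; lra. Qed.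

Lemma scale_r'E : scale_r' ^+ 2 = (q - p) / (q - 1).
Proof. by rewrite sqr_sqrtr// divr_ge0//; move: p1 pq; lra. Qed.

Lemma scale_r_gt0 : 0 < scale_r.
Proof. by rewrite sqrtr_gt0 divr_gt0//; move: p1 pq; lra. Qed.

Lemma scale_r'_gt0 : 0 < scale_r'.
Proof. by rewrite sqrtr_gt0 divr_gt0//; move: p1 pq; lra. Qed.

Lemma scale_k_gt0 : 0 < scale_k.
Proof. by rewrite divr_gt0 ?ou_sg_gt0 ?scale_r'_gt0. Qed.

Lemma scale_lam_gt0 : 0 < scale_lam.
Proof. by rewrite mulr_gt0 ?expR_gt0 ?scale_k_gt0. Qed.

Lemma scale_m_gt0 : 0 < scale_m.
Proof. by rewrite mulr_gt0 ?scale_k_gt0// divr_gt0 ?scale_r_gt0 ?expR_gt0. Qed.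

Lemma scale_mu_gt0 : 0 < scale_mu.
Proof. by rewrite mulr_gt0 ?expR_gt0 ?scale_m_gt0. Qed.

(** The hypothesis on the exponents, solved for the dilation parameter. *)
Lemma exponent_relation : expR a * (1 + ou_s ^+ 2 * (q - 1)) = p.
Proof.
rewrite hpq ou_sE mulrA -expRD addNr expR0 mul1r subrKC mulrCA -expRD.
by rewrite subrr expR0 mulr1.
Qed.

(** The exponents of [normal_kernel_scaling]. Three coefficients have
    to match for two dilations, which [exponent_relation] makes possible. *)
Lemma scale_form (x z : R) :
  (scale_lam * x) ^+ 2 / 2 +
    (scale_mu * z - ou_s * (scale_lam * x)) ^+ 2 / (2 * ou_sg ^+ 2) =
  x ^+ 2 / 2 + (z - scale_r * x) ^+ 2 / (2 * scale_r' ^+ 2) -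
    (1 - scale_lam ^+ 2) / 2 * x ^+ 2 * ((q - 1) / q) -
    (1 - scale_m ^+ 2) / 2 * z ^+ 2 / p.
Proof.
set S := ou_s ^+ 2.
have S0 : 0 < S by rewrite exprn_gt0// expR_gt0.
have S1 : S < 1 by rewrite /S ou_sE ou_s_lt1.
have [p0 q0 q10 qp] : [/\ 0 < p, 0 < q, 0 < q - 1 & 0 < q - p].
  by move: p1 pq => ? ?; split; lra.
have D0 : 0 < 1 + S * (q - 1) by rewrite addr_gt0// mulr_gt0.
have es : expR (- (a / 2)) * expR (a / 2) = 1 by rewrite -expRD addNr expR0.
have ea : expR (a / 2) ^+ 2 = p / (1 + S * (q - 1)).
  have -> : expR (a / 2) ^+ 2 = expR a by rewrite -expRM_natl; congr expR; field.
  by rewrite -[X in X / _]exponent_relation -/S mulfK// gt_eqF.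
have ea' : expR (- (a / 2)) ^+ 2 = (1 + S * (q - 1)) / p.
  by rewrite expRN exprVn ea invf_div.
have k2 : scale_k ^+ 2 = (1 - S) * (q - 1) / (q - p).
  by rewrite /scale_k expr_div_n ou_sgE scale_r'E -/S; field; rewrite !gt_eqF.
have c1 : scale_lam ^+ 2 = p / (1 + S * (q - 1)) * ((1 - S) * (q - 1) / (q - p)).
  by rewrite /scale_lam exprMn ea k2.
have c4 : scale_m ^+ 2 = (p - 1) * (1 - S) / (S * (q - p)).
  by rewrite /scale_m exprMn expr_div_n scale_rE k2 -/S; field; rewrite !gt_eqF.
have c2 : scale_mu ^+ 2 = (p - 1) * (1 - S) / (S * (q - p)) * ((1 + S * (q - 1)) / p).
  by rewrite /scale_mu exprMn c4 ea'.
have c3 : ou_s * scale_lam * scale_mu = scale_r * ((1 - S) * (q - 1) / (q - p)).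
  have s0 : ou_s != 0 by rewrite gt_eqF// expR_gt0.
  transitivity (scale_r * scale_k ^+ 2 * (expR (- (a / 2)) * expR (a / 2))).
    by rewrite /scale_lam /scale_mu /scale_m; field.
  by rewrite es mulr1 k2.
have -> : (scale_lam * x) ^+ 2 / 2 +
    (scale_mu * z - ou_s * (scale_lam * x)) ^+ 2 / (2 * ou_sg ^+ 2) =
  scale_lam ^+ 2 * x ^+ 2 / 2 + (scale_mu ^+ 2 * z ^+ 2 -
    2 * (ou_s * scale_lam * scale_mu) * x * z + S * scale_lam ^+ 2 * x ^+ 2) / (2 * ou_sg ^+ 2).
  by rewrite /S; ring.
have -> : (z - scale_r * x) ^+ 2 = z ^+ 2 - 2 * scale_r * x * z + scale_r ^+ 2 * x ^+ 2.
  by ring.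
rewrite c1 c2 c3 c4 scale_rE scale_r'E ou_sgE -/S.
have S1' : 1 - S != 0 by rewrite gt_eqF// subr_gt0.
field.
by rewrite ?S1' ?(gt_eqF S0) ?(gt_eqF p0) ?(gt_eqF q0) ?(gt_eqF q10) ?(gt_eqF qp) ?(gt_eqF D0).
Qed.

(** The two weights are the roots of order conj_q q and p of those in
    [gauss_scaling], so that they disappear from the norms of H and F. *)
Lemma normal_kernel_scaling (x z : R) :
  scale_lam * scale_mu * (normal_pdf 0 1 (scale_lam * x) *
     normal_pdf (ou_s * (scale_lam * x)) ou_sg (scale_mu * z)) =
  scale_m * (expR ((1 - scale_lam ^+ 2) / 2 * x ^+ 2 * ((q - 1) / q)) *
     expR ((1 - scale_m ^+ 2) / 2 * z ^+ 2 / p) *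
     (normal_pdf 0 1 x * normal_pdf (scale_r * x) scale_r' z)).
Proof.
have sg0 := ou_sg_gt0; have r'0 := scale_r'_gt0.
rewrite !normal_pdfE ?oner_eq0 ?(gt_eqF sg0) ?(gt_eqF r'0)//.
rewrite (normal_peak_scale _ sg0) (normal_peak_scale _ r'0) /normal_fun.
have -> : scale_lam * scale_mu = scale_m * scale_k.
  have es : expR (- (a / 2)) * expR (a / 2) = 1 by rewrite -expRD addNr expR0.
  transitivity (scale_m * scale_k * (expR (- (a / 2)) * expR (a / 2))).
    by rewrite /scale_lam /scale_mu; ring.
  by rewrite es mulr1.
have -> : forall P A B : R, scale_m * scale_k * (P * A * (P / ou_sg * B)) =
    scale_m * scale_k * P ^+ 2 / ou_sg * (A * B) by move=> *; ring.
have -> : forall P A B C D : R, scale_m * (C * D * (P * A * (P / scale_r' * B))) =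
    scale_m * P ^+ 2 / scale_r' * (C * D * (A * B)) by move=> *; ring.
rewrite -!expRD !subr0 expr1n.
congr (_ * expR _); first by rewrite /scale_k; field; rewrite !gt_eqF.
have := scale_form x z.
move=> E.
have -> : - (scale_lam * x) ^+ 2 / (1 *+ 2) +
   - (scale_mu * z - ou_s * (scale_lam * x)) ^+ 2 / (ou_sg ^+ 2 *+ 2) =
   - ((scale_lam * x) ^+ 2 / 2 +
    (scale_mu * z - ou_s * (scale_lam * x)) ^+ 2 / (2 * ou_sg ^+ 2)).
  by rewrite mulr2n -mulr_natl; field; rewrite gt_eqF.
have [p0 q0 q10 qp] : [/\ 0 < p, 0 < q, 0 < q - 1 & 0 < q - p].
  by move: p1 pq => ? ?; split; lra.
by rewrite E; field; rewrite !gt_eqF.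
Qed.

(** The factor scale_m of [normal_kernel_scaling], multiplied by those that
    [gauss_scaling] contributes to the two norms. *)
Definition scale_constant : R :=
  scale_m `^ (1 - 1 / p) * scale_lam `^ (1 / q - 1).

Lemma scale_constantE :
  (((p - 1) / expR (- (2 * t))) `^ (1 - 1 / p)
           * ((q - 1) / expR (- a)) `^ (1 / q - 1)
           * ((1 - expR (- (2 * t))) / (q - p)) `^ (1 / q - 1 / p)) `^ (1 / 2) =
  scale_constant.
Proof.
have [p0 q0 q10 qp] : [/\ 0 < p, 0 < q, 0 < q - 1 & 0 < q - p].
  by move: p1 pq => ? ?; split; lra.
have p10 : 0 < p - 1 by move: p1; lra.
have S1 : 0 < 1 - expR (- (2 * t)) by rewrite subr_gt0 ou_s_lt1.
have powE (x y : R) : 0 < x -> x `^ y = expR (y * ln x) by move=> x0; rewrite /powR gt_eqF.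
have sq (x y : R) : 0 < x -> x `^ y = expR (y / 2 * ln (x ^+ 2)).
  by move=> x0; rewrite powE// lnXn// mulr2n; congr expR; field.
rewrite /scale_constant (sq scale_m) ?scale_m_gt0// (sq scale_lam) ?scale_lam_gt0//.
have lk : ln (scale_k ^+ 2) = ln (1 - expR (- (2 * t))) + ln (q - 1) - ln (q - p).
  rewrite /scale_k expr_div_n ou_sgE ou_sE scale_r'E invf_div mulrA.
  by rewrite ln_div ?posrE ?mulr_gt0// lnM.
have lm : ln (scale_m ^+ 2) = ln (p - 1) - ln (q - 1) + 2 * t + ln (scale_k ^+ 2).
  have rs0 : 0 < scale_r / ou_s by exact: divr_gt0 scale_r_gt0 (expR_gt0 _).
  rewrite /scale_m exprMn lnM ?posrE; last 2 first.
  - exact: exprn_gt0.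
  - by apply: exprn_gt0; exact: scale_k_gt0.
  have rr0 : 0 < (p - 1) / (q - 1) by exact: divr_gt0.
  by rewrite expr_div_n scale_rE ou_sE !ln_div ?posrE ?expR_gt0// expRK opprK.
have ll : ln (scale_lam ^+ 2) = a + ln (scale_k ^+ 2).
  rewrite /scale_lam exprMn lnM ?posrE; last 2 first.
  - by apply: exprn_gt0; exact: expR_gt0.
  - by apply: exprn_gt0; exact: scale_k_gt0.
  by rewrite -expRM_natl expRK; congr (_ + _); field.
rewrite lm ll lk.
have A0 : 0 < (p - 1) / expR (- (2 * t)) by exact: divr_gt0 p10 (expR_gt0 _).
have B0 : 0 < (q - 1) / expR (- a) by exact: divr_gt0 q10 (expR_gt0 _).
have C0 : 0 < (1 - expR (- (2 * t))) / (q - p) by exact: divr_gt0.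
rewrite powE; last by rewrite !mulr_gt0// powR_gt0.
have lnM3 (x y z u v w : R) : 0 < x -> 0 < y -> 0 < z ->
    ln (x `^ u * y `^ v * z `^ w) = u * ln x + v * ln y + w * ln z.
  move=> x0 y0 z0; have xu := powR_gt0 u x0; have yv := powR_gt0 v y0.
  by have zw := powR_gt0 w z0; rewrite !lnM ?posrE ?mulr_gt0// !ln_powR.
rewrite lnM3// -expRD; congr expR.
rewrite !ln_div ?posrE ?expR_gt0// !expRK.
by field; rewrite !gt_eqF.
Qed.


Definition conj_q : R := q / (q - 1).

Local Open Scope ereal_scope.

(** Nelson's inequality for the dilated and weighted functions H' and F'. *)
Lemma line_inequality (F H : R -> \bar R) :
  measurable_fun [set: R] F -> (forall x, 0 <= F x) ->
  measurable_fun [set: R] H -> (forall x, 0 <= H x) ->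
  \int[gauss]_x \int[gauss]_z (H x * F (ou_s * x + ou_sg * z)%R) <=
  scale_constant%:E * ((\int[gauss]_x (H x `^ conj_q)) `^ conj_q^-1 *
     (\int[gauss]_x (F (expR (- (a / 2)) * x)%R `^ p)) `^ p^-1).
Proof.
move=> mF F0 mH H0.
have [p0 q0 q10 qp] : [/\ 0 < p, 0 < q, 0 < q - 1 & 0 < q - p]%R.
  by move: p1 pq => ? ?; split; lra.
have lam0 := scale_lam_gt0; have mu0 := scale_mu_gt0; have m0 := scale_m_gt0.
have sg0 := ou_sg_gt0; have r0 := scale_r_gt0; have r'0 := scale_r'_gt0.
have qc0 : (0 < conj_q)%R by rewrite divr_gt0.
have mHl : measurable_fun [set: R] (fun x => H (scale_lam * x)%R) by exact: (measurableT_comp mH).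
have mFm : measurable_fun [set: R] (fun x => F (scale_mu * x)%R) by exact: (measurableT_comp mF).
have mFe : measurable_fun [set: R] (fun x => F (expR (- (a / 2)) * x)%R).
  exact: (measurableT_comp mF).
have mw (c d : R) : measurable_fun [set: R] (fun x : R => (expR (c * x ^+ 2 * d))%:E).
  apply/measurable_EFinP; apply: measurableT_comp => //; apply: measurable_funM => //.
  by apply: measurable_funM.
pose H' x := H (scale_lam * x)%R * (expR ((1 - scale_lam ^+ 2) / 2 * x ^+ 2 * ((q - 1) / q)))%:E.
pose F' z := F (scale_mu * z)%R * (expR ((1 - scale_m ^+ 2) / 2 * z ^+ 2 / p))%:E.
have H'0 x : 0 <= H' x by rewrite mule_ge0// lee_fin expR_ge0.
have F'0 x : 0 <= F' x by rewrite mule_ge0// lee_fin expR_ge0.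
have mH' : measurable_fun [set: R] H' by exact: emeasurable_funM.
have mF' : measurable_fun [set: R] F' by exact: emeasurable_funM.
have K0 r s x z : 0 <= (normal_pdf 0 1 x * normal_pdf (r * x) s z : R)%:E.
  by rewrite lee_fin mulr_ge0// normal_pdf_ge0.
have mT (r s : R) (h f : R -> \bar R) : (0 < s)%R -> measurable_fun [set: R] h ->
    measurable_fun [set: R] f -> measurable_fun [set: R * R] (fun t : R * R =>
      h t.1 * f t.2 * (normal_pdf 0 1 t.1 * normal_pdf (r * t.1) s t.2)%:E).
  move=> s0 mh mf; apply: emeasurable_funM; last exact: measurable_normal_kernel.
  by apply: emeasurable_funM; [exact: (measurableT_comp mh)|exact: (measurableT_comp mf)].
have main : \int[gauss]_x \int[gauss]_z (H x * F (ou_s * x + ou_sg * z)%R) =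
    scale_m%:E * \int[gauss]_x \int[gauss]_z (H' x * F' (scale_r * x + scale_r' * z)%R).
  rewrite gauss_density// gauss_density//.
  pose T (x z : R) := H x * F z * (normal_pdf 0 1 x * normal_pdf (ou_s * x) ou_sg z)%:E.
  pose T' (x z : R) := H' x * F' z * (normal_pdf 0 1 x * normal_pdf (scale_r * x) scale_r' z)%:E.
  have T0 x z : 0 <= T x z by rewrite !mule_ge0.
  have T'0 x z : 0 <= T' x z by rewrite !mule_ge0.
  have mTT : measurable_fun [set: R * R] (fun t : R * R => T t.1 t.2) by exact: mT.
  have mTT' : measurable_fun [set: R * R] (fun t : R * R => T' t.1 t.2) by exact: mT.
  have TT' x z : (scale_lam * scale_mu)%:E * T (scale_lam * x)%R (scale_mu * z)%R =
      scale_m%:E * T' x z.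
    rewrite /T /T' /H' /F'.
    set A := H _; set B := F _; set k := (normal_pdf 0 1 (scale_lam * x) * _)%R.
    set u := expR _; set v := expR _; set k' := (normal_pdf 0 1 x * _)%R.
    have E : (scale_lam * scale_mu * k = scale_m * (u * v * k'))%R.
      exact: normal_kernel_scaling.
    transitivity (A * B * (scale_lam * scale_mu * k)%:E).
      by rewrite muleCA -EFinM.
    by rewrite E (muleACA A) -(muleA (A * B)) [RHS]muleCA -!EFinM.
  have mI : measurable_fun [set: R] (fun x => \int[lebesgue_measure]_z T x z).
    exact: (@measurable_fun_fubini_tonelli_F _ _ _ _ R lebesgue_measure
      (fun t : R * R => T t.1 t.2) mTT (fun t => T0 _ _)).
  have I0 x : 0 <= \int[lebesgue_measure]_z T x z.
    by apply: integral_ge0 => z _; exact: T0.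
  transitivity (scale_lam%:E * \int[lebesgue_measure]_x (scale_mu%:E *
     \int[lebesgue_measure]_z T (scale_lam * x)%R (scale_mu * z)%R)).
    transitivity (\int[lebesgue_measure]_x \int[lebesgue_measure]_z T x z); first by [].
    rewrite (ge0_integral_lebesgue_affine scale_lam 0 _ lam0 mI I0).
    apply: (congr1 (fun I => scale_lam%:E * I)).
    apply: eq_integral => x _; rewrite addr0.
    have mTx : measurable_fun [set: R] (T (scale_lam * x)%R).
      exact: (measurableT_comp mTT (measurable_pair1 (scale_lam * x)%R)).
    rewrite (ge0_integral_lebesgue_affine scale_mu 0 _ mu0 mTx (T0 _)).
    apply: (congr1 (fun I => scale_mu%:E * I)).
    apply: eq_integral => z _; apply: (congr1 (T (scale_lam * x)%R)).
    exact: addr0.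
  have mTs : measurable_fun [set: R * R] (fun t : R * R => T (scale_lam * t.1)%R (scale_mu * t.2)%R).
    have mp : measurable_fun [set: R * R] (fun t : R * R => (scale_lam * t.1, scale_mu * t.2)%R).
      by apply: measurable_fun_pair; exact: measurable_funM.
    exact: (measurableT_comp mTT mp).
  pose TI (x : R) := \int[lebesgue_measure]_z T (scale_lam * x)%R (scale_mu * z)%R.
  have mTI : measurable_fun [set: R] TI.
    exact: (@measurable_fun_fubini_tonelli_F _ _ _ _ R lebesgue_measure _ mTs (fun t => T0 _ _)).
  rewrite -ge0_integralZl; last 4 first.
  - by [].
  - exact: (emeasurable_funM (measurable_cst _) mTI).
  - move=> x _; rewrite mule_ge0 ?lee_fin ?(ltW mu0)//.
    by apply: integral_ge0 => z _; exact: T0.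
  - by rewrite lee_fin ltW.
  rewrite -[RHS]ge0_integralZl; last 4 first.
  - by [].
  - exact: (@measurable_fun_fubini_tonelli_F _ _ _ _ R lebesgue_measure _ mTT' (fun t => T'0 _ _)).
  - by move=> x _; apply: integral_ge0 => z _; exact: T'0.
  - by rewrite lee_fin ltW.
  apply: eq_integral => x _; rewrite muleA -EFinM.
  rewrite -ge0_integralZl; last 4 first.
  - by [].
  - exact: (measurableT_comp mTs (measurable_pair1 x)).
  - by move=> z _; exact: T0.
  - by rewrite lee_fin mulr_ge0// ltW.
  rewrite -[RHS]ge0_integralZl; last 4 first.
  - by [].
  - exact: (measurableT_comp mTT' (measurable_pair1 x)).
  - by move=> z _; exact: T'0.
  - by rewrite lee_fin ltW.
  by apply: eq_integral => z _; exact: TT'.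
have H'q : \int[gauss]_x (H' x `^ conj_q) = (scale_lam^-1)%:E * \int[gauss]_x (H x `^ conj_q).
  have mHq : measurable_fun [set: R] (fun x => H x `^ conj_q).
    exact: (measurableT_comp (measurable_poweR _)).
  have mHq0 x : 0 <= H x `^ conj_q by exact: poweR_ge0.
  rewrite -(gauss_scaling scale_lam (fun x => H x `^ conj_q) lam0 mHq mHq0).
  apply: eq_integral => x _; rewrite /H' poweRM ?lee_fin ?expR_ge0//.
  congr (_ * _); rewrite poweR_EFin -expRM; congr (expR _)%:E.
  by rewrite /conj_q; field; rewrite !gt_eqF.
have F'p : \int[gauss]_x (F' x `^ p) =
    (scale_m^-1)%:E * \int[gauss]_x (F (expR (- (a / 2)) * x)%R `^ p).
  have mFp : measurable_fun [set: R] (fun x => F (expR (- (a / 2)) * x)%R `^ p).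
    exact: (measurableT_comp (measurable_poweR _)).
  have mFp0 x : 0 <= F (expR (- (a / 2)) * x)%R `^ p by exact: poweR_ge0.
  rewrite -(gauss_scaling scale_m (fun x => F (expR (- (a / 2)) * x)%R `^ p) m0 mFp mFp0).
  apply: eq_integral => x _; rewrite /F' poweRM ?lee_fin ?expR_ge0//.
  congr (_ * _); first by congr (F _ `^ _); rewrite /scale_mu; ring.
  rewrite poweR_EFin -expRM; congr (expR _)%:E.
  by field; rewrite !gt_eqF.
have qc1 : (1 <= conj_q)%R by rewrite ler_pdivlMr//; lra.
have r2 : (scale_r ^+ 2 + scale_r' ^+ 2 = 1)%R.
  by rewrite scale_rE scale_r'E; field; rewrite gt_eqF.
have hyp : (scale_r ^+ 2 * (p^-1 * conj_q^-1) <= (1 - p^-1) * (1 - conj_q^-1))%R.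
  rewrite scale_rE /conj_q le_eqVlt; apply/orP; left; apply/eqP.
  by field; rewrite !gt_eqF.
have N := nelson p conj_q scale_r scale_r' (ltW p1) qc1 r0 r'0 r2 hyp F' H' mF' F'0 mH' H'0.
rewrite main; apply: (@le_trans _ _ (scale_m%:E *
  ((\int[gauss]_x (H' x `^ conj_q)) `^ conj_q^-1 * (\int[gauss]_x (F' x `^ p)) `^ p^-1))).
  by rewrite lee_wpmul2l// lee_fin ltW.
set X := \int[gauss]_x (H x `^ _) in H'q *.
set Y := \int[gauss]_x (F (_ * x)%R `^ _) in F'p *.
have X0 : 0 <= X by apply: integral_ge0 => x _; exact: poweR_ge0.
have Y0 : 0 <= Y by apply: integral_ge0 => x _; exact: poweR_ge0.
have li0 : (0 <= scale_lam^-1)%R by rewrite invr_ge0 ltW.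
have mi0 : (0 <= scale_m^-1)%R by rewrite invr_ge0 ltW.
rewrite H'q F'p (poweRM _ _ X0) ?lee_fin// (poweRM _ _ Y0) ?lee_fin// !poweR_EFin.
have assoc (A B C D E : \bar R) : A * (B * C * (D * E)) = A * (B * D) * (C * E).
  by rewrite (muleACA B); exact: muleA.
rewrite assoc -!EFinM le_eqVlt; apply/orP; left; apply/eqP.

congr (_%:E * _); rewrite /scale_constant.
have powV (x y : R) : (0 < x -> x^-1 `^ y = x `^ (- y))%R.
  by move=> x0; rewrite -mulN1r powRrM powR_inv1// ltW.
rewrite !powV//.
have -> : (1 - 1 / p = 1 + - p^-1)%R by rewrite div1r.
have -> : (1 / q - 1 = - conj_q^-1)%R.
  by rewrite /conj_q; field; rewrite !gt_eqF.
rewrite powRD; last by rewrite (gt_eqF m0) implybT.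
by rewrite powRr1 ?(ltW m0)// mulrA mulrAC.
Qed.

End constants.

(** * Tensorization *)

Section tuples.
Context {R : realType}.

Definition tuple_scale (c : R) {n} (x : n.-tuple R) : n.-tuple R :=
  [tuple c * tnth x i | i < n].

Definition tuple_lincomb (r s : R) {n} (x y : n.-tuple R) : n.-tuple R :=
  [tuple r * tnth x i + s * tnth y i | i < n].

Lemma measurable_cons_tuple n :
  measurable_fun [set: R * n.-tuple R] (@cons_pair R n).
Proof. by apply: measurable_cons; [exact: measurable_fst|exact: measurable_snd]. Qed.

Lemma measurable_tuple_scale (c : R) n :
  measurable_fun [set: n.-tuple R] (tuple_scale c).
Proof.
apply/measurable_fun_tnthP => i; rewrite (_ : _ \o _ = fun x => c * tnth x i).
  by apply: measurable_funM => //; exact: measurable_tnth.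
by apply/funext => x /=; rewrite tnth_mktuple.
Qed.

Lemma measurable_tuple_lincomb (r s : R) n :
  measurable_fun [set: n.-tuple R * n.-tuple R] (fun p => tuple_lincomb r s p.1 p.2).
Proof.
apply/measurable_fun_tnthP => i.
rewrite (_ : _ \o _ = fun p => r * tnth p.1 i + s * tnth p.2 i).
  apply: measurable_funD; apply: measurable_funM => //.
    exact: (measurableT_comp (measurable_tnth i) measurable_fst).
  exact: (measurableT_comp (measurable_tnth i) measurable_snd).
by apply/funext => p /=; rewrite tnth_mktuple.
Qed.

Lemma tuple_scale_cons (c x : R) n (y : n.-tuple R) :
  tuple_scale c (cons_pair (x, y)) = cons_pair (c * x, tuple_scale c y).
Proof.
apply: eq_from_tnth => i; rewrite tnth_mktuple.
by case: (unliftP ord0 i) => [j|] -> //=; rewrite !tnthS tnth_mktuple.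
Qed.

Lemma tuple_lincomb_cons (r s x y : R) n (u v : n.-tuple R) :
  tuple_lincomb r s (cons_pair (x, u)) (cons_pair (y, v)) =
  cons_pair (r * x + s * y, tuple_lincomb r s u v).
Proof.
apply: eq_from_tnth => i; rewrite tnth_mktuple.
by case: (unliftP ord0 i) => [j|] -> //=; rewrite !tnthS tnth_mktuple.
Qed.

Local Open Scope ereal_scope.

Lemma ge0_integral_stdGaussianS n (g : n.+1.-tuple R -> \bar R) :
  measurable_fun [set: n.+1.-tuple R] g -> (forall x, 0 <= g x) ->
  \int[stdGaussian R n.+1]_x g x =
  \int[gauss]_x \int[stdGaussian R n]_y g (cons_pair (x, y)).
Proof.
move=> mg g0.
have mgc : measurable_fun [set: measurableTypeR R * n.-tuple R]
    (fun p => g (cons_pair p)).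
  exact: (measurableT_comp mg (@measurable_cons_pair R n)).
rewrite [LHS](@ge0_integral_distribution _ _ _ _ R
  (normal_prob 0 1 \x stdGaussian R n) (@cons_pair R n) g mg g0).
rewrite [LHS](@fubini_tonelli1 _ _ _ _ R (normal_prob 0 1) (stdGaussian R n)
  (fun p => g (cons_pair p)) mgc (fun p => g0 _)).
apply: ge0_integral_gauss; last by move=> x; exact: integral_ge0.
exact: (@measurable_fun_fubini_tonelli_F _ _ _ _ R (stdGaussian R n)
  (fun p => g (cons_pair p)) (measurableT_comp mg (measurable_cons_tuple n)) (fun p => g0 _)).
Qed.

(** Induction on n by Fubini's theorem: for fixed first coordinates the induction
    hypothesis bounds the integral over the others by a product of a function of
    x and a function of r x + s y, the partial norms of h and f, and the
    inequality on the line applies to these. *)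
Lemma tensorized (r s d C p q : R) : (0 <= C)%R -> (0 < p)%R -> (0 < q)%R ->
  (forall F H : R -> \bar R,
    measurable_fun [set: R] F -> (forall x, 0 <= F x) ->
    measurable_fun [set: R] H -> (forall x, 0 <= H x) ->
    \int[gauss]_x \int[gauss]_z (H x * F (r * x + s * z)%R) <=
    C%:E * ((\int[gauss]_x (H x `^ q)) `^ q^-1 *
     (\int[gauss]_x (F (d * x)%R `^ p)) `^ p^-1)) ->
  forall n (f h : n.-tuple R -> \bar R),
    measurable_fun [set: n.-tuple R] f -> (forall x, 0 <= f x) ->
    measurable_fun [set: n.-tuple R] h -> (forall x, 0 <= h x) ->
    \int[stdGaussian R n]_x \int[stdGaussian R n]_z (h x * f (tuple_lincomb r s x z)) <=
    (C ^+ n)%:E * ((\int[stdGaussian R n]_x (h x `^ q)) `^ q^-1 *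
     (\int[stdGaussian R n]_x (f (tuple_scale d x) `^ p)) `^ p^-1).
Proof.
move=> C0 p0 q0 line; elim=> [|n IH] f h mf f0 mh h0.
  have dir (g : 0.-tuple R -> \bar R) : \int[stdGaussian R 0]_x g x = g [tuple].
    transitivity (\int[stdGaussian R 0]_x (g [tuple])); last exact: integral_prob_cst.
    by apply: eq_integral => x _; rewrite (tuple0 x).
  rewrite !dir expr0 mul1e -!poweRrM !mulfV ?gt_eqF// !poweRe1//.
  by rewrite [X in f X]tuple0 [X in _ <= _ * f X]tuple0.
set g := stdGaussian R n.
have mcons := measurable_cons_tuple n.
have mcx (x : R) : measurable_fun [set: n.-tuple R] (fun y => cons_pair (x, y)).
  exact: (measurableT_comp mcons (measurable_pair1 x)).
have mhq : measurable_fun [set: R * n.-tuple R] (fun t => h (cons_pair t) `^ q).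
  exact: (measurableT_comp (measurable_poweR _) (measurableT_comp mh mcons)).
have mfp : measurable_fun [set: R * n.-tuple R]
    (fun t => f (cons_pair (t.1, tuple_scale d t.2)) `^ p).
  apply: (measurableT_comp (measurable_poweR _)); apply: (measurableT_comp mf).
  apply: (measurableT_comp mcons); apply: measurable_fun_pair; first exact: measurable_fst.
  exact: (measurableT_comp (measurable_tuple_scale d n) measurable_snd).
pose HH x := \int[g]_y (h (cons_pair (x, y)) `^ q).
pose FF x := \int[g]_y (f (cons_pair (x, tuple_scale d y)) `^ p).
have HH0 x : 0 <= HH x by apply: integral_ge0 => y _; exact: poweR_ge0.
have FF0 x : 0 <= FF x by apply: integral_ge0 => y _; exact: poweR_ge0.
have mHH : measurable_fun [set: R] HH.
  exact: (@measurable_fun_fubini_tonelli_F _ _ _ _ R g _ mhq (fun t => poweR_ge0 _ _)).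
have mFF : measurable_fun [set: R] FF.
  exact: (@measurable_fun_fubini_tonelli_F _ _ _ _ R g _ mfp (fun t => poweR_ge0 _ _)).
pose H x := HH x `^ q^-1; pose F x := FF x `^ p^-1.
have H0 x : 0 <= H x by exact: poweR_ge0.
have F0 x : 0 <= F x by exact: poweR_ge0.
have mH : measurable_fun [set: R] H by exact: (measurableT_comp (measurable_poweR _) mHH).
have mF : measurable_fun [set: R] F by exact: (measurableT_comp (measurable_poweR _) mFF).
have mlin : measurable_fun [set: R * R] (fun t : R * R => r * t.1 + s * t.2)%R.
  by apply: measurable_funD; exact: measurable_funM.
have Hq x : H x `^ q = HH x by rewrite /H -poweRrM mulVf ?gt_eqF// poweRe1.
have Fp x : F x `^ p = FF x by rewrite /F -poweRrM mulVf ?gt_eqF// poweRe1.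
have hE : \int[stdGaussian R n.+1]_x (h x `^ q) = \int[gauss]_x (H x `^ q).
  rewrite ge0_integral_stdGaussianS; last 2 first.
  - exact: (measurableT_comp (measurable_poweR _) mh).
  - by move=> x; exact: poweR_ge0.
  by apply: eq_integral => x _; rewrite Hq.
have fE : \int[stdGaussian R n.+1]_x (f (tuple_scale d x) `^ p) =
    \int[gauss]_x (F (d * x)%R `^ p).
  rewrite ge0_integral_stdGaussianS; last 2 first.
  - apply: (measurableT_comp (measurable_poweR _)).
    exact: (measurableT_comp mf (measurable_tuple_scale d n.+1)).
  - by move=> x; exact: poweR_ge0.
  apply: eq_integral => x _; rewrite Fp; apply: eq_integral => y _.
  by rewrite tuple_scale_cons.
rewrite hE fE.
(* the integrand as a function of the four groups of variables *)
pose K (x : R) (u : n.-tuple R) (y : R) (v : n.-tuple R) :=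
  h (cons_pair (x, u)) * f (cons_pair (r * x + s * y, tuple_lincomb r s u v)%R).
have K0 x u y v : 0 <= K x u y v by exact: mule_ge0.
pose L (t : n.+1.-tuple R * n.+1.-tuple R) := h t.1 * f (tuple_lincomb r s t.1 t.2).
have L0 t : 0 <= L t by exact: mule_ge0.
have mL : measurable_fun [set: n.+1.-tuple R * n.+1.-tuple R] L.
  apply: emeasurable_funM; first exact: (measurableT_comp mh measurable_fst).
  exact: (measurableT_comp mf (measurable_tuple_lincomb r s n.+1)).
have LK x u y v : L (cons_pair (x, u), cons_pair (y, v)) = K x u y v.
  by rewrite /L /K /= tuple_lincomb_cons.
have LHS_E : \int[stdGaussian R n.+1]_x \int[stdGaussian R n.+1]_z
      (h x * f (tuple_lincomb r s x z)) =
    \int[gauss]_x \int[g]_u \int[gauss]_y \int[g]_v K x u y v.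
  rewrite ge0_integral_stdGaussianS; last 2 first.
  - exact: (@measurable_fun_fubini_tonelli_F _ _ _ _ R (stdGaussian R n.+1) L mL L0).
  - by move=> x; apply: integral_ge0 => z _; exact: mule_ge0.
  apply: eq_integral => x _; apply: eq_integral => u _.
  rewrite ge0_integral_stdGaussianS; last 2 first.
  - exact: (measurableT_comp mL (measurable_pair1 (cons_pair (x, u)))).
  - by move=> z; exact: mule_ge0.
  apply: eq_integral => y _; apply: eq_integral => v _; exact: LK.
have mK x : measurable_fun [set: (n.-tuple R * R) * n.-tuple R]
    (fun t => K x t.1.1 t.1.2 t.2).
  have -> : (fun t : (n.-tuple R * R) * n.-tuple R => K x t.1.1 t.1.2 t.2) =
      L \o (fun t => (cons_pair (x, t.1.1), cons_pair (t.1.2, t.2))).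
    by apply/funext => t /=; rewrite LK.
  apply: (measurableT_comp mL); apply: measurable_fun_pair.
    apply: (measurableT_comp (mcx x)).
    exact: (measurableT_comp measurable_fst measurable_fst).
  apply: (measurableT_comp mcons); apply: measurable_fun_pair; last exact: measurable_snd.
  exact: (measurableT_comp measurable_snd measurable_fst).
have swap x : \int[g]_u \int[gauss]_y \int[g]_v K x u y v =
    \int[gauss]_y \int[g]_u \int[g]_v K x u y v.
  have mI := @measurable_fun_fubini_tonelli_F _ _ _ _ R g _ (mK x) (fun t => K0 _ _ _ _).
  exact: (@fubini_tonelli _ _ _ _ R g gauss _ mI (fun t => integral_ge0 _ (fun v _ => K0 _ _ _ _))).
have inner x y : \int[g]_u \int[g]_v K x u y v <=
    (C ^+ n)%:E * (H x * F (r * x + s * y)%R).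
  apply: (IH (fun u => f (cons_pair (r * x + s * y, u)%R)) (fun u => h (cons_pair (x, u)))).
  - exact: (measurableT_comp mf (mcx _)).
  - by move=> u; exact: f0.
  - exact: (measurableT_comp mh (mcx _)).
  - by move=> u; exact: h0.
have Cn0 : (0 <= C ^+ n)%R by exact: exprn_ge0.
have mHF : measurable_fun [set: R * R] (fun t : R * R => H t.1 * F (r * t.1 + s * t.2)%R).
  apply: emeasurable_funM; first exact: (measurableT_comp mH measurable_fst).
  exact: (measurableT_comp mF mlin).
have mHFx x : measurable_fun [set: R] (fun y => H x * F (r * x + s * y)%R).
  exact: (measurableT_comp mHF (measurable_pair1 x)).
have HF0 (t : R * R) : 0 <= H t.1 * F (r * t.1 + s * t.2)%R by exact: mule_ge0.
have mHFI : measurable_fun [set: R] (fun x => \int[gauss]_y (H x * F (r * x + s * y)%R)).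
  exact: (@measurable_fun_fubini_tonelli_F _ _ _ _ R gauss _ mHF HF0).
have mLout : measurable_fun [set: R * (n.-tuple R)]
   (fun t => \int[stdGaussian R n.+1]_z L (cons_pair t, z)).
  have mI := @measurable_fun_fubini_tonelli_F _ _ _ _ R (stdGaussian R n.+1) L mL L0.
  exact: (measurableT_comp mI mcons).
have mLE x u : \int[gauss]_y \int[g]_v K x u y v =
    \int[stdGaussian R n.+1]_z L (cons_pair (x, u), z).
  rewrite ge0_integral_stdGaussianS; last 2 first.
  - exact: (measurableT_comp mL (measurable_pair1 (cons_pair (x, u)))).
  - by move=> z; exact: mule_ge0.
  by apply: eq_integral => y _; apply: eq_integral => v _; rewrite LK.
rewrite LHS_E.
apply: (@le_trans _ _ (\int[gauss]_x ((C ^+ n)%:E *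
   \int[gauss]_y (H x * F (r * x + s * y)%R)))).
  apply: ge0_le_integral => //.
  - move=> x _; apply: integral_ge0 => u _; apply: integral_ge0 => y _.
    by apply: integral_ge0 => v _; exact: K0.
  - have -> : (fun x => \int[g]_u \int[gauss]_y \int[g]_v K x u y v) =
       (fun x => \int[g]_u \int[stdGaussian R n.+1]_z L (cons_pair (x, u), z)).
      by apply/funext => x; apply: eq_integral => u _; exact: mLE.
    exact: (@measurable_fun_fubini_tonelli_F _ _ _ _ R g _ mLout
      (fun t => integral_ge0 _ (fun z _ => L0 _))).
  - exact: (emeasurable_funM (measurable_cst _) mHFI).
  - move=> x _; rewrite swap -ge0_integralZl; last 4 first.
    + by [].
    + exact: mHFx.
    + by move=> y _; exact: (HF0 (x, y)).
    + by rewrite lee_fin.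
    apply: ge0_le_integral => //.
    + by move=> y _; apply: integral_ge0 => u _; apply: integral_ge0 => v _; exact: K0.
    + have mI := @measurable_fun_fubini_tonelli_F _ _ _ _ R g _ (mK x) (fun t => K0 _ _ _ _).
      exact: (@measurable_fun_fubini_tonelli_G _ _ _ _ R g _ mI
        (fun t => integral_ge0 _ (fun v _ => K0 _ _ _ _))).
    + exact: (emeasurable_funM (measurable_cst _) (mHFx x)).
rewrite ge0_integralZl; last 4 first.
- by [].
- exact: mHFI.
- by move=> x _; apply: integral_ge0 => y _; exact: (HF0 (x, y)).
- by rewrite lee_fin.
rewrite exprSr EFinM -muleA; apply: lee_wpmul2l; first by rewrite lee_fin.
exact: line.
Qed.

End tuples.

(** * Duality and the theorem *)

Section duality.
Context {R : realType}.
Local Open Scope ereal_scope.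

(** Test against h = u^(1/q') with u the truncation of g^q at height n, and q' the
    exponent conjugate to q. Then h g >= u, so that the integral I of u satisfies
    I <= B I^(1/q'); it is finite, hence I^(1/q) <= B. *)
Lemma norm_le_dual d (T : measurableType d) (P : probability T R) (q : R)
    (g : T -> \bar R) (B : \bar R) : (1 < q)%R -> 0 <= B ->
  measurable_fun [set: T] g -> (forall x, 0 <= g x) ->
  (forall h : T -> \bar R, measurable_fun [set: T] h -> (forall x, 0 <= h x) ->
     \int[P]_x (h x * g x) <= B * (\int[P]_x (h x `^ conj_q q)) `^ (conj_q q)^-1) ->
  (\int[P]_x (g x `^ q)) `^ q^-1 <= B.
Proof.
move=> q1 B0 mg g0 dual.
have [q0 q10] : (0 < q /\ 0 < q - 1)%R by move: q1 => ?; split; lra.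
have qc0 : (0 < conj_q q)%R by rewrite divr_gt0.
have qqc : (q^-1 + (conj_q q)^-1 = 1)%R by rewrite /conj_q; field; rewrite !gt_eqF.
have qi0 : (0 <= q^-1)%R by rewrite invr_ge0 ltW.
have qci0 : (0 <= (conj_q q)^-1)%R by rewrite invr_ge0 ltW.
(* truncating g ^ q itself reduces the convergence of u n x to that of min(y, n)
   to y *)
pose u n x := mine (g x `^ q) n%:R%:E.
have u0 n x : 0 <= u n x by rewrite le_min poweR_ge0 lee_fin/=.
have mgq : measurable_fun [set: T] (fun x => g x `^ q).
  exact: (measurableT_comp (measurable_poweR _) mg).
have mu n : measurable_fun [set: T] (u n).
  by apply: measurable_mine => //; exact: mgq.
have bound n : \int[P]_x u n x <= B `^ q.
  have I0 : 0 <= \int[P]_x u n x by exact: integral_ge0.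
  have Ifin : \int[P]_x u n x \is a fin_num.
    rewrite ge0_fin_numE// (@le_lt_trans _ _ n%:R%:E) ?ltry//.
    rewrite -[leRHS](integral_prob_cst _ _ P); apply: ge0_le_integral => //.
    by move=> x _; rewrite ge_min lexx orbT.
  have main : \int[P]_x u n x <= B * (\int[P]_x u n x) `^ (conj_q q)^-1.
    have mh : measurable_fun [set: T] (fun x => u n x `^ (conj_q q)^-1).
      exact: (measurableT_comp (measurable_poweR _) (mu n)).
    have := dual (fun x => u n x `^ (conj_q q)^-1) mh (fun x => poweR_ge0 _ _).
    have -> : \int[P]_x ((u n x `^ (conj_q q)^-1) `^ conj_q q) = \int[P]_x u n x.
      apply: eq_integral => x _.
      by rewrite -poweRrM mulVf ?gt_eqF// poweRe1.
    apply: le_trans; apply: ge0_le_integral => //.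
    - exact: emeasurable_funM.
    - move=> x _.
      have ufin : u n x \is a fin_num.
        by rewrite ge0_fin_numE// (@le_lt_trans _ _ n%:R%:E) ?ltry// ge_min lexx orbT.
      apply: (@le_trans _ _ (u n x `^ (conj_q q)^-1 * u n x `^ q^-1)).
        move: (u0 n x); rewrite -(fineK ufin) lee_fin => v0.
        rewrite !poweR_EFin -EFinM -powRD; last by rewrite addrC qqc oner_eq0.
        by rewrite addrC qqc powRr1.
      apply: lee_wpmul2l; first exact: poweR_ge0.
      rewrite -[leRHS]poweRe1// -(mulfV (lt0r_neq0 q0)) poweRrM.
      by apply: le_poweR => //; rewrite ge_min lexx.
  move: I0 main; rewrite -(fineK Ifin) lee_fin; set r := fine _.
  rewrite le_eqVlt => /predU1P[<- _|r0]; first exact: poweR_ge0.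
  move: B0; case: (B) => [b| |]//; last by rewrite poweRyr ?gt_eqF// => _ _; exact: leey.
  rewrite lee_fin => b0; rewrite !poweR_EFin -EFinM !lee_fin.
  have rE : (r = r `^ q^-1 * r `^ (conj_q q)^-1)%R.
    by rewrite -powRD ?qqc ?oner_eq0// powRr1// ltW.
  rewrite [X in (X <= _)%R -> _]rE ler_pM2r ?powR_gt0// => rb.
  rewrite -[leLHS]powRr1 ?(ltW r0)// -(mulVf (lt0r_neq0 q0)) powRrM.
  by apply: ge0_ler_powR; rewrite ?nnegrE ?powR_ge0 ?(ltW q0).
have gE x : g x `^ q = limn (u ^~ x).
  by apply/esym/cvg_lim => //; apply: cvg_mine_natr; exact: poweR_ge0.
have nd x : {homo u ^~ x : m n / (m <= n)%N >-> m <= n}.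
  by move=> m n mn; rewrite le_min ge_min lexx/= ge_min lee_fin ler_nat mn orbT.
have le_q : \int[P]_x (g x `^ q) <= B `^ q.
  under eq_integral do rewrite gE.
  rewrite monotone_convergence//.
  apply: lime_le; last exact: nearW.
  apply: ereal_nondecreasing_is_cvgn => m n mn.
  by apply: ge0_le_integral => // x _; exact: nd.
rewrite -[leRHS]poweRe1// -(mulfV (lt0r_neq0 q0)) poweRrM.
by apply: le_poweR => //; apply: integral_ge0 => x _; exact: poweR_ge0.
Qed.

End duality.

Section ornstein_uhlenbeck.
Context {R : realType}.
Local Open Scope ereal_scope.

Lemma ornsteinUhlenbeckE (t : R) n (f : n.-tuple R -> R) (x : n.-tuple R) :
  ornsteinUhlenbeck t f x =
  \int[stdGaussian R n]_y (f (tuple_lincomb (ou_s t) (ou_sg t) x y))%:E.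
Proof. by rewrite /ornsteinUhlenbeck unlock. Qed.

Lemma measurable_ornsteinUhlenbeck (t : R) n (f : n.-tuple R -> R) :
  measurable_fun [set: n.-tuple R] f ->
  measurable_fun [set: n.-tuple R] (ornsteinUhlenbeck t f).
Proof.
move=> mf.
pose G (p : n.-tuple R * n.-tuple R) :=
  (f (tuple_lincomb (ou_s t) (ou_sg t) p.1 p.2))%:E.
have mG : measurable_fun [set: n.-tuple R * n.-tuple R] G.
  by apply/measurable_EFinP; exact: (measurableT_comp mf (measurable_tuple_lincomb _ _ n)).
rewrite (_ : ornsteinUhlenbeck t f = fun x =>
    \int[stdGaussian R n]_y (G^\+ (x, y)) - \int[stdGaussian R n]_y (G^\- (x, y))).
  apply: emeasurable_funB.
    exact: (@measurable_fun_fubini_tonelli_F _ _ _ _ R _ _ (measurable_funepos mG)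
      (fun _ => funepos_ge0 _ _)).
  exact: (@measurable_fun_fubini_tonelli_F _ _ _ _ R _ _ (measurable_funeneg mG)
      (fun _ => funeneg_ge0 _ _)).
apply/funext => x; rewrite ornsteinUhlenbeckE integralE.
by congr (_ - _); apply: eq_integral => y _; rewrite ?funeposE ?funenegE.

Qed.

End ornstein_uhlenbeck.

Theorem mainTheorem3 (R : realType) (n : nat) (hn : (1 <= n)%N)
    (t a q1 q2 : R) (ht : 0 < t) (hq1 : 1 < q1) (hq12 : q1 < q2)
    (hq : q2 - 1 = expR (2 * t) * (q1 * expR (- a) - 1))
    (f : n.-tuple R -> R) (mf : measurable_fun [set: n.-tuple R] f)
    (hf : ('N[stdGaussian R n]_(q1%:E) [EFin \o dilation (- a) f] < +oo)%E) :
  let M := ((q1 - 1) / expR (- (2 * t))) `^ (1 - 1 / q1)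
           * ((q2 - 1) / expR (- a)) `^ (1 / q2 - 1)
           * ((1 - expR (- (2 * t))) / (q2 - q1)) `^ (1 / q2 - 1 / q1) in
  ('N[stdGaussian R n]_(q2%:E) [ornsteinUhlenbeck t f]
    <= (M `^ (n%:R / 2))%:E
       * 'N[stdGaussian R n]_(q1%:E) [EFin \o dilation (- a) f])%E.
Proof.
cbv zeta; set M := (X in (X `^ (n%:R / 2))%:E).
have [p0 q20 q21] : [/\ 0 < q1, 0 < q2 & 1 < q2] by move: hq1 hq12 => *; split; lra.
have qc0 : 0 < conj_q q2 by rewrite divr_gt0// subr_gt0.
set C := scale_constant t a q1 q2.
have C0 : 0 <= C by rewrite mulr_ge0// powR_ge0.
have ME : M `^ (n%:R / 2) = C ^+ n.
  rewrite /C -(scale_constantE t a q1 q2 ht hq1 hq12) -/M.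
  by rewrite -powR_mulrn ?powR_ge0// -powRrM div1r mulrC.
rewrite {}ME; move: M => _.
set g := stdGaussian R n.
set N := ('N[_]_(q1%:E)[_])%E.
have NE : N = ((\int[g]_x (`|f (tuple_scale (expR (- (a / 2))) x)|%:E `^ q1)) `^ q1^-1)%E.
  rewrite /N Lnorm.unlock.
  apply: (congr1 (fun I => I `^ q1^-1)%E); apply: eq_integral => x _.
  by rewrite /= /dilation mulNr.
pose F y := (`|f y|%:E)%E.
have F0 y : (0 <= F y)%E by rewrite lee_fin.
have mF : measurable_fun [set: n.-tuple R] F.
  by apply/measurable_EFinP; exact: (measurableT_comp (@normr_measurable _ _) mf).
pose L x y := F (tuple_lincomb (ou_s t) (ou_sg t) x y).
have mL : measurable_fun [set: n.-tuple R * n.-tuple R] (fun p => L p.1 p.2).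
  exact: (measurableT_comp mF (measurable_tuple_lincomb _ _ n)).
have L0 x y : (0 <= L x y)%E by exact: F0.
pose G x := (\int[g]_y L x y)%E.
have G0 x : (0 <= G x)%E by apply: integral_ge0 => y _; exact: L0.
have mG : measurable_fun [set: n.-tuple R] G.
  exact: (@measurable_fun_fubini_tonelli_F _ _ _ _ R g _ mL (fun p => L0 _ _)).
have mLx x : measurable_fun [set: n.-tuple R] (L x).
  exact: (measurableT_comp mL (measurable_pair1 x)).
apply: (@le_trans _ _ ((\int[g]_x (G x `^ q2)) `^ q2^-1)%E).
  rewrite Lnorm.unlock; apply: le_poweR.
  - by rewrite invr_ge0 ltW.
  - by apply: integral_ge0 => x _; exact: poweR_ge0.
  - apply: ge0_le_integral => //.
    + by move=> x _; exact: poweR_ge0.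
    + apply: (measurableT_comp (measurable_poweR _)).
      apply: measurableT_comp; first exact: abse_measurable.
      exact: (measurable_ornsteinUhlenbeck t n f mf).
    + exact: (measurableT_comp (measurable_poweR _) mG).
    + move=> x _; apply: le_poweR; [exact: ltW|exact: abse_ge0|].
      rewrite ornsteinUhlenbeckE; apply: (le_trans (le_abse_integral _ _ _)) => //.
      apply/measurable_EFinP; apply: (measurableT_comp mf).
      exact: (measurableT_comp (measurable_tuple_lincomb _ _ n) (measurable_pair1 x)).
apply: norm_le_dual => //.
  by apply: mule_ge0; [rewrite lee_fin; exact: exprn_ge0|exact: Lnorm_ge0].
move=> h mh h0.
have line := line_inequality t a q1 q2 ht hq1 hq12 hq.
have := tensorized (ou_s t) (ou_sg t) (expR (- (a / 2))) C q1 (conj_q q2) C0 p0 qc0 line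
  n F h mF F0 mh h0.
rewrite -NE -/g.
have -> : (\int[g]_x \int[g]_z (h x * F (tuple_lincomb (ou_s t) (ou_sg t) x z)) =
    \int[g]_x (h x * G x))%E.
  by apply: eq_integral => x _; rewrite ge0_integralZl//; exact: mLx.
by rewrite -muleA [X in _ -> (_ <= _ * X)%E]muleC.
Qed.
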